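(* Let $(X,d,\mu)$ be an unbounded doubling metric measure space, let $p\in\mathbb{P}(X)$, and suppose there exist a ball $B(x_0,R)$, $x_0\in X$, $R>0$, and a constant $p_\infty$ such that $p(x)\equiv p_\infty$ for $x\in X\setminus B(x_0,R)$. Let $x_1,\dots,x_N\in X$ be distinct points and $$\varrho(x)=w_0(1+d(x_0,x))\prod_{k=1}^N w_k(d(x,x_k)),$$ where $w_k\in\widetilde{W}(\mathbb{R}^1_+)$ for $k=0,1,\dots,N$. Suppose that $$-\frac{m(\mu B)}{p(x_k)}<m(w_k)\le M(w_k)<\frac{m(\mu B)}{p'(x_k)},\qquad k=1,\dots,N,$$ and $$-\frac{m_\infty(\mu B)}{p_\infty}<\sum_{k=0}^N m_\infty(w_k)\le\sum_{k=0}^N M_\infty(w_k)<\frac{m_\infty(\mu B)}{p'_\infty}-\Delta_{p_\infty},\qquad \Delta_{p_\infty}=\frac{M_\infty(\mu B)-m_\infty(\mu B)}{p_\infty},$$ where $p'_\infty=\frac{p_\infty}{p_\infty-1}$. Then the Hardy-Littlewood maximal operator $\mathcal{M}$ is bounded in $L^{p(\cdot)}(X,\varrho)$, i.e. there is a constant $C>0$ such that $\|\mathcal{M}f\|_{L^{p(\cdot)}(X,\varrho)}\le C\|f\|_{L^{p(\cdot)}(X,\varrho)}$ for all $f\in L^{p(\cdot)}(X,\varrho)$.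
   Context: A doubling metric measure space $(X,d,\mu)$ (space of homogeneous type) is a set $X$ with a quasimetric $d$ (that is, $d\ge 0$, $d(x,y)=0$ iff $x=y$, $d(x,y)=d(y,x)$, and $d(x,y)\le c_0[d(x,z)+d(z,y)]$ for a constant $c_0\ge 1$) and a non-negative Borel regular measure $\mu$ for which all balls $B(x,r)=\{y\in X: d(x,y)<r\}$ are measurable with $0<\mu B(x,r)<\infty$ and the doubling condition $\mu B(x,2r)\le C\mu B(x,r)$ holds with $C$ independent of $x\in X$ and $r>0$. $X$ is unbounded if $\sup_{x,y\in X}d(x,y)=\infty$. $\mathbb{P}(X)$ is the set of bounded measurable functions $p:X\to\mathbb{R}$ such that $1<p_-\le p(x)\le p^+<\infty$ for all $x\in X$, where $p_-=\inf_{x\in X}p(x)$ and $p^+=\sup_{x\in X}p(x)$, and for some constant $A>0$, $|p(x)-p(y)|\le A/\ln\frac{1}{d(x,y)}$ for all $x,y\in X$ with $0<d(x,y)\le\frac12$. The conjugate exponent is $p'(x)=\frac{p(x)}{p(x)-1}$. $L^{p(\cdot)}(X,\varrho)$ is the space of measurable $f:X\to\mathbb{C}$ with $$\|f\|_{L^{p(\cdot)}(X,\varrho)}=\inf\left\{\lambda>0:\int_X\left|\frac{\varrho(x)f(x)}{\lambda}\right|^{p(x)}d\mu(x)\le 1\right\}<\infty .$$ The maximal operator is $\displaystyle \mathcal{M}f(x)=\sup_{r>0}\frac{1}{\mu B(x,r)}\int_{B(x,r)}|f(y)|\,d\mu(y)$, $x\in X$. Uniform lower index of the measure: $$m(\mu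 B)=\lim_{t\to 0}\frac{\ln\left(\limsup\limits_{r\to 0}\ \sup\limits_{x\in X}\frac{\mu B(x,rt)}{\mu B(x,r)}\right)}{\ln t} =\sup_{t>1}\frac{\ln\left(\liminf\limits_{r\to 0}\ \inf\limits_{x\in X}\frac{\mu B(x,rt)}{\mu B(x,r)}\right)}{\ln t}.$$ Lower and upper dimensions at infinity (these numbers do not depend on the choice of $x\in X$): $$m_\infty(\mu B)=\sup_{t>1}\frac{\ln\left(\liminf\limits_{r\to\infty}\frac{\mu B(x,rt)}{\mu B(x,r)}\right)}{\ln t},\qquad M_\infty(\mu B)=\inf_{t>1}\frac{\ln\left(\limsup\limits_{r\to\infty}\frac{\mu B(x,rt)}{\mu B(x,r)}\right)}{\ln t}.$$ A non-negative function $u$ is almost increasing if $u(s)\le Cu(t)$ for all $s\le t$ with some constant $C>0$. $\widetilde{W}(\mathbb{R}^1_+)$ is the set of continuous positive functions $w$ on $(0,\infty)$ whose restriction to $(0,1]$ is in $\widetilde{W}([0,1])$ and whose restriction to $[1,\infty)$ is in $\widetilde{W}([1,\infty))$. Here $w\in\widetilde{W}([0,1])$ means that for some $a\in\mathbb{R}$ the function $t^aw(t)$ extends to a continuous function on $[0,1]$, positive for $t>0$ and almost increasing; and $w\in\widetilde{W}([1,\infty))$ means that for some $a\in\mathbb{R}$ the function $t^aw(t)$ is continuous, positive and almost increasing on $[1,\infty)$ and has a finite or infinite limit as $t\to\infty$. Indices of $w\in\widetilde{W}(\mathbb{R}^1_+)$ at $0$ and at infinity: $$m(w)=\sup_{t>1}\frac{\ln\left(\liminf\limits_{h\to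 0}\frac{w(ht)}{w(h)}\right)}{\ln t},\qquad M(w)=\inf_{t>1}\frac{\ln\left(\limsup\limits_{h\to 0}\frac{w(ht)}{w(h)}\right)}{\ln t},$$ $$m_\infty(w)=\sup_{t>1}\frac{\ln\left(\liminf\limits_{h\to\infty}\frac{w(th)}{w(h)}\right)}{\ln t},\qquad M_\infty(w)=\inf_{t>1}\frac{\ln\left(\limsup\limits_{h\to\infty}\frac{w(th)}{w(h)}\right)}{\ln t}.$$ *)

(* Defs.v *)
From HB Require Import structures.
From mathcomp Require Import all_boot all_order all_algebra.
From mathcomp Require Import all_classical all_reals all_analysis.
From mathcomp Require Import complex.

Set Implicit Arguments.
Unset Strict Implicit.
Unset Printing Implicit Defensive.

Import Order.TTheory GRing.Theory Num.Theory.
Import numFieldNormedType.Exports.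

Local Open Scope classical_set_scope.
Local Open Scope ring_scope.

Definition is_quasimetric (R : realType) (X : Type) (d : X -> X -> R) : Prop :=
  [/\ forall x y, 0 <= d x y,
      forall x y, d x y = 0 <-> x = y,
      forall x y, d x y = d y x &
      exists2 c0 : R, 1 <= c0 &
        forall x y z, d x y <= c0 * (d x z + d z y)].

Definition qball (R : realType) (X : Type) (d : X -> X -> R) (x : X) (r : R) :
  set X := [set y | d x y < r].

(* The balls of a quasimetric need not be open for the topology they induce. *)
Definition qopen (R : realType) (X : Type) (d : X -> X -> R) : set (set X) :=
  [set U | forall x, U x -> exists2 r : R, 0 < r & qball d x r `<=` U].

(* The sigma-algebra of [X] plays the role of the mu-measurable sets: it
   contains the Borel sets and each of its members has a Borel hull of the same
   measure. *)
Definition borel_regular (R : realType) (disp : measure_display)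
    (X : measurableType disp) (d : X -> X -> R)
    (mu : {measure set X -> \bar R}) : Prop :=
  (forall U, qopen d U -> measurable U) /\
  (forall A : set X, measurable A ->
     exists B : set X, [/\ <<s qopen d >> B, A `<=` B & mu B = mu A]).

Definition doubling_space (R : realType) (disp : measure_display)
    (X : measurableType disp) (d : X -> X -> R)
    (mu : {measure set X -> \bar R}) : Prop :=
  [/\ is_quasimetric d,
      borel_regular d mu,
      forall x r, measurable (qball d x r),
      forall x r, 0 < r -> (0 < mu (qball d x r) < +oo)%E &
      exists C : R, forall x r, 0 < r ->
        (mu (qball d x (2 * r)) <= C%:E * mu (qball d x r))%E].

Definition unbounded_space (R : realType) (X : Type) (d : X -> X -> R) : Prop :=
  ereal_sup [set (d xy.1 xy.2)%:E | xy in [set: X * X]] = +oo%E.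

Definition exponent_class (R : realType) (disp : measure_display)
    (X : measurableType disp) (d : X -> X -> R) (p : X -> R) : Prop :=
  [/\ measurable_fun setT p,
      (1 < ereal_inf (range (fun x => (p x)%:E)))%E,
      (ereal_sup (range (fun x => (p x)%:E)) < +oo)%E &
      exists2 A : R, 0 < A &
        forall x y, 0 < d x y -> d x y <= 2^-1 ->
          `|p x - p y| <= A / ln (1 / d x y)].

Definition conj_exp (R : realType) (p : R) : R := p / (p - 1).

(* The argument [g] is the modulus of a complex-valued function or a maximal
   function, hence takes its values in the extended reals. *)
Definition lp_norm (R : realType) (disp : measure_display)
    (X : measurableType disp) (mu : {measure set X -> \bar R})
    (p rho : X -> R) (g : X -> \bar R) : \bar R :=
  ereal_inf [set l%:E | l in [set l : R | 0 < l /\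
    (\int[mu]_x (`| (rho x)%:E * g x * (l^-1)%:E | `^ (p x)) <= 1)%E]].

Definition modulus (R : realType) (X : Type) (f : X -> R[i]) (x : X) : \bar R :=
  (Normc.normc (f x))%:E.

Definition lp_space (R : realType) (disp : measure_display)
    (X : measurableType disp) (mu : {measure set X -> \bar R})
    (p rho : X -> R) (f : X -> R[i]) : Prop :=
  [/\ measurable_fun setT (fun x => complex.Re (f x)),
      measurable_fun setT (fun x => complex.Im (f x)) &
      (lp_norm mu p rho (modulus f) < +oo)%E].

Definition maximal_function (R : realType) (disp : measure_display)
    (X : measurableType disp) (d : X -> X -> R)
    (mu : {measure set X -> \bar R}) (f : X -> R[i]) (x : X) : \bar R :=
  ereal_sup [set ((fine (mu (qball d x r)))^-1%:E *
                  \int[mu]_(y in qball d x r) modulus f y)%E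
            | r in [set r : R | 0 < r]].

(* [lower_index phi] is sup_{t>1} ln (phi t) / ln t and [upper_index phi] the
   corresponding infimum, with ln 0 = -oo and ln +oo = +oo. *)
Definition lower_index (R : realType) (phi : R -> \bar R) : \bar R :=
  ereal_sup [set (lne (phi t) * (ln t)^-1%:E)%E | t in [set t : R | 1 < t]].

Definition upper_index (R : realType) (phi : R -> \bar R) : \bar R :=
  ereal_inf [set (lne (phi t) * (ln t)^-1%:E)%E | t in [set t : R | 1 < t]].

Definition ball_ratio (R : realType) (disp : measure_display)
    (X : measurableType disp) (d : X -> X -> R)
    (mu : {measure set X -> \bar R}) (x : X) (t r : R) : \bar R :=
  (fine (mu (qball d x (r * t))) / fine (mu (qball d x r)))%:E.

Definition m_mu (R : realType) (disp : measure_display)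
    (X : measurableType disp) (d : X -> X -> R)
    (mu : {measure set X -> \bar R}) : \bar R :=
  lower_index (fun t => limf_einf
    (fun r : R => ereal_inf (range (fun x => ball_ratio d mu x t r))) 0^'+).

Definition m_mu_infty (R : realType) (disp : measure_display)
    (X : measurableType disp) (d : X -> X -> R)
    (mu : {measure set X -> \bar R}) (x : X) : \bar R :=
  lower_index (fun t => limf_einf (ball_ratio d mu x t) +oo%R).

Definition M_mu_infty (R : realType) (disp : measure_display)
    (X : measurableType disp) (d : X -> X -> R)
    (mu : {measure set X -> \bar R}) (x : X) : \bar R :=
  upper_index (fun t => limf_esup (ball_ratio d mu x t) +oo%R).

Definition almost_increasing (R : realType) (D : set R) (u : R -> R) : Prop :=
  (forall t, D t -> 0 <= u t) /\
  (exists2 C : R, 0 < C & forall s t, D s -> D t -> s <= t -> u s <= C * u t).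

Definition Wtilde01 (R : realType) (w : R -> R) : Prop :=
  exists (a : R) (v : R -> R),
    [/\ forall t, 0 < t -> t <= 1 -> v t = t `^ a * w t,
        {within `[0, 1], continuous v},
        forall t, 0 < t -> t <= 1 -> 0 < v t &
        almost_increasing `[0, 1] v].

Definition Wtilde1oo (R : realType) (w : R -> R) : Prop :=
  exists a : R, let v t := t `^ a * w t in
    [/\ {within `[1, +oo[, continuous v},
        forall t, 1 <= t -> 0 < v t,
        almost_increasing `[1, +oo[ v &
        exists l : \bar R, (v t)%:E @[t --> +oo%R] --> l].

(* Only the values of [w] on ]0, +oo[ matter. *)
Definition Wtilde (R : realType) (w : R -> R) : Prop :=
  [/\ {in `]0, +oo[, continuous w},
      forall t, 0 < t -> 0 < w t,
      Wtilde01 w &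
      Wtilde1oo w].

Definition dil_ratio (R : realType) (w : R -> R) (t h : R) : \bar R :=
  (w (h * t) / w h)%:E.

Definition m_idx (R : realType) (w : R -> R) : \bar R :=
  lower_index (fun t => limf_einf (dil_ratio w t) 0^'+).

Definition M_idx (R : realType) (w : R -> R) : \bar R :=
  upper_index (fun t => limf_esup (dil_ratio w t) 0^'+).

Definition m_idx_infty (R : realType) (w : R -> R) : \bar R :=
  lower_index (fun t => limf_einf (dil_ratio w t) +oo%R).

Definition M_idx_infty (R : realType) (w : R -> R) : \bar R :=
  upper_index (fun t => limf_esup (dil_ratio w t) +oo%R).

(* [w ord0] is w_0 and [w (lift ord0 k)] is the weight attached to [xs k]. *)
Definition radial_weight (R : realType) (X : Type) (d : X -> X -> R) (x0 : X)
    (N : nat) (xs : 'I_N -> X) (w : 'I_N.+1 -> R -> R) (x : X) : R :=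
  w ord0 (1 + d x0 x) * \prod_(k < N) w (lift ord0 k) (d x (xs k)).

(* Main.v *)
Require Import Defs.
From HB Require Import structures.
From mathcomp Require Import all_boot all_order all_algebra.
From mathcomp Require Import all_classical all_reals all_analysis.
From mathcomp Require Import complex.
From mathcomp Require Import measurable_realfun ring lra.

(** Write [F = |f| / l] with [l] such that the modular of [rho * F] is at most 1.
    It suffices to dominate [(rho(x) * average of F over B(x, r))^p(x)], off the
    null set of the points [x_k], by a function of [x] alone whose integral is
    bounded independently of [F].

    Near [x_k] the log-condition on [p] makes [rho^p] comparable to
    [w_k(d(., x_k))^p(x_k)], and the index bounds place this radial weight in the
    Muckenhoupt class [A_s] for some [s < p(x_k)].  Away from the [x_k], on bounded
    sets, [rho^p] is comparable to 1.  On small balls, where [v] is the comparison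
    weight, Diening's argument bounds [(average of F)^p(x)] by a multiple of
    [(1 + a)^t], where [t > 1] and [a] is the [v]-average of [F^(p/t)]; the loss is
    [(1 + a)^(osc p)], which the log-condition keeps bounded.  This reduces the
    estimate to the boundedness in [L^t(v)] of the maximal operator of the doubling
    measure [v d mu], which follows from Vitali's covering lemma.

    Outside a bounded set [p] is constant and [rho^p] is again a radial [A_s]
    weight, whose exponents are the sums of those of the [w_k]; the bounded part of
    [F] is replaced there by the indicator of a ball, since it only enters through
    its integral, which the modular controls. *)

Set Implicit Arguments.
Unset Strict Implicit.
Unset Printing Implicit Defensive.

Import Order.TTheory GRing.Theory Num.Theory.
Import numFieldNormedType.Exports.

Local Open Scope classical_set_scope.
Local Open Scope ring_scope.

(** * Integrals of real-valued functions *)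

(** Measurability of the maximal function is never established, and the radii are uncountable. Every
    estimate is therefore stated as the existence of one measurable majorant valid for all radii,
    built from a countable family of balls; the supremum over radii is taken only at the end,
    pointwise. The gap between s and the exponent is what leaves room for t > 1: s pays for the
    passage from dmu to v dmu, and t is spent on the maximal operator of v dmu, under the constraint
    s t <= p. The additive 1 in (1 + a)^t costs a multiple of v, which is integrable over a bounded
    set; for distant points the constant exponent gives an estimate without it. One regime remains:
    points of a bounded set with radii bounded below. There A_s bounds the averages by a constant,
    and rho^p is integrable over bounded sets. *)

Section nonneg_integral.
Import HBNNSimple.
Context (R : realType) (disp : measure_display) (X : measurableType disp).
Variable mu : {measure set X -> \bar R}.
Implicit Types (f g : X -> R).

(** No measurability is asked of either side: the integral of a non-negative function is a supremum
    over the simple functions below it. The modular of the maximal function is compared with its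
    majorant in this way. *)
Lemma le_integral_ge0 (f g : X -> \bar R) : (forall x, 0 <= f x)%E ->
  (forall x, f x <= g x)%E -> (\int[mu]_x f x <= \int[mu]_x g x)%E.
Proof.
move=> f0 fg.
rewrite !ge0_integralTE//; last by move=> x; exact: le_trans (fg x).
apply: ereal_sup_le => _ [h /= hf <-].
by exists h => //= x; exact: le_trans (fg x).
Qed.

Definition nint (f : X -> R) : \bar R := \int[mu]_x (f x)%:E.

Lemma nint_ge0 f : (forall x, 0 <= f x) -> (0 <= nint f)%E.
Proof. by move=> f0; apply: integral_ge0 => x _; rewrite lee_fin. Qed.

Lemma le_nint f g : (forall x, 0 <= f x) -> (forall x, f x <= g x) ->
  (nint f <= nint g)%E.
Proof.
by move=> f0 fg; apply: le_integral_ge0 => x; rewrite lee_fin.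
Qed.

Lemma eq_nint f g : f =1 g -> nint f = nint g.
Proof. by move=> fg; apply: eq_integral => x _; rewrite fg. Qed.

Lemma nintD f g : measurable_fun setT f -> measurable_fun setT g ->
  (forall x, 0 <= f x) -> (forall x, 0 <= g x) ->
  nint (fun x => f x + g x) = (nint f + nint g)%E.
Proof.
move=> mf mg f0 g0; rewrite /nint -ge0_integralD//.
- by move=> x _; rewrite lee_fin.
- exact/measurable_EFinP.
- by move=> x _; rewrite lee_fin.
- exact/measurable_EFinP.
Qed.

Lemma nintZ k f : measurable_fun setT f -> (forall x, 0 <= f x) -> 0 <= k ->
  nint (fun x => k * f x) = (k%:E * nint f)%E.
Proof.
move=> mf f0 k0; rewrite /nint -ge0_integralZl_EFin//.
- by move=> x _; rewrite lee_fin.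
- exact/measurable_EFinP.
Qed.

Lemma nint_sum (I : Type) (s : seq I) (F : I -> X -> R) :
  (forall i, measurable_fun setT (F i)) -> (forall i x, 0 <= F i x) ->
  nint (fun x => \sum_(i <- s) F i x) = (\sum_(i <- s) nint (F i))%E.
Proof.
move=> mF F0; elim: s => [|i s IH].
  rewrite big_nil -[RHS](integral0 mu setT).
  by apply: eq_integral => x _; rewrite big_nil.
rewrite big_cons -IH -nintD//; last 2 first.
- exact: measurable_sum.
- by move=> x; exact: sumr_ge0.
by apply: eq_nint => x; rewrite big_cons.
Qed.

Lemma nint_setE (A : set X) f :
  (\int[mu]_(x in A) (f x)%:E)%E = nint (fun x => f x * \1_A x).
Proof.
rewrite /nint integral_mkcond; apply: eq_integral => x _.
by rewrite /patch indicE; case: ifP => _; rewrite ?mulr1 ?mulr0.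
Qed.

Lemma nint_indic (A : set X) : measurable A -> nint (\1_A) = mu A.
Proof. by move=> mA; rewrite /nint integral_indic// setIT. Qed.

Lemma nint_cstM_indic k (A : set X) : measurable A -> 0 <= k ->
  nint (fun x => k * \1_A x) = (k%:E * mu A)%E.
Proof. by move=> mA k0; rewrite nintZ ?nint_indic. Qed.

End nonneg_integral.
(** * Balls and coverings *)

Section homogeneous_space.
Context (R : realType) (disp : measure_display) (X : measurableType disp).
Variables (d : X -> X -> R) (mu : {measure set X -> \bar R}).

(** The quasimetric constant becomes a parameter, since the radii chosen below are explicit in terms
    of it. *)
Record homogeneous (c0 : R) : Prop := Homogeneous {
  hs_ge0 : forall x y, 0 <= d x y;
  hs_eq0 : forall x y, d x y = 0 <-> x = y;
  hs_sym : forall x y, d x y = d y x;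
  hs_c0 : 1 <= c0;
  hs_tri : forall x y z, d x y <= c0 * (d x z + d z y);
  hs_meas : forall x r, measurable (qball d x r);
  hs_pos : forall x r, 0 < r -> (0 < mu (qball d x r) < +oo)%E;
  hs_dbl : exists C : R, forall x r, 0 < r ->
    (mu (qball d x (2 * r)) <= C%:E * mu (qball d x r))%E }.

Lemma doubling_homogeneous : doubling_space d mu ->
  exists c0, homogeneous c0.
Proof.
case=> -[d0 deq dsym [c0 c01 tri]] _ mB Bpos dbl.
by exists c0; split.
Qed.

Definition ballm x r : R := fine (mu (qball d x r)).

Variables (c0 : R) (hs : homogeneous c0).

Lemma hs_xx x : d x x = 0. Proof. exact/(hs_eq0 hs). Qed.

Lemma hs_c0_gt0 : 0 < c0. Proof. exact: lt_le_trans (hs_c0 hs). Qed.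

Lemma ballmE x r : 0 < r -> mu (qball d x r) = (ballm x r)%:E.
Proof.
move=> r0; rewrite /ballm fineK//.
by case/andP: (hs_pos hs x r0) => a b; rewrite ge0_fin_numE// ltW.
Qed.

Lemma ballm_gt0 x r : 0 < r -> 0 < ballm x r.
Proof.
by move=> r0; rewrite -lte_fin -ballmE//; case/andP: (hs_pos hs x r0).
Qed.

Lemma ballm_le x r y s : 0 < r -> 0 < s -> qball d x r `<=` qball d y s ->
  ballm x r <= ballm y s.
Proof.
move=> r0 s0 sub; rewrite -lee_fin -!ballmE//.
by apply: le_measure => //; rewrite inE; exact: hs_meas hs _ _.
Qed.

Lemma ballm_set_le (A : set X) x r : measurable A -> 0 < r ->
  A `<=` qball d x r -> (mu A <= (ballm x r)%:E)%E.
Proof.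
move=> mA r0 sub; rewrite -ballmE//.
by apply: le_measure => //; rewrite inE //; exact: hs_meas hs _ _.
Qed.

Lemma qball_sub x r s : r <= s -> qball d x r `<=` qball d x s.
Proof. by move=> rs y; rewrite /qball /= => /lt_le_trans; apply. Qed.

Lemma qball_sub_ball x y r s : c0 * (d x y + r) <= s ->
  qball d y r `<=` qball d x s.
Proof.
move=> rs z; rewrite /qball /= => dyz; apply: lt_le_trans rs.
apply: le_lt_trans (hs_tri hs x z y) _.
by rewrite ltr_pM2l ?hs_c0_gt0// ltrD2l.
Qed.

Lemma qball_center x r : 0 < r -> qball d x r x.
Proof. by move=> r0; rewrite /qball /= hs_xx. Qed.

(** The factor [K] is below some power of 2, and the doubling constant is raised to the same power.
    Allowing any real [K] only adds the case of an empty ball and spares positivity conditions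
    later. *)
Lemma ballm_dbl K : exists2 C : R, 1 <= C &
  forall x r, 0 < r -> ballm x (K * r) <= C * ballm x r.
Proof.
have [C0 HC0] := hs_dbl hs.
pose C1 := Num.max 1 C0.
have C11 : 1 <= C1 by rewrite le_max lexx.
have HC n x r : 0 < r -> ballm x (2 ^+ n * r) <= C1 ^+ n * ballm x r.
  move=> r0; elim: n => [|n IH]; first by rewrite !expr0 !mul1r.
  have pr : 0 < 2 ^+ n * r by rewrite mulr_gt0// exprn_gt0.
  rewrite exprS -mulrA exprS -mulrA.
  apply: (@le_trans _ _ (C1 * ballm x (2 ^+ n * r))); last first.
    by rewrite ler_pM2l// (lt_le_trans _ C11).
  have := HC0 x _ pr; rewrite !ballmE ?mulr_gt0// -EFinM lee_fin => /le_trans.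
  apply; rewrite ler_wpM2r//; first exact/ltW/ballm_gt0.
  by rewrite le_max lexx orbT.
have [n Kn] : exists n, K <= 2 ^+ n.
  exists (Num.truncn `|K|).+1.
  rewrite (le_trans (ler_norm _))// (le_trans (ltW (truncnS_gt _)))//.
  by rewrite -natrX ler_nat ltnW// ltn_expl.
exists (C1 ^+ n); first exact: exprn_ege1.
move=> x r r0; have [K0|K0] := ltP 0 K.
  apply: le_trans (HC n x r r0); apply: ballm_le; rewrite ?mulr_gt0//.
  by apply: qball_sub; rewrite ler_pM2r.
rewrite (_ : ballm x (K * r) = 0).
  apply: mulr_ge0; last exact/ltW/ballm_gt0.
  by apply: exprn_ge0; apply: le_trans C11.
rewrite /ballm (_ : qball d x (K * r) = set0) ?measure0//.
rewrite -subset0 => y; rewrite /qball /= ltNge => /negP; apply.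
by rewrite (le_trans _ (hs_ge0 hs x y))// pmulr_lle0.
Qed.

End homogeneous_space.

Section covering.
Context (R : realType) (disp : measure_display) (X : measurableType disp).
Variables (d : X -> X -> R) (mu : {measure set X -> \bar R}) (c0 : R).
Hypothesis hs : homogeneous d mu c0.
Local Notation B := (qball d).
Local Notation bm := (ballm d mu).

Lemma sum_indic_pairwise (I : Type) (A : I -> set X) (s : seq I) x :
  pairwise (fun i j => `[< A i `&` A j = set0 >]) s ->
  \sum_(i <- s) \1_(A i) x <= 1 :> R.
Proof.
elim: s => [|i s IH] /=; first by rewrite big_nil.
case/andP => dis /IH{}IH; rewrite big_cons.
rewrite {1}indicE; case: (boolP (x \in A i)) => [|_]; last by rewrite add0r.
rewrite inE => xi; suff -> : \sum_(j <- s) \1_(A j) x = 0 :> R by rewrite addr0.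
elim: s dis {IH} => [|j s IH] /=; first by rewrite big_nil.
case/andP => /asboolP Aij /IH{}IH; rewrite big_cons IH addr0 indicE memNset//.
by move=> xj; have : set0 x by rewrite -Aij.
Qed.

(** Packing: the balls of radius e / (2 c0) about e-separated points are disjoint and lie in B x r',
    and doubling makes each of them a fixed fraction of B x r' in measure. *)
Lemma separated_size x r e : 0 < r -> 0 < e -> exists n : nat,
  forall s : seq X, (forall y, y \in s -> B x r y) ->
    pairwise (fun y z => e <= d y z) s -> (size s <= n)%N.
Proof.
move=> r0 e0; have c00 := hs_c0_gt0 hs.
pose r' := c0 * (r + e); pose e' := e / (2 * c0).
have r'0 : 0 < r' by rewrite mulr_gt0// addr_gt0.
have e'0 : 0 < e' by rewrite divr_gt0// mulr_gt0.
have [C C1 HC] := ballm_dbl hs (c0 * (r + r') / e').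
exists (Num.truncn C) => s sB sep.
have C0 : 0 <= C by apply: le_trans C1.
suff : (size s)%:R * bm x r' <= C * bm x r'.
  rewrite ler_pM2r ?(ballm_gt0 hs)// => sC.
  by rewrite truncn_ge_nat.
have step1 y : y \in s -> bm x r' <= C * bm y e'.
  move=> ys; apply: le_trans (HC y _ e'0).
  have E : c0 * (r + r') / e' * e' = c0 * (r + r') by rewrite mulfVK// gt_eqF.
  rewrite E; apply: (ballm_le hs) => //; first by rewrite mulr_gt0// addr_gt0.
  apply: (qball_sub_ball hs); rewrite ler_pM2l// lerD2r (hs_sym hs).
  exact/ltW/sB.
apply: (@le_trans _ _ (C * \sum_(y <- s) bm y e')).
  rewrite mulr_sumr; elim: s step1 {sB sep} => [|y s IH] H.
    by rewrite big_nil mul0r.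
  rewrite big_cons /= -nat1r mulrDl mul1r lerD//.
    by apply: H; rewrite inE eqxx.
  by apply: IH => z zs; apply: H; rewrite inE zs orbT.
rewrite ler_wpM2l// -lee_fin -(ballmE hs)// -sumEFin.
rewrite (eq_bigr (fun y => nint mu (\1_(B y e')))); last first.
  by move=> y _; rewrite nint_indic ?(ballmE hs)//; exact: (hs_meas hs).
rewrite -nint_sum; last 2 first.
- by move=> y; apply: measurable_indic; exact: hs_meas hs _ _.
- by move=> y z; rewrite indicE.
rewrite -nint_indic; last exact: hs_meas hs _ _.
apply: le_nint => z.
  by apply: sumr_ge0 => y _; rewrite indicE.
rewrite [leRHS]indicE; case: (boolP (z \in B x r')) => [_|zn].
  apply: sum_indic_pairwise; apply: sub_pairwise sep => y1 y2 ey.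
  apply/asboolP; rewrite -subset0 => t [t1 t2].
  move: ey; rewrite leNgt => /negP; apply.
  apply: le_lt_trans (hs_tri hs y1 y2 t) _.
  have E : e = c0 * (e' + e').
    rewrite /e'; field; exact: lt0r_neq0.
  rewrite E ltr_pM2l//; apply: ltrD => //; rewrite ?[d t _](hs_sym hs)//.
rewrite big_seq big1// => y ys; rewrite indicE memNset// => zy.
move/negP: zn; apply; rewrite inE.
apply: (qball_sub_ball hs _ zy); rewrite ler_pM2l// lerD//.
  exact/ltW/sB.
by rewrite /e' ler_pdivrMr ?mulr_gt0// ler_peMr// ?ltW//; have := hs_c0 hs; lra.
Qed.

(** Otherwise a separated family could be enlarged point by point beyond the bound of
    [separated_size]. *)
Lemma finite_net x r e : 0 < r -> 0 < e -> exists s : seq X,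
  forall y, B x r y -> exists2 z, z \in s & d y z < e.
Proof.
move=> r0 e0; apply: contrapT => nocover.
have [n Hn] := separated_size x r0 e0.
have [s [sz sB sep]] : exists s : seq X, [/\ size s = n.+1,
    forall y, y \in s -> B x r y & pairwise (fun y z => e <= d y z) s].
  elim: n.+1 => [|m [s [sz sB sep]]]; first by exists [::].
  have [y [By yfar]] : exists y, B x r y /\ forall z, z \in s -> e <= d y z.
    apply: contrapT => H; apply: nocover; exists s => y By.
    apply: contrapT => H'; apply: H; exists y; split=> // z zs.
    by rewrite leNgt; apply/negP => dyz; apply: H'; exists z.
  exists (y :: s); split => /=; first by rewrite sz.
    by move=> z; rewrite inE => /orP[/eqP->//|/sB].
  by rewrite sep andbT; apply/allP => z /yfar.
by have := Hn s sB sep; rewrite sz ltnn.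
Qed.

(* Countably many balls suffice, so the maximal function over them is measurable. *)
Lemma ball_family (x0 : X) : exists (c : nat -> X) (rad : nat -> R),
  (forall i, 0 < rad i) /\ forall x r, 0 < r -> exists i,
    [/\ B x r `<=` B (c i) (rad i), B (c i) (rad i) `<=` B x (4 * c0 ^+ 2 * r) &
        rad i <= 3 * c0 * r].
Proof.
have c00 := hs_c0_gt0 hs; have c01 := hs_c0 hs.
have netP n : exists s : seq X,
    forall y, B x0 n.+1%:R y -> exists2 z, z \in s & d y z < n.+1%:R^-1.
  by apply: finite_net.
have [net Hnet] := choice netP.
(* An index codes a scale, a rank in the net of that scale and a rational radius; undecodable codes
   and non-positive radii fall back on radius 1. *)
pose dec i : nat * nat * rat := odflt (0%N, 0%N, 1%Q) (unpickle i).
pose c i := nth x0 (net (dec i).1.1) (dec i).1.2.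
pose rad i : R := if 0 < (dec i).2 then ratr (dec i).2 else 1.
exists c, rad; split=> [i|x r r0].
  by rewrite /rad; case: ifP => // q0; rewrite ltr0q.
(* With [z] within r of [x], B x r lies in B z (2 c0 r), and B z (3 c0 r) lies in the ball about [x]
   of radius c0 (r + 3 c0 r), whence the factor 4 c0^2. *)
have [q /=] : exists q, ratr q \in `]2 * c0 * r, 3 * c0 * r[%R.
  apply: rat_in_itvoo; rewrite ltr_pM2r// ltr_pM2r//; lra.
rewrite in_itv /= => /andP[q2 q3].
pose n := (maxn (Num.truncn (d x0 x)) (Num.truncn r^-1)).
have nx : B x0 n.+1%:R x.
  rewrite /qball /= (lt_le_trans (truncnS_gt _))// ler_nat ltnS leq_max.
  by rewrite leqnn.
have nr : n.+1%:R^-1 < r.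
  rewrite invf_plt ?posrE// (lt_le_trans (truncnS_gt _))// ler_nat ltnS.
  by rewrite leq_max leqnn orbT.
have [z zs dz] := Hnet n x nx.
have dz' : d x z < r by exact: lt_trans nr.
have q0 : 0 < q.
  rewrite -(@ltr0q R); apply: lt_trans q2; rewrite !mulr_gt0//.
exists (pickle (n, index z (net n), q)).
rewrite /c /rad /dec pickleK /= q0 nth_index//; split.
- apply: (qball_sub_ball hs); apply: ltW; apply: le_lt_trans q2.
  by rewrite [2 * c0]mulrC -mulrA ler_pM2l// (hs_sym hs); lra.
- apply: (qball_sub_ball hs).
  have -> : 4 * c0 ^+ 2 * r = c0 * (4 * c0 * r) by ring.
  rewrite ler_pM2l//; have : r <= c0 * r by rewrite ler_peMl// ltW.
  lra.
- exact: ltW.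
Qed.

(** Greedy selection from the largest radius down: a ball is kept when it is disjoint from those
    already kept. A rejected ball meets a kept one whose radius is at least its own, and two
    quasi-triangle inequalities give the dilation c0 (2 c0 + 1). *)
Lemma vitali_finite (c : nat -> X) (rad : nat -> R) (s : seq nat) :
  (forall i, 0 < rad i) -> exists2 J : seq nat, {subset J <= s} &
   pairwise (fun i j => `[< B (c i) (rad i) `&` B (c j) (rad j) = set0 >]) J /\
   forall i, i \in s -> exists2 j, j \in J &
     B (c i) (rad i) `<=` B (c j) (c0 * (2 * c0 + 1) * rad j).
Proof.
move=> rad0; have c00 := hs_c0_gt0 hs; have c01 := hs_c0 hs.
(* Increasing order, because the induction treats the head after the tail: the head is then the
   smallest ball. *)
pose le i j := rad i <= rad j.
have [s' [sorts' eqs]] : exists s', sorted le s' /\ perm_eq s' s.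
  by exists (sort le s); rewrite perm_sort perm_refl sort_sorted// => i j;
     exact: le_total.
suff [J Js [dis cov]] : exists2 J : seq nat, {subset J <= s'} &
   pairwise (fun i j => `[< B (c i) (rad i) `&` B (c j) (rad j) = set0 >]) J /\
   forall i, i \in s' -> exists2 j, j \in J &
     B (c i) (rad i) `<=` B (c j) (c0 * (2 * c0 + 1) * rad j).
  exists J; first by move=> i /Js; rewrite (perm_mem eqs).
  by split=> // i; rewrite -(perm_mem eqs) => /cov.
elim: s' sorts' {eqs} => [|i s' IH]; first by exists [::].
have le_tr : transitive le by move=> a b e; exact: le_trans.
rewrite /= (path_sortedE le_tr) => /andP[imin /IH[J Js [dis cov]]].
have selfcov j : B (c j) (rad j) `<=` B (c j) (c0 * (2 * c0 + 1) * rad j).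
  apply: qball_sub; rewrite ler_peMl//; first exact: ltW.
  by rewrite mulr_ege1//; lra.
have [ndis|/existsNP[j /not_implyP[jJ]]] := pselect
    (forall j, j \in J -> B (c i) (rad i) `&` B (c j) (rad j) = set0).
  exists (i :: J).
    move=> j; rewrite !inE => /orP[->//|/Js ->]; by rewrite orbT.
  split=> /=.
    by rewrite dis andbT; apply/allP => j /ndis ?; apply/asboolP.
  move=> j; rewrite inE => /orP[/eqP->|/cov[k kJ sub]].
    by exists i; rewrite ?inE ?eqxx//.
  by exists k; rewrite // inE kJ orbT.
move=> /eqP/set0P[t [ti tj]].
exists J; first by move=> k /Js kk; rewrite inE kk orbT.
split=> // k; rewrite inE => /orP[/eqP->|/cov//].
exists j => // y yi.
have rij : rad i <= rad j by move/allP: imin => /(_ _ (Js _ jJ)).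
rewrite /qball /=; apply: le_lt_trans (hs_tri hs _ _ t) _.
rewrite -mulrA ltr_pM2l// mulrDl mul1r addrC ler_ltD//.
apply: le_trans (hs_tri hs t y (c i)) _.
rewrite [2 * _]mulrC -mulrA ler_pM2l// (hs_sym hs).
by move: ti yi; rewrite /qball /=; lra.
Qed.

End covering.

(** * The maximal operator of a doubling weight *)

Lemma powR_exprn (R : realType) (x u : R) k : (x `^ u) ^+ k = x `^ (u * k%:R).
Proof. by rewrite -powR_mulrn ?powR_ge0// powRrM. Qed.

Section levels.
Context (R : realType).

Lemma geometric_sum_le (b : R) (m : nat) : 1 < b ->
  \sum_(k < m.+1) b ^+ k <= b / (b - 1) * b ^+ m.
Proof.
move=> b1; have b10 : 0 < b - 1 by rewrite subr_gt0.
have := subrX1 b m.+1; move: (\sum_(k < m.+1) _) => S E.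
have {E} : S * (b - 1) <= b ^+ m.+1 by rewrite mulrC -E gerBl.
by rewrite -ler_pdivlMr// => /le_trans; apply; rewrite exprS mulrAC.
Qed.

(** Discrete layer cake: the terms below [y] form a geometric sum, dominated by its last term, so
    the constant depends neither on the number of levels nor on [L]. *)
Lemma level_geometric (u L y : R) (m : nat) : 0 < u -> 0 < L -> 0 <= y ->
  \sum_(k < m) (2 ^+ k / L) `^ u * (2 ^+ k / L < y)%R%:R <=
  (2 `^ u / (2 `^ u - 1)) * y `^ u.
Proof.
move=> u0 L0 y0; have b1 : 1 < 2 `^ u :> R.
  rewrite -[ltLHS](powRr0 2); rewrite /powR !gt_eqF// ltr_expR.
  by rewrite ltr_pM2r// ln_gt0// ltr1n.
have b10 : 0 < 2 `^ u - 1 :> R by rewrite subr_gt0.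
have C0 : 0 <= 2 `^ u / (2 `^ u - 1) :> R.
  by rewrite divr_ge0 ?powR_ge0// ltW.
elim: m => [|m IH]; first by rewrite big_ord0 mulr_ge0// powR_ge0.
have [my|] := ltP (2 ^+ m / L) y; last first.
  by move=> ym; rewrite big_ord_recr /= ltNge ym mulr0 addr0.
have lvl k : (2 ^+ k / L) `^ u = (2 `^ u) ^+ k * L^-1 `^ u :> R.
  rewrite powRM ?exprn_ge0 ?invr_ge0 ?ltW//; congr (_ * _).
  by rewrite powR_exprn -[2 ^+ k]powR_mulrn// -powRrM mulrC.
apply: (@le_trans _ _ (\sum_(k < m.+1) (2 `^ u) ^+ k * L^-1 `^ u)).
  apply: ler_sum => k _; rewrite lvl ler_piMr//; last by case: (_ < _).
  by rewrite mulr_ge0 ?exprn_ge0 ?powR_ge0.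
rewrite -mulr_suml.
apply: (@le_trans _ _ (2 `^ u / (2 `^ u - 1) * (2 `^ u) ^+ m * L^-1 `^ u)).
  by rewrite ler_wpM2r ?powR_ge0// geometric_sum_le.
have l0 : 0 < 2 ^+ m / L by rewrite divr_gt0// exprn_gt0.
rewrite -mulrA -lvl ler_wpM2l// ge0_ler_powR ?nnegrE//.
- exact: ltW.
- exact: ltW.
- exact: ltW.
Qed.

(** The level sits a factor 2 below [a] because [maximal_weak_trunc] at level l asks for averages of
    at least 2 l; the ratio 2 of consecutive levels accounts for the 4. *)
Lemma level_exists (L a : R) : 0 < L -> 2 / L < a ->
  exists k : nat, 2 * (2 ^+ k / L) < a /\ a <= 4 * (2 ^+ k / L).
Proof.
move=> L0 La; have ex : exists k, a <= 2 * (2 ^+ k / L).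
  exists (Num.truncn `|a * L|).+1; rewrite mulrA ler_pdivlMr//.
  rewrite (le_trans (ler_norm _))// (le_trans (ltW (truncnS_gt _)))//.
  rewrite -exprS -natrX ler_nat.
  by rewrite (leq_trans (ltnW (ltn_expl _ (isT : 1 < 2)%N)))// leq_exp2l.
case: (ex_minnP ex) => [[|k]] ak mink.
  by move: ak; rewrite expr0 mulrA mulr1 leNgt La.
exists k; split; first by rewrite ltNge; apply/negP => /mink; rewrite ltnn.
by move: ak; rewrite exprS; lra.
Qed.

End levels.

Section sup_integral.
Context (R : realType) (disp : measure_display) (X : measurableType disp).
Variable mu : {measure set X -> \bar R}.

(** The majorant is the pointwise limit, possibly infinite; monotone convergence carries the uniform
    bound over to it. *)
Lemma nint_sup (F : nat -> X -> R) (M : \bar R) :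
  (forall n, measurable_fun setT (F n)) -> (forall n x, 0 <= F n x) ->
  (forall n x, F n x <= F n.+1 x) -> (forall n, nint mu (F n) <= M)%E ->
  exists Phi : X -> \bar R, [/\ measurable_fun setT Phi,
    forall x, (0 <= Phi x)%E, forall n x, ((F n x)%:E <= Phi x)%E &
    (\int[mu]_x Phi x <= M)%E].
Proof.
move=> mF F0 ndF FM.
have nd x : nondecreasing_seq (fun n => (F n x)%:E).
  by apply/nondecreasing_seqP => n; rewrite lee_fin.
have FPhi n x : ((F n x)%:E <= limn (fun n => (F n x)%:E))%E.
  rewrite (cvg_lim _ (ereal_nondecreasing_cvgn (nd x)))//.
  by apply: ereal_sup_ubound; exists n.
exists (fun x => limn (fun n => (F n x)%:E)); split => //.
- apply: (emeasurable_fun_cvg (fun n x => (F n x)%:E)).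
    by move=> n; exact/measurable_EFinP.
  by move=> x _; exact: ereal_nondecreasing_is_cvgn.
- by move=> x; apply: le_trans (FPhi 0%N x); rewrite lee_fin.
rewrite monotone_convergence//.
- apply: lime_le; last by apply: nearW => n; exact: FM.
  apply: ereal_nondecreasing_is_cvgn; apply/nondecreasing_seqP => n.
  exact: le_nint.
- by move=> n; exact/measurable_EFinP.
- by move=> n x _; rewrite lee_fin.
Qed.

End sup_integral.

Section maximal.
Context (R : realType) (disp : measure_display) (X : measurableType disp).
Variables (d : X -> X -> R) (mu : {measure set X -> \bar R}) (c0 : R).
Hypothesis hs : homogeneous d mu c0.
Local Notation B := (qball d).
Implicit Types (v g f : X -> R) (A : set X) (x y : X) (r s : R).

(** For a weight [v] this is the measure of [A] under v dmu; with a function in place of [v] it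
    serves as the integral of that function over [A]. *)
Definition wint (v : X -> R) (A : set X) : \bar R :=
  nint mu (fun x => v x * \1_A x).

Definition wballm (v : X -> R) x r : R := fine (wint v (B x r)).

Record doubling_weight (v : X -> R) : Prop := DoublingWeight {
  dw_meas : measurable_fun setT v;
  dw_ge0 : forall x, 0 <= v x;
  dw_pos : forall x r, 0 < r -> (0 < wint v (B x r) < +oo)%E;
  dw_dbl : forall K, exists2 C : R, 1 <= C &
    forall x r, 0 < r -> wballm v x (K * r) <= C * wballm v x r }.

Lemma wballmE v x r : doubling_weight v -> 0 < r ->
  wint v (B x r) = (wballm v x r)%:E.
Proof.
move=> dw r0; rewrite /wballm fineK//.
by case/andP: (dw_pos dw x r0) => a b; rewrite ge0_fin_numE// ltW.
Qed.

Lemma wballm_gt0 v x r : doubling_weight v -> 0 < r -> 0 < wballm v x r.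
Proof.
move=> dw r0; rewrite -lte_fin -(wballmE _ dw)//.
by case/andP: (dw_pos dw x r0).
Qed.

Lemma measurable_mul_indic (f : X -> R) (A : set X) :
  measurable_fun setT f -> measurable A ->
  measurable_fun setT (fun x => f x * \1_A x).
Proof. by move=> mf mA; apply: measurable_funM => //; exact: measurable_indic. Qed.

Lemma indic_ge0 (A : set X) x : 0 <= \1_A x :> R.
Proof. by rewrite indicE. Qed.

Lemma indic_le1 (A : set X) x : \1_A x <= 1 :> R.
Proof. by rewrite indicE; case: (_ \in _). Qed.

Lemma indic_le (A A' : set X) x : A `<=` A' -> \1_A x <= \1_A' x :> R.
Proof.
move=> AA'; rewrite !indicE; case: (boolP (x \in A)) => // xA.
by rewrite mem_set//; apply: AA'; rewrite inE in xA.
Qed.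

Lemma wint_ge0 v A : (forall x, 0 <= v x) -> (0 <= wint v A)%E.
Proof. by move=> v0; apply: nint_ge0 => x; rewrite mulr_ge0 ?indic_ge0. Qed.

Lemma le_wint v (v' : X -> R) A (A' : set X) : (forall x, 0 <= v x) -> (forall x, v x <= v' x) ->
  A `<=` A' -> (wint v A <= wint v' A')%E.
Proof.
move=> v0 vv' AA'; apply: le_nint => x; first by rewrite mulr_ge0 ?indic_ge0.
by rewrite ler_pM ?indic_ge0 ?indic_le.
Qed.

Lemma wint_le_nint v A : (forall x, 0 <= v x) -> (wint v A <= nint mu v)%E.
Proof.
move=> v0; apply: le_nint => x; first by rewrite mulr_ge0 ?indic_ge0.
by rewrite ler_piMr ?indic_le1.
Qed.

Lemma wintD v (v' : X -> R) A : measurable_fun setT v -> measurable_fun setT v' ->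
  (forall x, 0 <= v x) -> (forall x, 0 <= v' x) -> measurable A ->
  wint (fun x => v x + v' x) A = (wint v A + wint v' A)%E.
Proof.
move=> mv mv' v0 v'0 mA; rewrite /wint -nintD; first last.
- by move=> x; rewrite mulr_ge0 ?indic_ge0.
- by move=> x; rewrite mulr_ge0 ?indic_ge0.
- exact: measurable_mul_indic.
- exact: measurable_mul_indic.
by apply: eq_nint => x; rewrite mulrDl.
Qed.

Lemma wintZ k v A : measurable_fun setT v ->
  (forall x, 0 <= v x) -> measurable A -> 0 <= k ->
  wint (fun x => k * v x) A = (k%:E * wint v A)%E.
Proof.
move=> mv v0 mA k0; rewrite /wint -nintZ//.
- by apply: eq_nint => x; rewrite mulrA.
- exact: measurable_mul_indic.
- by move=> x; rewrite mulr_ge0 ?indic_ge0.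
Qed.

Variables (c : nat -> X) (rad : nat -> R).
Hypothesis rad0 : forall i, 0 < rad i.

Definition famU (I : seq nat) : set X :=
  [set x | exists2 i, i \in I & B (c i) (rad i) x].

Lemma measurable_famU I : measurable (famU I).
Proof.
elim: I => [|i I IH].
  by rewrite (_ : famU _ = set0)// -subset0 => x [].
rewrite (_ : famU _ = B (c i) (rad i) `|` famU I).
  by apply: measurableU => //; exact: hs_meas hs _ _.
apply/seteqP; split=> [x [j]|x [xi|[j jI xj]]].
- by rewrite inE => /orP[/eqP->|jI xj]; [left|right; exists j].
- by exists i => //; rewrite inE eqxx.
- by exists j => //; rewrite inE jI orbT.
Qed.

(** Weak type (1,1) for v dmu. The balls selected by [vitali_finite] are disjoint, so their
    integrals add up to at most the full one, and the doubling of [v] pays for the dilation that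
    covers the union. The constant does not see the number of balls. *)
Lemma maximal_weak v : doubling_weight v -> exists2 C : R, 0 < C &
  forall (g : X -> R) (l : R) (I : seq nat),
  measurable_fun setT g -> (forall x, 0 <= g x) -> 0 <= l ->
  (forall i, i \in I ->
    (l%:E * wint v (B (c i) (rad i)) <=
     wint (fun x => (g x * v x)%R) (B (c i) (rad i)))%E) ->
  (l%:E * wint v (famU I) <= C%:E * nint mu (fun x => (g x * v x)%R))%E.
Proof.
move=> dw; pose K := c0 * (2 * c0 + 1).
have [C C1 HC] := dw_dbl dw K; have C0 : 0 < C by apply: lt_le_trans C1.
have K0 : 0 < K.
  by rewrite /K mulr_gt0 ?(hs_c0_gt0 hs)//; have := hs_c0 hs; lra.
have mv := dw_meas dw; have v0 := dw_ge0 dw.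
have mB := hs_meas hs.
exists C => // g l I mg g0 l0 HI.
have [J JI [dis cov]] := vitali_finite hs c I rad0.
have mgv : measurable_fun setT (fun x => g x * v x) by exact: measurable_funM.
have gv0 x : 0 <= g x * v x by rewrite mulr_ge0.
apply: (@le_trans _ _ (l%:E * (\sum_(j <- J) (C * wballm v (c j) (rad j)))%:E)%E).
  rewrite lee_wpmul2l ?lee_fin// -sumEFin.
  apply: (@le_trans _ _ (\sum_(j <- J) wint v (B (c j) (K * rad j)))%E).
    rewrite /wint -nint_sum; last 2 first.
    - by move=> j; exact: measurable_mul_indic.
    - by move=> j x; rewrite mulr_ge0 ?indic_ge0.
    apply: le_nint => x; first by rewrite mulr_ge0 ?indic_ge0.
    rewrite -mulr_sumr ler_wpM2l//; rewrite [leLHS]indicE.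
    case: (boolP (x \in famU I)) => [|_]; last first.
      by apply: sumr_ge0 => j _; exact: indic_ge0.
    rewrite inE => -[i /cov[j jJ sub] /sub xj].
    rewrite (perm_big _ (perm_to_rem jJ)) big_cons /= indicE mem_set//=.
    by rewrite lerDl sumr_ge0// => k _; exact: indic_ge0.
  apply: lee_sum => j _; rewrite (wballmE _ dw (mulr_gt0 K0 (rad0 j))) lee_fin; exact: HC.
rewrite -EFinM -mulr_sumr mulrCA EFinM.
apply: lee_wpmul2l; first by rewrite lee_fin ltW.
rewrite mulr_sumr -sumEFin.
apply: (@le_trans _ _ (\sum_(j <- J) wint (fun x => (g x * v x)%R) (B (c j) (rad j)))%E).
  rewrite big_seq [leRHS]big_seq; apply: lee_sum => j jJ.
  by rewrite EFinM -(wballmE _ dw)//; exact/HI/JI.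
rewrite /wint -nint_sum; last 2 first.
- by move=> j; exact: measurable_mul_indic.
- by move=> j x; rewrite mulr_ge0 ?indic_ge0.
apply: le_nint => x; first by apply: sumr_ge0 => j _; rewrite mulr_ge0 ?indic_ge0.
rewrite -mulr_sumr ler_piMr//.
exact: (@sum_indic_pairwise R _ X nat (fun i => B (c i) (rad i))).
Qed.

(** The part of g at most l contributes at most l to an average, so an average of at least 2 l
    leaves at least l to the part above l. *)
Lemma maximal_weak_trunc v : doubling_weight v -> exists2 C : R, 0 < C &
  forall (g : X -> R) (l : R) (I : seq nat),
  measurable_fun setT g -> (forall x, 0 <= g x) -> 0 <= l ->
  (forall i, i \in I ->
    ((2 * l)%:E * wint v (B (c i) (rad i)) <=
     wint (fun x => (g x * v x)%R) (B (c i) (rad i)))%E) ->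
  (l%:E * wint v (famU I) <=
   C%:E * nint mu (fun x => (g x * (l < g x)%R%:R * v x)%R))%E.
Proof.
move=> dw; have [C C0 HC] := maximal_weak dw.
have mv := dw_meas dw; have v0 := dw_ge0 dw.
exists C => // g l I mg g0 l0 HI.
have m1 : measurable_fun setT (fun x => (l < g x)%R%:R : R).
  rewrite (_ : (fun x => _) = \1_[set x | l < g x]).
    apply: measurable_indic.
    rewrite (_ : [set x | _] = setT `&` g @^-1` `]l, +oo[%classic).
      exact: mg.
    by apply/seteqP; split => x /=; rewrite in_itv/= andbT => // -[].
  apply/funext => x; rewrite indicE; congr (nat_of_bool _)%:R.
  by apply/idP/idP => [lx|]; [rewrite inE|rewrite inE].
have mg1 : measurable_fun setT (fun x => g x * (l < g x)%R%:R).
  exact: measurable_funM.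
have g10 x : 0 <= g x * (l < g x)%R%:R by rewrite mulr_ge0.
apply: HC => // i iI.
have fin : (l%:E * wint v (B (c i) (rad i)) = (l * wballm v (c i) (rad i))%:E)%E.
  by rewrite (wballmE _ dw)// EFinM.
have := HI i iI; rewrite mulr_natl mulr2n EFinD ge0_muleDl ?lee_fin// => {}HI.
have mB := hs_meas hs.
have : (wint (fun x => (g x * v x)%R) (B (c i) (rad i)) <=
  l%:E * wint v (B (c i) (rad i)) +
  wint (fun x => (g x * (l < g x)%R%:R * v x)%R) (B (c i) (rad i)))%E.
  rewrite -wintZ// -wintD//; last 4 first.
  - exact: measurable_funM.
  - exact: measurable_funM.
  - by move=> x; rewrite mulr_ge0.
  - by move=> x; rewrite mulr_ge0.
  apply: le_wint => // x; first by rewrite mulr_ge0.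
  rewrite -mulrDl ler_wpM2r//; case: ltP => [_|gl]; first by rewrite mulr1 lerDr.
  by rewrite mulr0 addr0.
move=> /(le_trans HI); by rewrite fin leeD2lE.
Qed.

Definition wavg (v g : X -> R) i : R :=
  fine (wint (fun x => (g x * v x)%R) (B (c i) (rad i))) / wballm v (c i) (rad i).

(** The maximal function over the first [n] balls when [a] lists the averages; finiteness keeps it
    measurable and leaves finitely many levels to consider. *)
Fixpoint fmax (a : nat -> R) n x : R :=
  if n is m.+1 then Num.max (fmax a m x) (a m * \1_(B (c m) (rad m)) x) else 0.

Lemma fmax_ge0 a n x : 0 <= fmax a n x.
Proof. by elim: n => [|n IH] //=; rewrite le_max IH. Qed.

Lemma measurable_fmax a n : measurable_fun setT (fmax a n).
Proof.
elim: n => [|n IH] /=; first exact: measurable_cst.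
apply: measurable_maxr => //; apply: measurable_funM => //.
by apply: measurable_indic; exact: hs_meas hs _ _.
Qed.

Lemma fmax_attained a n x : fmax a n x = 0 \/
  exists i, [/\ (i < n)%N, B (c i) (rad i) x & fmax a n x = a i].
Proof.
elim: n => [|n IH] /=; first by left.
rewrite maxEle; case: ifP => _; last first.
  by case: IH => [->|[i [ni Bi ->]]]; [left|right; exists i; rewrite ltnW].
rewrite indicE; case: (boolP (x \in _)) => [|_]; last by left; rewrite mulr0.
by rewrite inE => xB; right; exists n; rewrite mulr1.
Qed.

Lemma fmax_ge a n i x : (i < n)%N -> B (c i) (rad i) x -> a i <= fmax a n x.
Proof.
elim: n => // n IH; rewrite ltnS leq_eqVlt => /orP[/eqP->|ni] Bx /=.
  by rewrite le_max indicE mem_set// mulr1 lexx orbT.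
by rewrite le_max IH.
Qed.

End maximal.

(** * Strong type bound for the maximal operator *)

Section maximal_strong.
Context (R : realType) (disp : measure_display) (X : measurableType disp).
Variables (d : X -> X -> R) (mu : {measure set X -> \bar R}) (c0 : R).
Hypothesis hs : homogeneous d mu c0.
Local Notation B := (qball d).
Variables (c : nat -> X) (rad : nat -> R).
Hypothesis rad0 : forall i, 0 < rad i.
Local Notation wavg := (wavg d mu c rad).
Local Notation fmax := (fmax d c rad).
Local Notation famU := (famU d c rad).
Implicit Types (v g : X -> R) (x : X) (t l : R).

Lemma measurable_fun_powR_cst (g : X -> R) t : measurable_fun setT g ->
  measurable_fun setT (fun x => g x `^ t).
Proof. by move=> mg; exact: (measurableT_comp (measurable_powR t)). Qed.

Lemma measurable_fun_lt_cst (g : X -> R) l : measurable_fun setT g ->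
  measurable_fun setT (fun x => (l < g x)%R%:R : R).
Proof.
move=> mg; rewrite (_ : (fun x => _) = \1_[set x | l < g x]).
  apply: measurable_indic.
  rewrite (_ : [set x | _] = setT `&` g @^-1` `]l, +oo[%classic).
    exact: mg.
  by apply/seteqP; split => x /=; rewrite in_itv/= andbT => // -[].
apply/funext => x; rewrite indicE; congr (nat_of_bool _)%:R.
by apply/idP/idP => [lx|]; [rewrite inE|rewrite inE].
Qed.

(** A crude substitute for Hoelder's inequality, sufficient wherever an additive constant is
    harmless. *)
Lemma le_1Dpow (y t : R) : 0 <= y -> 1 <= t -> y <= 1 + y `^ t.
Proof.
move=> y0 t1; have [y1|/ltW y1] := leP 1 y.
  by apply: le_trans (le1r_powR y1 t1) _; rewrite lerDr.
by rewrite (le_trans y1)// lerDl powR_ge0.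
Qed.

Lemma wint_lty_of_pow v g t (A : set X) : doubling_weight d mu v ->
  1 <= t -> measurable_fun setT g -> (forall x, 0 <= g x) -> measurable A ->
  (wint mu v A < +oo)%E -> (nint mu (fun x => (g x `^ t * v x)%R) < +oo)%E ->
  (wint mu (fun x => (g x * v x)%R) A < +oo)%E.
Proof.
move=> dw t1 mg g0 mA vA gt.
have mv := dw_meas dw; have v0 := dw_ge0 dw.
apply: (@le_lt_trans _ _ (wint mu v A + wint mu (fun x => (g x `^ t * v x)%R) A)%E).
  rewrite -wintD//; last 2 first.
  - by apply: measurable_funM => //; exact: measurable_fun_powR_cst.
  - by move=> x; rewrite mulr_ge0 ?powR_ge0.
  apply: le_wint => // x; first by rewrite mulr_ge0.
  by rewrite -[X in X + _]mul1r -mulrDl ler_wpM2r// le_1Dpow.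
rewrite lte_add_pinfty//; apply: le_lt_trans gt; apply: wint_le_nint => x.
by rewrite mulr_ge0 ?powR_ge0.
Qed.

(** Marcinkiewicz interpolation on dyadic levels. The part of g above [l k] controls the v-measure
    of the balls with average above twice [l k]. Exchanging the sum over k with the integral leaves
    the sum of the (t - 1)-th powers of the levels below g, which [level_geometric] bounds by a
    multiple of g^(t - 1). *)
Lemma maximal_strong_fin v t : doubling_weight d mu v -> 1 < t ->
  exists2 C : R, 0 < C &
  forall (g : X -> R) n, measurable_fun setT g -> (forall x, 0 <= g x) ->
  (nint mu (fun x => (g x `^ t * v x)%R) < +oo)%E ->
  (nint mu (fun x => (fmax (wavg v g) n x `^ t * v x)%R) <=
   C%:E * nint mu (fun x => (g x `^ t * v x)%R))%E.
Proof.
move=> dw t1; have [C C0 HC] := maximal_weak_trunc hs c rad0 dw.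
have mv := dw_meas dw; have v0 := dw_ge0 dw.
have t0 : 0 < t by apply: lt_trans t1.
pose u := t - 1; have u0 : 0 < u by rewrite subr_gt0.
pose Cg : R := 2 `^ u / (2 `^ u - 1).
have Cg0 : 0 < Cg.
  rewrite divr_gt0 ?powR_gt0// subr_gt0 -[ltLHS](powRr0 2).
  by rewrite /powR !gt_eqF// ltr_expR ltr_pM2r// ln_gt0// ltr1n.
exists (4 `^ t * C * Cg); first by apply: mulr_gt0 => //; apply: mulr_gt0 => //; exact: powR_gt0.
move=> g n mg g0 gfin.
pose a := wavg v g.
have gv0 x : 0 <= g x * v x by rewrite mulr_ge0.
have afin i : wint mu (fun x => (g x * v x)%R) (B (c i) (rad i)) =
    (a i * wballm d mu v (c i) (rad i))%:E.
  rewrite /a /wavg divfK ?gt_eqF ?(wballm_gt0 _ dw)// fineK//.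
  rewrite ge0_fin_numE ?wint_ge0//.
  apply: (wint_lty_of_pow dw (ltW t1)) => //; first exact: hs_meas hs _ _.
  by case/andP: (dw_pos dw (c i) (rad0 i)).
have a0 i : 0 <= a i.
  by rewrite divr_ge0 ?fine_ge0 ?wint_ge0// ltW ?(wballm_gt0 _ dw).
(* Only n averages occur: [L] puts the lowest level 1 / L below half of every positive one, and [m]
   stops the levels above the largest. Neither enters the constant. *)
pose L := 1 + \sum_(i < n) 4 / a i.
have L1 : 1 <= L by rewrite lerDl sumr_ge0// => i _; rewrite divr_ge0.
have L0 : 0 < L by apply: lt_le_trans L1.
have La i : (i < n)%N -> 0 < a i -> 2 / L < a i.
  move=> ni ai; rewrite ltr_pdivrMr// mulrC -ltr_pdivrMr//.
  apply: (@lt_le_trans _ _ (1 + 4 / a i)).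
    have : 0 < (a i)^-1 by rewrite invr_gt0.
    lra.
  rewrite lerD2l (bigD1 (Ordinal ni))//= lerDl sumr_ge0// => j _.
  by rewrite divr_ge0.
have [m Hm] : exists m, forall i, (i < n)%N -> a i * L < 2 ^+ m.
  exists (Num.truncn (\sum_(i < n) a i * L)).+1 => i ni.
  apply: (@le_lt_trans _ _ (\sum_(i < n) a i * L)).
    rewrite (bigD1 (Ordinal ni))//= lerDl sumr_ge0// => j _.
    by rewrite mulr_ge0// ltW.
  apply: (lt_le_trans (truncnS_gt _)).
  by rewrite -natrX ler_nat ltnW// ltn_expl.
pose l k : R := 2 ^+ k / L.
have l0 k : 0 < l k by rewrite divr_gt0// exprn_gt0.
pose I k := [seq i <- iota 0 n | 2 * l k < a i].
have mfam k : measurable (famU (I k)) by exact: measurable_famU hs _ _ _.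
have ptw x : fmax a n x `^ t <= \sum_(k < m) 4 `^ t * (l k `^ t * \1_(famU (I k)) x).
  have [->|[i [ni xi ->]]] := fmax_attained d c rad a n x.
    rewrite powR0 ?gt_eqF//; apply: sumr_ge0 => k _.
    by rewrite !mulr_ge0 ?powR_ge0 ?indic_ge0.
  have := a0 i; rewrite le_eqVlt => /predU1P[<-|ai].
    rewrite powR0 ?gt_eqF//; apply: sumr_ge0 => k _.
    by rewrite !mulr_ge0 ?powR_ge0 ?indic_ge0.
  have [k [k2 k4]] := level_exists L0 (La i ni ai).
  have km : (k < m)%N.
    rewrite ltnNge; apply/negP => mk; move: k2; apply/negP; rewrite -leNgt.
    apply: (@le_trans _ _ (2 ^+ m / L)).
      by rewrite ler_pdivlMr// ltW// Hm.
    rewrite mulrA ler_pM2r ?invr_gt0// -exprS.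
    by rewrite -!natrX ler_nat leq_exp2l// ltnW.
  rewrite (bigD1 (Ordinal km))//= indicE mem_set; last first.
    by exists i => //; rewrite mem_filter mem_iota /= add0n ni k2.
  rewrite mulr1; apply: ler_wpDr.
    by apply: sumr_ge0 => j _; rewrite !mulr_ge0 ?powR_ge0 ?indic_ge0.
  rewrite -powRM//; last exact: ltW.
  apply: ge0_ler_powR; rewrite ?nnegrE; [exact: ltW|exact: ltW| |exact: k4].
  by rewrite mulr_ge0// ltW.
have mgk k : measurable_fun setT (fun x => g x * (l k < g x)%R%:R * v x).
  apply: measurable_funM => //; apply: measurable_funM => //.
  exact: measurable_fun_lt_cst.
have gk0 k x : 0 <= g x * (l k < g x)%R%:R * v x by rewrite !mulr_ge0.
apply: (@le_trans _ _ (\sum_(k < m) (4 `^ t * l k `^ t)%:E *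
    wint mu v (famU (I k)))%E).
  have E k : ((4 `^ t * l k `^ t)%:E * wint mu v (famU (I k)) =
     nint mu (fun x => (4 `^ t * l k `^ t * (v x * \1_(famU (I k)) x))%R))%E.
    rewrite nintZ//; first exact: measurable_mul_indic.
    - by move=> x; rewrite mulr_ge0 ?indic_ge0.
    - by rewrite mulr_ge0 ?powR_ge0.
  under eq_bigr do rewrite E.
  rewrite -(@nint_sum _ _ _ _ _ _ (fun (k : 'I_m) x =>
     (4 `^ t * l k `^ t * (v x * \1_(famU (I k)) x))%R)); last 2 first.
  - move=> k; apply: measurable_funM => //; exact: measurable_mul_indic.
  - by move=> k x; rewrite !mulr_ge0 ?powR_ge0 ?indic_ge0.
  apply: le_nint => x; first by rewrite mulr_ge0 ?powR_ge0.
  apply: (le_trans (ler_wpM2r (v0 x) (ptw x))); rewrite mulr_suml.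
  by apply: ler_sum => k _; rewrite le_eqVlt; apply/orP; left; apply/eqP; ring.
apply: (@le_trans _ _ (\sum_(k < m) (4 `^ t * C * l k `^ u)%:E *
   nint mu (fun x => (g x * (l k < g x)%R%:R * v x)%R))%E).
  apply: lee_sum => k _.
  have -> : 4 `^ t * l k `^ t = (4 `^ t * l k `^ u) * l k.
    by rewrite -(mulr_powRB1 (ltW (l0 k)) t0) -mulrA [l k * _]mulrC.
  rewrite EFinM -muleA.
  have -> : (4 `^ t * C * l k `^ u)%:E = ((4 `^ t * l k `^ u)%:E * C%:E)%E.
    by rewrite -EFinM mulrAC.
  rewrite -muleA; apply: lee_wpmul2l.
    by rewrite lee_fin mulr_ge0 ?powR_ge0.
  apply: HC => //; first exact: ltW.
  move=> i; rewrite mem_filter => /andP[ai _].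
  rewrite (wballmE _ dw)// afin -EFinM lee_fin ler_pM2r ?(wballm_gt0 _ dw)//.
  exact: ltW.
have K0 k : 0 <= 4 `^ t * C * l k `^ u.
  by rewrite mulr_ge0 ?powR_ge0// mulr_ge0 ?powR_ge0// ltW.
have E k : ((4 `^ t * C * l k `^ u)%:E *
   nint mu (fun x => (g x * (l k < g x)%R%:R * v x)%R) =
   nint mu (fun x => (4 `^ t * C * l k `^ u * (g x * (l k < g x)%R%:R * v x))%R))%E.
  by rewrite nintZ.
under eq_bigr do rewrite E.
rewrite -(@nint_sum _ _ _ _ _ _ (fun (k : 'I_m) x =>
     (4 `^ t * C * l k `^ u * (g x * (l k < g x)%R%:R * v x))%R)); last 2 first.
- by move=> k; apply: measurable_funM.
- by move=> k x; rewrite mulr_ge0.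
rewrite -nintZ; last 3 first.
- by apply: measurable_funM => //; exact: measurable_fun_powR_cst.
- by move=> x; rewrite mulr_ge0 ?powR_ge0.
- by apply/ltW/mulr_gt0 => //; apply: mulr_gt0 => //; exact: powR_gt0.
apply: le_nint => x.
  by apply: sumr_ge0 => k _; rewrite mulr_ge0.
have := level_geometric m u0 L0 (g0 x); rewrite -/Cg => HG.
rewrite (eq_bigr (fun k : 'I_m => (4 `^ t * C * g x * v x) *
    (l k `^ u * (l k < g x)%R%:R))); last by move=> k _; ring.
rewrite -mulr_sumr.
have K1 : 0 <= 4 `^ t * C * g x * v x.
  by rewrite mulr_ge0// mulr_ge0// mulr_ge0 ?powR_ge0// ltW.
apply: (le_trans (ler_wpM2l K1 HG)).
rewrite -(mulr_powRB1 (g0 x) t0) le_eqVlt; apply/orP; left; apply/eqP; rewrite /u; ring.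
Qed.

(** The bound of [maximal_strong_fin] does not depend on the number of balls, so one majorant serves
    the whole countable family. *)
Theorem maximal_strong v t : doubling_weight d mu v -> 1 < t ->
  exists2 C : R, 0 < C &
  forall g : X -> R, measurable_fun setT g -> (forall x, 0 <= g x) ->
  (nint mu (fun x => (g x `^ t * v x)%R) < +oo)%E ->
  exists Phi : X -> \bar R, [/\ measurable_fun setT Phi,
    forall x, (0 <= Phi x)%E,
    forall i x, B (c i) (rad i) x -> ((wavg v g i `^ t * v x)%:E <= Phi x)%E &
    (\int[mu]_x Phi x <= C%:E * nint mu (fun x => (g x `^ t * v x)%R))%E].
Proof.
move=> dw t1; have [C C0 HC] := maximal_strong_fin dw t1.
have mv := dw_meas dw; have v0 := dw_ge0 dw.
exists C => // g mg g0 gfin.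
pose a := wavg v g.
have a0 i : 0 <= a i.
  apply: divr_ge0; last by apply/ltW/(wballm_gt0 _ dw).
  by apply/fine_ge0/wint_ge0 => x; rewrite mulr_ge0.
have [] := @nint_sup _ _ _ mu (fun n x => fmax a n x `^ t * v x)
  (C%:E * nint mu (fun x => (g x `^ t * v x)%R))%E.
- move=> n; apply: measurable_funM => //; apply: measurable_fun_powR_cst.
  exact: measurable_fmax hs _ _ _ _.
- by move=> n x; rewrite mulr_ge0 ?powR_ge0.
- move=> n x; rewrite ler_wpM2r// ge0_ler_powR ?nnegrE ?fmax_ge0//=.
    by apply: le_trans (ltW t1).
  by rewrite le_max lexx.
- by move=> n; exact: HC.
move=> Phi [mPhi Phi0 HPhi intPhi]; exists Phi; split=> // i x xi.
apply: le_trans (HPhi i.+1 x); rewrite lee_fin ler_wpM2r//.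
rewrite ge0_ler_powR ?nnegrE ?fmax_ge0 ?a0//.
  by apply: le_trans (ltW t1).
exact: fmax_ge.
Qed.

End maximal_strong.

(** * Muckenhoupt weights *)

Section weight_class.
Context (R : realType) (disp : measure_display) (X : measurableType disp).
Variables (d : X -> X -> R) (mu : {measure set X -> \bar R}) (c0 : R).
Hypothesis hs : homogeneous d mu c0.
Local Notation B := (qball d).
Local Notation bm := (ballm d mu).
Local Notation wm := (wballm d mu).
Implicit Types (v g f : X -> R) (A : set X) (x y z : X) (r s : R).

(* Muckenhoupt's condition A_s in the form of a normalised Hoelder inequality, which
   avoids the dual weight v^(-1/(s-1)). *)
Definition Acond s v := exists2 C : R, 0 < C & forall x r, 0 < r ->
  forall g, measurable_fun setT g -> (forall y, 0 <= g y) ->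
  (wint mu (fun y => (g y `^ s * v y)%R) (B x r) <= wint mu v (B x r))%E ->
  (wint mu g (B x r) <= (C * bm x r)%:E)%E.

Lemma wint_cst k A : measurable A -> 0 <= k ->
  wint mu (fun=> k) A = (k%:E * mu A)%E.
Proof. by move=> mA k0; rewrite /wint nint_cstM_indic. Qed.

(** [Acond] on the larger ball is tested with the function equal to l on B x r and 0 elsewhere,
    where l^s is the ratio of the two v-measures. This bounds l by [C] times the ratio of the
    mu-measures. *)
Lemma Acond_doubling s v : 0 < s -> measurable_fun setT v ->
  (forall x, 0 <= v x) -> (forall x r, 0 < r -> (wint mu v (B x r) < +oo)%E) ->
  Acond s v -> doubling_weight d mu v.
Proof.
move=> s0 mv v0 vfin [C C0 HC]; have mB := hs_meas hs.
have vpos x r : 0 < r -> (0 < wint mu v (B x r))%E.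
  move=> r0; rewrite lt0e wint_ge0// andbT; apply/eqP => v_eq0.
  (* On a ball of zero v-measure every g would be admissible, and the constant C + 1 contradicts the
     conclusion. *)
  have := HC x r r0 (fun=> C + 1) (@measurable_cst _ _ _ _ _ _).
  have C10 : 0 <= C + 1 by rewrite addr_ge0// ltW.
  rewrite wintZ ?powR_ge0// v_eq0 mule0 lexx wint_cst// (ballmE hs)//.
  move=> /(_ (fun=> C10) isT); rewrite -EFinM lee_fin ler_pM2r ?(ballm_gt0 hs)//.
  lra.
split => // [x r r0|K]; first by rewrite vpos//= vfin.
have wmE x r : 0 < r -> wint mu v (B x r) = (wm v x r)%:E.
  by move=> r0; rewrite /wballm fineK// ge0_fin_numE ?wint_ge0// vfin.
have wm0 x r : 0 < r -> 0 < wm v x r.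
  by move=> r0; rewrite -lte_fin -wmE// vpos.
have [C' C'1 HC'] := ballm_dbl hs (Num.max 1 K).
pose K' := Num.max 1 K; have K'1 : 1 <= K' by rewrite le_max lexx.
have CC0 : 0 <= C * C' by rewrite mulr_ge0 ?ltW// (lt_le_trans _ C'1).
exists (1 + (C * C') `^ s); first by rewrite lerDl powR_ge0.
move=> x r r0; have [K0|K0] := ltP 0 K; last first.
  rewrite {1}/wballm (_ : wint mu v _ = 0%E).
    by rewrite mulr_ge0 ?addr_ge0 ?powR_ge0// ltW// wm0.
  rewrite (_ : B x (K * r) = set0).
    by rewrite /wint -[RHS](integral0 mu setT); apply: eq_integral => y _;
       rewrite indic0 mulr0.
  rewrite -subset0 => y; rewrite /qball /= ltNge => /negP; apply.
  by rewrite (le_trans _ (hs_ge0 hs x y))// pmulr_lle0.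
have Kr0 : 0 < K' * r by rewrite mulr_gt0// (lt_le_trans _ K'1).
apply: (@le_trans _ _ (wm v x (K' * r))).
  rewrite -lee_fin -(wmE x _ (mulr_gt0 K0 r0)) -wmE//; apply: le_wint => //.
  by apply: qball_sub; rewrite ler_pM2r// le_max lexx orbT.
pose l := (wm v x (K' * r) / wm v x r) `^ s^-1.
have l0 : 0 <= l by exact: powR_ge0.
have ls : l `^ s * wm v x r = wm v x (K' * r).
  rewrite -powRrM mulVf ?gt_eqF// powRr1 ?divfK ?gt_eqF ?wm0//.
  by rewrite divr_ge0// ltW// wm0.
have sub : B x r `<=` B x (K' * r) by apply: qball_sub; rewrite ler_peMl// ltW.
have := HC x _ Kr0 (fun y => l * \1_(B x r) y).
have ml : measurable_fun setT (fun y => l * \1_(B x r) y).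
  by apply: measurable_funM => //; exact: measurable_indic.
have l_ge0 y : 0 <= l * \1_(B x r) y by rewrite mulr_ge0 ?indic_ge0.
move=> /(_ ml l_ge0) H.
have : (wint mu (fun y => ((l * \1_(B x r) y) `^ s * v y)%R) (B x (K' * r)) <=
   wint mu v (B x (K' * r)))%E.
  rewrite [leRHS]wmE// -ls EFinM -wmE// -wintZ ?powR_ge0//.
  apply: le_nint => y; first by rewrite !mulr_ge0 ?powR_ge0 ?indic_ge0.
  rewrite -!mulrA; case: (boolP (y \in B x r)) => yB.
    rewrite [\1_(B x r) y]indicE yB !mulr1.
    by rewrite ler_wpM2l ?powR_ge0// ler_piMr ?indic_le1.
  rewrite [\1_(B x r) y]indicE (negbTE yB) /= mulr0 powR0 ?gt_eqF// mul0r.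
  by rewrite !mulr_ge0 ?powR_ge0.
move=> /H {}H.
have lC : l <= C * C'.
  rewrite -(ler_pM2r (ballm_gt0 hs x r0)) -mulrA.
  apply: (@le_trans _ _ (C * bm x (K' * r))); last first.
    by rewrite ler_pM2l// HC'.
  rewrite -lee_fin; apply: le_trans H.
  rewrite EFinM -(ballmE hs)// -nint_cstM_indic//; apply: le_nint => y.
    by rewrite mulr_ge0 ?indic_ge0.
  rewrite -mulrA ler_wpM2l// !indicE; case: (boolP (y \in B x r)) => yB; last by rewrite mul0r.
  by rewrite mem_set ?mulr1//; apply: sub; rewrite inE in yB.
rewrite -ls ler_wpM2r//; first by rewrite ltW// wm0.
by rewrite ler_wpDl// ge0_ler_powR ?nnegrE// ltW.
Qed.

(** Homogeneity: g / Z^(1/s) meets the normalisation in [Acond]. *)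
Lemma Acond_scaled s v : 0 < s -> doubling_weight d mu v -> Acond s v ->
  exists2 C : R, 0 < C & forall x r, 0 < r ->
  forall g (Z : R), measurable_fun setT g -> (forall y, 0 <= g y) -> 0 < Z ->
  (wint mu (fun y => (g y `^ s * v y)%R) (B x r) <= (Z * wm v x r)%:E)%E ->
  (wint mu g (B x r) <= (C * Z `^ s^-1 * bm x r)%:E)%E.
Proof.
move=> s0 dw [C C0 HC]; exists C => // x r r0 g Z mg g0 Z0 HZ.
have mB := hs_meas hs; have v0 := dw_ge0 dw; have mv := dw_meas dw.
have Zs0 : 0 < Z `^ s^-1 by exact: powR_gt0.
have := HC x r r0 (fun y => (Z `^ s^-1)^-1 * g y).
have mg' : measurable_fun setT (fun y => (Z `^ s^-1)^-1 * g y).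
  exact: measurable_funM.
have g'0 y : 0 <= (Z `^ s^-1)^-1 * g y by rewrite mulr_ge0// invr_ge0 ltW.
move=> /(_ mg' g'0) H.
have mgs : measurable_fun setT (fun y => g y `^ s * v y).
  by apply: measurable_funM => //; exact: measurable_fun_powR_cst.
have gs0 y : 0 <= g y `^ s * v y by rewrite mulr_ge0 ?powR_ge0.
have : (wint mu (fun y => (((Z `^ s^-1)^-1 * g y) `^ s * v y)%R) (B x r) <=
   wint mu v (B x r))%E.
  apply: (@le_trans _ _ (wint mu (fun y => (Z^-1 * (g y `^ s * v y))%R) (B x r))).
    apply: le_wint => // y; first by rewrite mulr_ge0 ?powR_ge0.
    rewrite powRM// ?invr_ge0 ?powR_ge0// -mulrA.
    rewrite (_ : (Z `^ s^-1)^-1 `^ s = Z^-1)//.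
    by rewrite -powRN -powRrM mulNr mulVf ?gt_eqF// powR_inv1// ltW.
  rewrite wintZ//; last by rewrite invr_ge0 ltW.
  apply: (@le_trans _ _ ((Z^-1)%:E * (Z * wm v x r)%:E)%E).
    by apply: lee_wpmul2l => //; rewrite lee_fin invr_ge0 ltW.
  by rewrite -EFinM mulKf ?gt_eqF// (wballmE _ dw).
move=> /H; rewrite wintZ//; last by rewrite invr_ge0 ltW.
rewrite -[X in (_ <= X)%E](@mul1e R).
have -> : (1 = (Z `^ s^-1)^-1%:E * (Z `^ s^-1)%:E :> \bar R)%E.
  by rewrite -EFinM mulVf// gt_eqF.
rewrite -muleA lee_pmul2l ?lte_fin ?invr_gt0// -EFinM => /le_trans; apply.
by rewrite lee_fin mulrA [_ * C]mulrC.
Qed.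

(** The number [u] stands for a typical value of [v] on the ball: the hypothesis is the classical
    A_s condition with both of its averages compared with [u]. *)
Lemma Acond_of_level s v : 1 < s -> measurable_fun setT v ->
  (forall x, 0 < v x) ->
  (exists2 C : R, 0 < C & forall x r, 0 < r -> exists u, [/\ 0 < u,
     (wint mu v (B x r) <= (C * u * bm x r)%:E)%E &
     (wint mu (fun y => (v y `^ (- (s - 1)^-1))%R) (B x r) <=
        (C * u `^ (- (s - 1)^-1) * bm x r)%:E)%E]) ->
  (forall x r, 0 < r -> (wint mu v (B x r) < +oo)%E) /\ Acond s v.
Proof.
move=> s1 mv v0 [C C0 HC]; have mB := hs_meas hs; split.
  move=> x r r0; have [u [_ + _]] := HC x r r0 => /le_lt_trans; apply.
  exact: ltry.
exists (C + C); first exact: addr_gt0.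
move=> x r r0 g mg g0 Hg.
have [u [u0 Hv Hs]] := HC x r r0.
have s10 : 0 < s - 1 by rewrite subr_gt0.
pose q := (s - 1)^-1.
pose sg y := v y `^ (- q).
have sg0 y : 0 < sg y by exact: powR_gt0.
have msg : measurable_fun setT sg by exact: measurable_fun_powR_cst.
have uq0 : 0 < u `^ q by exact: powR_gt0.
(* Young's inequality in elementary form: where g exceeds u^q v^(-q), raising to the power s - 1
   gives u <= g^(s - 1) v, that is g <= u^(-1) g^s v. *)
have ptw y : g y <= u^-1 * (g y `^ s * v y) + u `^ q * sg y.
  have [gs|gs] := leP (g y) (u `^ q * sg y).
    apply: (le_trans gs); rewrite lerDr.
    apply: mulr_ge0; first by rewrite invr_ge0 ltW.
    by rewrite mulr_ge0 ?powR_ge0// ltW.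
  apply: ler_wpDr; first by rewrite ltW// mulr_gt0.
  have gy0 : 0 < g y by apply: lt_trans gs; rewrite mulr_gt0.
  rewrite -(@mulr_powRB1 _ (g y) s)//; last by apply: lt_trans s1.
  suff : 1 <= u^-1 * (g y `^ (s - 1) * v y).
    rewrite -(ler_pM2l gy0) mulr1 => /le_trans; apply.
    by rewrite le_eqVlt; apply/orP; left; apply/eqP; ring.
  have : (u `^ q * sg y) `^ (s - 1) <= g y `^ (s - 1).
    apply: ge0_ler_powR; rewrite ?nnegrE; do ?exact: ltW.
    by apply/ltW/mulr_gt0.
  rewrite /sg powRM ?powR_ge0// -!powRrM mulNr mulVf ?gt_eqF//.
  rewrite powRr1 ?(ltW u0)// powR_inv1 ?(ltW (v0 y))// => H.
  rewrite mulrC ler_pdivlMr// mul1r -ler_pdivrMr//.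
have mgs : measurable_fun setT (fun y => g y `^ s * v y).
  by apply: measurable_funM => //; exact: measurable_fun_powR_cst.
have gs0 y : 0 <= g y `^ s * v y by rewrite mulr_ge0 ?powR_ge0// ltW.
apply: (@le_trans _ _ (wint mu (fun y => (u^-1 * (g y `^ s * v y) + u `^ q * sg y)%R)
   (B x r))).
  exact: le_wint.
have ui0 : 0 <= u^-1 by rewrite invr_ge0 ltW.
rewrite wintD//; last 4 first.
- exact: measurable_funM.
- exact: measurable_funM.
- by move=> y; rewrite mulr_ge0.
- by move=> y; rewrite mulr_ge0// ltW.
rewrite !wintZ//; [|by move=> y; exact: ltW|exact: ltW].
rewrite mulrDl EFinD; apply: leeD.
  apply: (@le_trans _ _ ((u^-1)%:E * (C * u * bm x r)%:E)%E).
    by apply: lee_wpmul2l; rewrite ?lee_fin//; exact: le_trans Hv.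
  by rewrite -EFinM lee_fin [C * u]mulrC -mulrA mulKf ?gt_eqF.
apply: (@le_trans _ _ ((u `^ q)%:E * (C * u `^ (- q) * bm x r)%:E)%E).
  by apply: lee_wpmul2l; rewrite ?lee_fin// ltW.
by rewrite -EFinM lee_fin powRN [C * _]mulrC -mulrA mulVKf ?gt_eqF.
Qed.

(** The constant weight serves on bounded sets away from the points x_k. *)
Lemma Acond_cst1 s : 1 < s -> Acond s (fun=> 1) /\ doubling_weight d mu (fun=> 1).
Proof.
move=> s1; have [] := @Acond_of_level s (fun=> 1) s1 (@measurable_cst _ _ _ _ _ _).
- by move=> _; exact: ltr01.
- exists 1 => // x r r0; exists 1.
  have W : wint mu (fun=> 1) (B x r) = (bm x r)%:E.
    by rewrite wint_cst ?mul1e ?(ballmE hs)//; exact: hs_meas hs _ _.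
  by rewrite powR1 W !mul1r.
move=> H1 H2; split=> //; apply: (@Acond_doubling s) => //.
exact: lt_trans s1.
Qed.

End weight_class.

(** * Integrals of radial weights over concentric balls *)

Section radial.
Context (R : realType) (disp : measure_display) (X : measurableType disp).
Variables (d : X -> X -> R) (mu : {measure set X -> \bar R}) (c0 : R).
Hypothesis hs : homogeneous d mu c0.
Local Notation B := (qball d).
Local Notation bm := (ballm d mu).
Implicit Types (v g f : X -> R) (A : set X) (x y z : X) (r s : R).

Lemma measurable_dist z : measurable_fun setT (fun y => d y z).
Proof.
apply: (measurability _ (RGenInftyO.measurableE R)) => //.
move=> _ [_ [r ->] <-]; rewrite setTI.
rewrite (_ : _ @^-1` _ = B z r); first exact: hs_meas hs _ _.
by apply/seteqP; split => y /=; rewrite in_itv/= /qball /= (hs_sym hs).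
Qed.

Lemma measurable_point z : measurable [set z].
Proof.
rewrite (_ : [set z] = (fun y => d y z) @^-1` [set 0]).
  rewrite -[X in measurable X]setTI; apply: measurable_dist => //.
by apply/seteqP; split => y /=; rewrite (hs_eq0 hs).
Qed.

Lemma pow2_scale (D r : R) : 0 < D -> D < r ->
  exists j : nat, D < r / 2 ^+ j /\ r / 2 ^+ j.+1 <= D.
Proof.
move=> D0 Dr; have ex : exists k, r / 2 ^+ k <= D.
  exists (Num.truncn (r / D)).+1; rewrite ler_pdivrMr ?exprn_gt0// mulrC.
  rewrite -ler_pdivrMr// (le_trans (ltW (truncnS_gt _)))//.
  by rewrite -natrX ler_nat ltnW// ltn_expl.
case: (ex_minnP ex) => [[|k]] kD mink.
  by move: kD; rewrite expr0 divr1 leNgt Dr.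
by exists k; split=> //; rewrite ltNge; apply/negP => /mink; rewrite ltnn.
Qed.

(** A point of the ball is charged to a scale r / 2^j at which v is at most [coef j], and the last
    hypothesis makes the contributions a geometric series. The centre may escape this only if it is
    a null set. *)
Lemma dyadic_integral z v r M th (coef : nat -> R) :
  measurable_fun setT v -> (forall y, 0 <= v y) -> 0 < r -> 0 <= th < 1 ->
  0 <= M -> (forall j, 0 <= coef j) ->
  (forall y, B z r y -> (y = z /\ mu [set z] = 0%E) \/
     exists j, B z (r / 2 ^+ j) y /\ v y <= coef j) ->
  (forall j, coef j * bm z (r / 2 ^+ j) <= M * th ^+ j) ->
  (wint mu v (B z r) <= (M / (1 - th))%:E)%E.
Proof.
move=> mv v0 r0 /andP[th0 th1] M0 coef0 Hv Hc.
have rj0 j : 0 < r / 2 ^+ j by rewrite divr_gt0// exprn_gt0.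
pose F j y := coef j * \1_(B z (r / 2 ^+ j)) y.
have F0 j y : 0 <= F j y by rewrite mulr_ge0 ?indic_ge0.
have mF j : measurable_fun setT (F j).
  by apply: measurable_funM => //; apply: measurable_indic; exact: hs_meas hs _ _.
(* Carries the value of v at the centre when that point is null; otherwise the first alternative of
   the hypothesis does not arise. *)
pose w y : R := if mu [set z] == 0%E then v z * \1_[set z] y else 0.
have w0 y : 0 <= w y by rewrite /w; case: ifP => // _; rewrite mulr_ge0 ?indic_ge0.
have mw : measurable_fun setT w.
  rewrite /w; case: (mu [set z] == 0%E); last exact: measurable_cst.
  by apply: measurable_funM => //; apply: measurable_indic; exact: measurable_point.
have intw : nint mu w = 0%E.
  rewrite /w; have [z0|z0] := eqVneq (mu [set z]) 0%E; last exact: integral0.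
  by rewrite nint_cstM_indic ?z0 ?mule0//; exact: measurable_point.
have S0 y : (0 <= \sum_(j <oo) (F j y)%:E)%E.
  by apply: nneseries_ge0 => j _ _; rewrite lee_fin.
have mS : measurable_fun setT (fun y => (\sum_(j <oo) (F j y)%:E)%E).
  apply: (ge0_emeasurable_sum (P := xpredT)) => [j y _ _|j _].
    by rewrite lee_fin.
  exact/measurable_EFinP.
apply: (@le_trans _ _ (\int[mu]_y ((\sum_(j <oo) (F j y)%:E) + (w y)%:E))%E).
  apply: le_integral_ge0 => y; first by rewrite lee_fin mulr_ge0 ?indic_ge0.
  rewrite indicE; case: (boolP (y \in B z r)) => [|_]; last first.
    by rewrite mulr0 adde_ge0// lee_fin.
  rewrite inE mulr1 => /Hv[[-> z0]|[j [yj vj]]].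
    apply: (@le_trans _ _ (w z)%:E); last by rewrite leeDr.
    by rewrite lee_fin /w z0 eqxx indicE mem_set ?mulr1.
  apply: (@le_trans _ _ (\sum_(j <oo) (F j y)%:E)%E); last by rewrite leeDl// lee_fin.
  apply: (@le_trans _ _ (F j y)%:E).
    by rewrite lee_fin /F indicE mem_set// mulr1.
  apply: (@le_trans _ _ (\sum_(0 <= i < j.+1) (F i y)%:E)%E).
    rewrite big_nat_recr//= leeDr// sume_ge0// => i _; by rewrite lee_fin.
  by apply: nneseries_lim_ge => i _ _; rewrite lee_fin.
rewrite ge0_integralD//; last 2 first.
- by move=> y _; rewrite lee_fin.
- exact/measurable_EFinP.
rewrite -/(nint mu w) intw adde0 integral_nneseries//; last 2 first.
- by move=> j; exact/measurable_EFinP.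
- by move=> j y _; rewrite lee_fin.
apply: lime_le.
  by apply: is_cvg_nneseries => j _ _; apply: integral_ge0 => y _; rewrite lee_fin.
apply: nearW => n.
apply: (@le_trans _ _ (\sum_(0 <= j < n) (M * th ^+ j)%:E)%E).
  apply: lee_sum => j _; rewrite -/(nint mu (F j)) nint_cstM_indic//.
    by rewrite (ballmE hs)// -EFinM lee_fin.
  exact: hs_meas hs _ _.
rewrite sumEFin lee_fin -mulr_sumr ler_wpM2l// big_mkord.
have := subrX1 th n; move: (\sum_(i < n) _) => S E.
rewrite -[leRHS]mul1r ler_pdivlMr ?subr_gt0//.
have : 0 <= th ^+ n by rewrite exprn_ge0.
lra.
Qed.

Variables (z : X) (u : R -> R) (h0 : R).
Hypotheses (u0 : forall t, 0 < u t) (h00 : 0 < h0).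

(** The bounds on [u] are known up to [h0] only, hence the weight frozen at u(h0) beyond. As u(t)
    times the measure of B z t grows at least like t^eta, the contributions of the scales r / 2^j
    decay like 2^(-eta j). *)
Lemma radial_local eta C : 0 < eta -> 0 < C -> mu [set z] = 0%E ->
  (forall t r, 0 < t -> t <= r -> r <= h0 -> r <= 2 * t -> u t <= C * u r) ->
  (forall t r, 0 < t -> t <= r -> r <= h0 ->
     u t * bm z t <= C * (t / r) `^ eta * (u r * bm z r)) ->
  measurable_fun setT (fun y => u (Num.min (d y z) h0)) ->
  exists2 C' : R, 0 < C' & forall r, 0 < r ->
    (wint mu (fun y => u (Num.min (d y z) h0)) (B z r) <=
     (C' * u (Num.min r h0) * bm z r)%:E)%E.
Proof.
move=> eta0 C0 z0 comp dec mu_; have mB := hs_meas hs.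
pose th : R := 2 `^ (- eta).
have th01 : 0 <= th < 1.
  rewrite /th powR_ge0 /= -[ltRHS](powRr0 2) /powR !gt_eqF// ltr_expR.
  by rewrite ltr_pM2r ?ln_gt0 ?ltr1n// oppr_lt0.
have th10 : 0 < 1 - th by rewrite subr_gt0; case/andP: th01.
have small r : 0 < r -> r <= h0 ->
    (wint mu (fun y => u (Num.min (d y z) h0)) (B z r) <=
     (C * C * (u r * bm z r) / (1 - th))%:E)%E.
  move=> r0 rh; have bz := ballm_gt0 hs z r0.
  apply: (@dyadic_integral z _ r _ th (fun j => C * u (r / 2 ^+ j))) => //.
  - by move=> y; rewrite ltW.
  - by rewrite mulr_ge0 ?mulr_ge0// ltW.
  - by move=> j; rewrite mulr_ge0 ?mulr_ge0// ltW.
  - move=> y; rewrite /qball /= (hs_sym hs) => dyr.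
    have [dy0|dy0] := eqVneq (d y z) 0.
      by left; split=> //; apply/(hs_eq0 hs).
    have {}dy0 : 0 < d y z by rewrite lt_neqAle eq_sym dy0 (hs_ge0 hs).
    right; have [j [j1 j2]] := pow2_scale dy0 dyr.
    exists j; split=> //.
    have rj : r / 2 ^+ j <= r.
      by rewrite ler_pdivrMr ?exprn_gt0// ler_peMr ?exprn_ege1 ?ler1n// ltW.
    rewrite /= min_l; last by rewrite (le_trans (ltW dyr)).
    apply: comp => //; [exact: ltW|exact: le_trans rh|].
    have -> : r / 2 ^+ j = 2 * (r / 2 ^+ j.+1).
      by rewrite exprS; field; rewrite expf_neq0 ?pnatr_eq0.
    by rewrite ler_pM2l.
  - move=> j.
    rewrite -!mulrA ler_pM2l//.
    have rj0 : 0 < r / 2 ^+ j by rewrite divr_gt0.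
    have rjr : r / 2 ^+ j <= r.
      by rewrite ler_pdivrMr// ler_peMr ?exprn_ege1 ?ler1n// ltW.
    apply: le_trans (dec _ _ rj0 rjr rh) _.
    rewrite -mulrA ler_pM2l// mulrC !mulrA ler_pM2l ?mulr_gt0//.
    rewrite le_eqVlt; apply/orP; left; apply/eqP.
    rewrite (_ : r / 2 ^+ j / r = 2 `^ (- j%:R)); last first.
      by rewrite powR_invn//; field; rewrite gt_eqF// gt_eqF.
    by rewrite powR_exprn -powRrM mulNr mulNr mulrC.
exists (C * C / (1 - th) + 1).
  by rewrite ltr_wpDl// ltW// divr_gt0// mulr_gt0.
move=> r r0; have bz := ballm_gt0 hs z r0.
have [rh|hr] := leP r h0.
  apply: le_trans (small r r0 rh) _; rewrite lee_fin.
  rewrite mulrDl mul1r mulrDl mulrAC -!mulrA -[leLHS]addr0 !mulrA.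
  by rewrite lerD// mulr_ge0// ltW.
(* For r beyond [h0], the ball of radius [h0] falls under [small], and outside it the weight is the
   constant u(h0). *)
apply: (@le_trans _ _ (wint mu (fun y => u (Num.min (d y z) h0)) (B z h0) +
    (u h0 * bm z r)%:E)%E).
  rewrite EFinM -(ballmE hs)// -nint_cstM_indic//; last exact: ltW.
  rewrite -nintD; last 4 first.
  - exact: measurable_mul_indic.
  - by apply: measurable_funM => //; exact: measurable_indic.
  - by move=> y; rewrite mulr_ge0 ?indic_ge0// ltW.
  - by move=> y; rewrite mulr_ge0 ?indic_ge0// ltW.
  apply: le_nint => y; first by rewrite mulr_ge0 ?indic_ge0// ltW.
  have ui t : 0 <= u t by exact: ltW.
  have [yh|hy] := ltP (d y z) h0.
    rewrite [\1_(B z h0) y]indicE mem_set; last by rewrite /qball /= (hs_sym hs).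
    by rewrite mulr1 ler_wpDr ?mulr_ge0 ?indic_ge0// ler_piMr ?indic_le1.
  by rewrite ler_wpDl ?mulr_ge0 ?indic_ge0//.
apply: (@le_trans _ _ ((C * C * (u h0 * bm z h0) / (1 - th))%:E +
   (u h0 * bm z r)%:E)%E).
  by apply: leeD => //; exact: small.
rewrite -EFinD lee_fin mulrDl mul1r mulrDl lerD2r.
rewrite mulrAC -[leRHS]mulrA ler_wpM2l//.
  by rewrite divr_ge0 ?mulr_ge0// ltW.
rewrite ler_pM2l//; apply: (ballm_le hs) => //; exact/qball_sub/ltW.
Qed.

(** Counterpart of [radial_local] when the bounds hold from [h0] on and the weight is frozen
    inside. *)
Lemma radial_infty eta C : 0 < eta -> 0 < C ->
  (forall t r, h0 <= t -> t <= r -> r <= 2 * t -> u t <= C * u r) ->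
  (forall t r, h0 <= t -> t <= r ->
     u t * bm z t <= C * (t / r) `^ eta * (u r * bm z r)) ->
  measurable_fun setT (fun y => u (Num.max (d y z) h0)) ->
  exists2 C' : R, 0 < C' & forall r, 0 < r ->
    (wint mu (fun y => u (Num.max (d y z) h0)) (B z r) <=
     (C' * u (Num.max r h0) * bm z r)%:E)%E.
Proof.
move=> eta0 C0 comp dec mu_; have mB := hs_meas hs.
pose th : R := 2 `^ (- eta).
have th01 : 0 <= th < 1.
  rewrite /th powR_ge0 /= -[ltRHS](powRr0 2) /powR !gt_eqF// ltr_expR.
  by rewrite ltr_pM2r ?ln_gt0 ?ltr1n// oppr_lt0.
have th10 : 0 < 1 - th by rewrite subr_gt0; case/andP: th01.
exists (C * C / (1 - th) + 1).
  by rewrite ltr_wpDl// ltW// divr_gt0// mulr_gt0.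
move=> r r0; have bz := ballm_gt0 hs z r0.
have ui t : 0 <= u t by exact: ltW.
have bzi := ltW bz.
have [rh|hr] := leP r h0.
  apply: (@le_trans _ _ (u h0 * bm z r)%:E).
    rewrite EFinM -(ballmE hs)// -nint_cstM_indic//.
    apply: le_nint => y; first by rewrite mulr_ge0 ?indic_ge0.
    rewrite indicE; case: (boolP (y \in B z r)) => [|_]; last by rewrite !mulr0.
    rewrite inE /qball /= (hs_sym hs) => yr.
    by rewrite max_r// (le_trans (ltW yr)).
  rewrite lee_fin mulrDl mul1r ler_wpM2r// ler_wpDl// mulr_ge0//.
  by rewrite divr_ge0 ?mulr_ge0// ltW.
apply: (@le_trans _ _ (C * C * (u r * bm z r) / (1 - th))%:E); last first.
  rewrite lee_fin mulrDl mul1r mulrDl; apply: ler_wpDr; first exact: mulr_ge0.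
  by rewrite le_eqVlt; apply/orP; left; apply/eqP; ring.
(* Points within [h0] of [z] are charged to the dyadic scale just above [h0]; scales below [h0]
   receive the coefficient 0. *)
apply: (@dyadic_integral z _ r _ th
  (fun j => if h0 <= r / 2 ^+ j then C * u (r / 2 ^+ j) else 0)) => //.
- by rewrite mulr_ge0 ?mulr_ge0// ltW.
- by move=> j; case: ifP => // _; rewrite mulr_ge0// ltW.
- move=> y; rewrite /qball /= (hs_sym hs) => dyr.
  right; pose D := Num.max (d y z) h0.
  have D0 : 0 < D by rewrite lt_max h00 orbT.
  have Dr : D < r by rewrite gt_max dyr.
  have [j [j1 j2]] := pow2_scale D0 Dr.
  have hD : h0 <= D by rewrite le_max lexx orbT.
  exists j; split.
    by apply: le_lt_trans j1; rewrite le_max lexx.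
  rewrite /= -/D.
  rewrite (le_trans hD (ltW j1)); apply: comp => //; first exact: ltW.
  have -> : r / 2 ^+ j = 2 * (r / 2 ^+ j.+1).
    by rewrite exprS; field; rewrite expf_neq0 ?pnatr_eq0.
  by rewrite ler_pM2l.
- move=> j.
  case: ifP => [hj|_]; last first.
    rewrite mul0r mulr_ge0 ?exprn_ge0 ?powR_ge0// !mulr_ge0// ltW//.
  rewrite -!mulrA ler_pM2l//.
  have rjr : r / 2 ^+ j <= r.
    by rewrite ler_pdivrMr// ler_peMr ?exprn_ege1 ?ler1n// ltW.
  apply: le_trans (dec _ _ hj rjr) _.
  rewrite -mulrA ler_pM2l// mulrC !mulrA ler_pM2l ?mulr_gt0//.
  rewrite le_eqVlt; apply/orP; left; apply/eqP.
  rewrite (_ : r / 2 ^+ j / r = 2 `^ (- j%:R)); last first.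
    by rewrite powR_invn//; field; rewrite gt_eqF// gt_eqF.
  by rewrite powR_exprn -powRrM mulNr mulNr mulrC.
Qed.

End radial.

(** * Radial weights in the class A_s *)

Section radial_class.
Context (R : realType) (disp : measure_display) (X : measurableType disp).
Variables (d : X -> X -> R) (mu : {measure set X -> \bar R}) (c0 : R).
Hypothesis hs : homogeneous d mu c0.
Local Notation B := (qball d).
Local Notation bm := (ballm d mu).
Implicit Types (v g f : X -> R) (A : set X) (x y z : X) (r s t : R).

Lemma powR_le_norm (x K a : R) : 1 <= x -> x <= K -> x `^ a <= K `^ `|a|.
Proof.
move=> x1 xK; apply: (@le_trans _ _ (x `^ `|a|)).
  by apply: ler_powR => //; exact: ler_norm.
by apply: ge0_ler_powR; rewrite ?nnegrE//; lra.
Qed.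

(** Up to the constant, t^(-a) u(t) is almost increasing and t^(-b) u(t) almost decreasing on
    [D]. *)
Definition power_bounds (D : set R) (a b C : R) (u : R -> R) :=
  forall t r, D t -> D r -> t <= r ->
    u t <= C * (r / t) `^ (- a) * u r /\ u r <= C * (r / t) `^ b * u t.

Lemma power_bounds_comp D a b C u K t r : (forall t, D t -> 0 < t) ->
  (forall t, 0 < u t) -> 0 < C -> power_bounds D a b C u ->
  1 <= K -> D t -> D r -> t <= K * r -> r <= K * t ->
  u t <= C * (K `^ `|a| + K `^ `|b|) * u r.
Proof.
move=> Dpos u0 C0 ub K1 Dt Dr tr rt.
have t0 := Dpos _ Dt; have r0 := Dpos _ Dr.
have [le_tr|/ltW le_rt] := leP t r.
  have [+ _] := ub t r Dt Dr le_tr; move/le_trans; apply.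
  rewrite ler_wpM2r ?ler_wpM2l//; [exact: ltW|exact: ltW|].
  rewrite ler_wpDr ?powR_ge0// -normrN powR_le_norm//.
    by rewrite ler_pdivlMr// mul1r.
  by rewrite ler_pdivrMr.
have [_] := ub r t Dr Dt le_rt; move/le_trans; apply.
rewrite ler_wpM2r ?ler_wpM2l//; [exact: ltW|exact: ltW|].
rewrite ler_wpDl ?powR_ge0// powR_le_norm//.
  by rewrite ler_pdivlMr// mul1r.
by rewrite ler_pdivrMr.
Qed.

Lemma power_bounds_inv D a b C u q : (forall t, D t -> 0 < t) ->
  (forall t, 0 < u t) -> 0 < C -> 0 < q -> power_bounds D a b C u ->
  power_bounds D (- (b * q)) (- (a * q)) (C `^ q) (fun t => u t `^ (- q)).
Proof.
move=> Dpos u0 C0 q0 ub t r Dt Dr tr.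
have [H1 H2] := ub t r Dt Dr tr.
have t0 := Dpos _ Dt; have r0 := Dpos _ Dr.
have rt0 : 0 < r / t by rewrite divr_gt0.
have inv (x y k : R) : 0 < x -> 0 < y -> 0 < k -> x <= k * y ->
    y `^ (- q) <= k `^ q * x `^ (- q).
  move=> x0 y0 k0 xky; rewrite !powRN -ler_pdivrMr ?invr_gt0 ?powR_gt0//.
  rewrite invrK ler_pdivrMl ?powR_gt0// mulrC -powRM ?(ltW k0) ?(ltW y0)//.
  apply: ge0_ler_powR => //; rewrite ?nnegrE; do ?exact: ltW.
  exact/ltW/mulr_gt0.
split.
  have := inv (u r) (u t) (C * (r / t) `^ b); rewrite !u0 H2 mulr_gt0 ?powR_gt0//.
  move=> /(_ isT isT isT isT) /le_trans; apply.
  by rewrite (powRM _ (ltW C0) (powR_ge0 _ _)) -powRrM opprK.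
have := inv (u t) (u r) (C * (r / t) `^ (- a)).
rewrite !u0 H1 mulr_gt0 ?powR_gt0//.
move=> /(_ isT isT isT isT) /le_trans; apply.
by rewrite (powRM _ (ltW C0) (powR_ge0 _ _)) -powRrM mulNr.
Qed.

(** Applied with [phi] the measure of concentric balls: the dyadic sums converge when the growth
    exponent a + m of the product is positive. *)
Lemma power_bounds_dec D a b C u (phi : R -> R) m Cm : (forall t, D t -> 0 < t) ->
  (forall t, 0 < u t) -> (forall t, D t -> 0 < phi t) -> 0 < C -> 0 < Cm ->
  power_bounds D a b C u ->
  (forall t r, D t -> D r -> t <= r -> phi t * (r / t) `^ m <= Cm * phi r) ->
  forall t r, D t -> D r -> t <= r ->
    u t * phi t <= C * Cm * (t / r) `^ (a + m) * (u r * phi r).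
Proof.
move=> Dpos u0 p0 C0 Cm0 ub pm t r Dt Dr tr.
have [H1 _] := ub t r Dt Dr tr; have H2 := pm t r Dt Dr tr.
have t0 := Dpos _ Dt; have r0 := Dpos _ Dr.
have rt0 : 0 < r / t by rewrite divr_gt0.
have E : t / r = (r / t)^-1 by rewrite invf_div.
rewrite E -(powR_inv1 (ltW rt0)) -powRrM mulN1r opprD.
rewrite powRD; last by rewrite (gt_eqF rt0) implybT.
have H3 : phi t <= Cm * (r / t) `^ (- m) * phi r.
  by rewrite mulrAC powRN ler_pdivlMr ?powR_gt0.
apply: le_trans (ler_pM (ltW (u0 t)) (ltW (p0 _ Dt)) H1 H3) _.
by rewrite le_eqVlt; apply/orP; left; apply/eqP; ring.
Qed.

(** When d x z is at least 2 c0 r, the weight is comparable on the ball to the constant U(d x z),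
    taken as the level. Otherwise the ball lies in the concentric ball B z (K r), of comparable
    measure, and the level is U(K r). *)
Lemma radial_Acond z (U : R -> R) s : 1 < s -> (forall t, 0 < U t) ->
  measurable_fun setT (fun y => U (d y z)) ->
  (forall K, 1 <= K -> exists2 C : R, 0 < C & forall t r, 0 < t -> 0 < r ->
     t <= K * r -> r <= K * t -> U t <= C * U r) ->
  (exists2 C : R, 0 < C & forall r, 0 < r ->
     (wint mu (fun y => U (d y z)) (B z r) <= (C * U r * bm z r)%:E)%E) ->
  (exists2 C : R, 0 < C & forall r, 0 < r ->
     (wint mu (fun y => (U (d y z) `^ (- (s - 1)^-1))%R) (B z r) <=
      (C * U r `^ (- (s - 1)^-1) * bm z r)%:E)%E) ->
  (forall x r, 0 < r -> (wint mu (fun y => U (d y z)) (B x r) < +oo)%E) /\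
  Acond d mu s (fun y => U (d y z)).
Proof.
move=> s1 U0 mU comp [C1 C10 I1] [C2 C20 I2].
have c00 := hs_c0_gt0 hs; have c01 := hs_c0 hs; have mB := hs_meas hs.
pose q := (s - 1)^-1; have q0 : 0 < q by rewrite invr_gt0 subr_gt0.
apply: (Acond_of_level hs s1 mU) => //.
have c02 : 1 <= 2 * c0 by lra.
have [Cc Cc0 Hc] := comp _ c02.
pose K := c0 * (2 * c0 + 1).
have K0 : 0 < K by rewrite mulr_gt0//; lra.
have [Cb Cb1 Hb] := ballm_dbl hs (2 * K ^+ 2 + K).
have Cb0 : 0 < Cb by exact: lt_le_trans Cb1.
have W0 k x r : 0 <= k -> 0 < r -> wint mu (fun=> k) (B x r) = (k * bm x r)%:E.
  by move=> k0 r0; rewrite wint_cst// (ballmE hs).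
exists (Cc + Cc `^ q + C1 * Cb + C2 * Cb).
  by rewrite !addr_gt0// ?mulr_gt0// powR_gt0.
move=> x r r0; have bx := ballm_gt0 hs x r0.
have fin3 (C a b' c : R) : 0 < C -> 0 < a -> 0 <= c -> C <= b' -> C * a * c <= b' * a * c.
  by move=> *; rewrite ler_wpM2r// ler_pM2r.
have [far|near] := leP (2 * c0 * r) (d x z).
  have D0 : 0 < d x z by apply: lt_le_trans far; rewrite !mulr_gt0.
  have comp1 y : B x r y -> [/\ 0 < d y z, d y z <= 2 * c0 * d x z &
      d x z <= 2 * c0 * d y z].
    rewrite /qball /= => yr.
    have H1 : d x z <= 2 * c0 * d y z by have := hs_tri hs x z y; nra.
    have H2 : d y z <= 2 * c0 * d x z.
      have := hs_tri hs y z x; rewrite [d y x](hs_sym hs) => H.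
      apply: (le_trans H); rewrite [2 * c0]mulrC -mulrA ler_pM2l//.
      by nra.
    split => //; have c20 : 0 < 2 * c0 by lra.
    by rewrite -(pmulr_rgt0 _ c20); exact: lt_le_trans H1.
  exists (U (d x z)); split => //.
    apply: (@le_trans _ _ (wint mu (fun=> Cc * U (d x z)) (B x r))).
      apply: le_nint => y; first by rewrite mulr_ge0 ?indic_ge0// ltW.
      rewrite indicE; case: (boolP (y \in B x r)) => [|_]; last by rewrite !mulr0.
      by rewrite inE !mulr1 => /comp1[a1 a2 a3]; exact: Hc.
    rewrite W0 ?mulr_ge0// ?(ltW Cc0) ?(ltW (U0 _))// lee_fin.
    apply: fin3 => //; first exact: ltW.
    by rewrite -!addrA lerDl !addr_ge0 ?mulr_ge0 ?powR_ge0// ltW.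
  apply: (@le_trans _ _ (wint mu (fun=> Cc `^ q * U (d x z) `^ (- q)) (B x r))).
    apply: le_nint => y; first by rewrite mulr_ge0 ?indic_ge0 ?powR_ge0.
    rewrite indicE; case: (boolP (y \in B x r)) => [|_]; last by rewrite !mulr0.
    rewrite inE !mulr1 => /comp1[a1 a2 a3]; have := Hc _ _ D0 a1 a3 a2 => H.
    rewrite !powRN -ler_pdivrMr ?invr_gt0 ?powR_gt0//.
    rewrite invrK ler_pdivrMl ?powR_gt0// mulrC -powRM ?(ltW Cc0) ?(ltW (U0 _))//.
    apply: ge0_ler_powR => //; rewrite ?nnegrE; do ?exact: ltW.
    exact/ltW/mulr_gt0.
  rewrite W0 ?mulr_ge0// ?powR_ge0// lee_fin.
  apply: fin3 => //; [exact: powR_gt0|exact: powR_gt0|exact: ltW|].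
  by rewrite -!addrA ler_wpDl ?(ltW Cc0)// lerDl addr_ge0 ?mulr_ge0// ltW.
have Kr0 : 0 < K * r by rewrite mulr_gt0.
have sub : B x r `<=` B z (K * r).
  apply: (qball_sub_ball hs); rewrite /K -mulrA ler_pM2l// (hs_sym hs) mulrDl mul1r.
  by rewrite lerD2r ltW.
have bz : bm z (K * r) <= Cb * bm x r.
  apply: le_trans (Hb x r r0); apply: (ballm_le hs) => //.
    by rewrite mulr_gt0// addr_gt0// mulr_gt0// exprn_gt0.
  apply: (qball_sub_ball hs).
  have : c0 <= K by rewrite /K ler_peMr// ?ltW//; lra.
  have : 2 * c0 ^+ 2 <= K by rewrite /K; nra.
  have : 0 <= d x z by exact: hs_ge0 hs _ _.
  move: near Kr0 r0 K0 c01; move: (d x z) => D.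
  rewrite expr2 => *.
  have : c0 * D <= K * r by nra.
  by nra.
exists (U (K * r)); split => //.
  apply: (@le_trans _ _ (wint mu (fun y => U (d y z)) (B z (K * r)))).
    by apply: le_wint => // y; exact: ltW.
  apply: le_trans (I1 _ Kr0) _; rewrite lee_fin.
  apply: (@le_trans _ _ (C1 * U (K * r) * (Cb * bm x r))).
    by rewrite ler_wpM2l// mulr_ge0// ltW.
  rewrite (_ : C1 * _ * _ = (C1 * Cb) * U (K * r) * bm x r); last by ring.
  apply: fin3 => //; [by rewrite mulr_gt0|exact: ltW|].
  by rewrite -addrA [leRHS]addrC -addrA lerDl !addr_ge0 ?mulr_ge0 ?powR_ge0// ltW.
apply: (@le_trans _ _ (wint mu (fun y => (U (d y z) `^ (- q))%R) (B z (K * r)))).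
  by apply: le_wint => // y; exact: powR_ge0.
apply: le_trans (I2 _ Kr0) _; rewrite lee_fin.
apply: (@le_trans _ _ (C2 * U (K * r) `^ (- q) * (Cb * bm x r))).
  by rewrite ler_wpM2l// mulr_ge0 ?powR_ge0// ltW.
rewrite (_ : C2 * _ * _ = (C2 * Cb) * U (K * r) `^ (- q) * bm x r); last by ring.
apply: fin3 => //; [by rewrite mulr_gt0|exact: powR_gt0|exact: ltW|].
by rewrite lerDr !addr_ge0 ?mulr_ge0 ?powR_ge0// ltW.
Qed.

Variables (z : X) (u : R -> R) (h0 : R).
Hypotheses (u0 : forall t, 0 < u t) (h00 : 0 < h0).

(** The condition a + m > 0 makes the dyadic sums for u converge. The dual weight u^(-q), q = 1 / (s
    - 1), has lower exponent -b q, and b < m (s - 1) is the same condition for it. *)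
Lemma local_weight a b C m Cm s : 1 < s -> 0 < C -> 0 < Cm -> 0 < m ->
  power_bounds [set t | 0 < t <= h0] a b C u ->
  (forall t r, 0 < t -> t <= r -> r <= h0 -> bm z t * (r / t) `^ m <= Cm * bm z r) ->
  - a < m -> b < m * (s - 1) -> mu [set z] = 0%E ->
  measurable_fun setT (fun y => u (Num.min (d y z) h0)) ->
  doubling_weight d mu (fun y => u (Num.min (d y z) h0)) /\
  Acond d mu s (fun y => u (Num.min (d y z) h0)).
Proof.
move=> s1 C0 Cm0 m0 ub hm am bms z0 mu_.
pose D := [set t | 0 < t <= h0].
pose q := (s - 1)^-1; have q0 : 0 < q by rewrite invr_gt0 subr_gt0.
have Dpos t : D t -> 0 < t by case/andP.
have Dcl t : 0 < t -> D (Num.min t h0).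
  by move=> t0; rewrite /D /= lt_min t0 h00 ge_min lexx orbT.
have hmD t r : D t -> D r -> t <= r -> bm z t * (r / t) `^ m <= Cm * bm z r.
  by case/andP => t0 th /andP[r0 rh] tr; exact: hm.
have bz t : D t -> 0 < bm z t by move=> /Dpos/(ballm_gt0 hs z).
have ub' := power_bounds_inv Dpos u0 C0 q0 ub.
have u0' t : 0 < u t `^ (- q) by exact: powR_gt0.
have Cq0 : 0 < C `^ q by exact: powR_gt0.
have [F A] : (forall x r, 0 < r ->
    (wint mu (fun y => u (Num.min (d y z) h0)) (B x r) < +oo)%E) /\
    Acond d mu s (fun y => u (Num.min (d y z) h0)).
  have [] // := @radial_Acond z (fun t => u (Num.min t h0)) s.
  - move=> K K1; exists (C * (K `^ `|a| + K `^ `|b|)).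
      by rewrite mulr_gt0// addr_gt0// powR_gt0//; lra.
    have mn t r : 0 < r -> t <= K * r -> Num.min t h0 <= K * Num.min r h0.
      move=> r0 tr; have [rh|hr] := leP r h0.
        by apply: le_trans tr; rewrite ge_min lexx.
      by apply: (@le_trans _ _ h0); rewrite ?ge_min ?lexx ?orbT// ler_peMl// ltW.
    move=> t r t0 r0 tr rt.
    by apply: (@power_bounds_comp D) => //; [exact: Dcl|exact: Dcl|exact: mn|exact: mn].
  - apply: (@radial_local _ _ _ _ _ _ hs z u h0 u0 h00 (a + m)
      (C * Cm + C * (2 `^ `|a| + 2 `^ `|b|))) => //.
    + lra.
    + by rewrite addr_gt0// mulr_gt0// addr_gt0// powR_gt0.
    + move=> t r t0 tr rh r2; apply: le_trans
        (@power_bounds_comp D _ _ _ _ 2 t r Dpos u0 C0 ub _ _ _ _ _) _ => //.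
      * by rewrite ler1n.
      * by rewrite /D /= t0 (le_trans tr).
      * by rewrite /D /= (lt_le_trans t0).
      * lra.
      * by rewrite ler_wpM2r ?(ltW (u0 _))// lerDr mulr_ge0// ltW.
    + move=> t r t0 tr rh.
      have Dt : D t by rewrite /D /= t0 (le_trans tr).
      have Dr : D r by rewrite /D /= (lt_le_trans t0).
      apply: le_trans (power_bounds_dec Dpos u0 bz C0 Cm0 ub hmD Dt Dr tr) _.
      have b1 := bz _ Dr; have := u0 r => ur.
      rewrite ler_wpM2r ?mulr_ge0 ?(ltW ur) ?(ltW b1)//.
      rewrite ler_wpM2r ?powR_ge0// lerDl mulr_ge0 ?addr_ge0 ?powR_ge0//.
      exact: ltW.
  - apply: (@radial_local _ _ _ _ _ _ hs z (fun t => u t `^ (- q)) h0 u0' h00 (- (b * q) + m)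
      (C `^ q * Cm + C `^ q * (2 `^ `|- (b * q)| + 2 `^ `|- (a * q)|))) => //.
    + rewrite addrC subr_gt0 /q ltr_pdivrMr// subr_gt0//.
    + by rewrite addr_gt0// mulr_gt0// addr_gt0// powR_gt0.
    + move=> t r t0 tr rh r2; apply: le_trans
        (@power_bounds_comp D _ _ _ _ 2 t r Dpos u0' Cq0 ub' _ _ _ _ _) _ => //.
      * by rewrite ler1n.
      * by rewrite /D /= t0 (le_trans tr).
      * by rewrite /D /= (lt_le_trans t0).
      * lra.
      * by rewrite ler_wpM2r ?(ltW (u0' _))// lerDr mulr_ge0// ltW.
    + move=> t r t0 tr rh.
      have Dt : D t by rewrite /D /= t0 (le_trans tr).
      have Dr : D r by rewrite /D /= (lt_le_trans t0).
      apply: le_trans (power_bounds_dec Dpos u0' bz Cq0 Cm0 ub' hmD Dt Dr tr) _.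
      have b1 := bz _ Dr; have := u0' r => ur.
      rewrite ler_wpM2r ?mulr_ge0 ?(ltW ur) ?(ltW b1)//.
      rewrite ler_wpM2r ?powR_ge0// lerDl mulr_ge0 ?addr_ge0 ?powR_ge0//.
    + exact: measurable_fun_powR_cst.
split=> //; apply: (Acond_doubling hs _ mu_ _ F A); first exact: lt_trans s1.
by move=> y; exact: ltW.
Qed.

(** The two conditions of [local_weight], now for the exponents at infinity. *)
Lemma infinity_weight a b C m Cm s : 1 < s -> 0 < C -> 0 < Cm ->
  power_bounds [set t | h0 <= t] a b C u ->
  (forall t r, h0 <= t -> t <= r -> bm z t * (r / t) `^ m <= Cm * bm z r) ->
  - a < m -> b < m * (s - 1) ->
  measurable_fun setT (fun y => u (Num.max (d y z) h0)) ->
  doubling_weight d mu (fun y => u (Num.max (d y z) h0)) /\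
  Acond d mu s (fun y => u (Num.max (d y z) h0)).
Proof.
move=> s1 C0 Cm0 ub hm am bms mu_.
pose D := [set t | h0 <= t].
pose q := (s - 1)^-1; have q0 : 0 < q by rewrite invr_gt0 subr_gt0.
have Dpos t : D t -> 0 < t by exact: lt_le_trans.
have Dcl t : 0 < t -> D (Num.max t h0).
  by move=> t0; rewrite /D /= le_max lexx orbT.
have hmD t r : D t -> D r -> t <= r -> bm z t * (r / t) `^ m <= Cm * bm z r.
  by move=> th rh tr; exact: hm.
have bz t : D t -> 0 < bm z t by move=> /Dpos/(ballm_gt0 hs z).
have ub' := power_bounds_inv Dpos u0 C0 q0 ub.
have u0' t : 0 < u t `^ (- q) by exact: powR_gt0.
have Cq0 : 0 < C `^ q by exact: powR_gt0.
have [F A] : (forall x r, 0 < r ->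
    (wint mu (fun y => u (Num.max (d y z) h0)) (B x r) < +oo)%E) /\
    Acond d mu s (fun y => u (Num.max (d y z) h0)).
  have [] // := @radial_Acond z (fun t => u (Num.max t h0)) s.
  - move=> K K1; exists (C * (K `^ `|a| + K `^ `|b|)).
      by rewrite mulr_gt0// addr_gt0// powR_gt0//; lra.
    have mn t r : 0 < r -> t <= K * r -> Num.max t h0 <= K * Num.max r h0.
      move=> r0 tr; rewrite ge_max; apply/andP; split.
        by apply: (le_trans tr); rewrite ler_wpM2l ?le_max ?lexx//; lra.
      apply: (@le_trans _ _ (Num.max r h0)); first by rewrite le_max lexx orbT.
      by rewrite ler_peMl// le_max (ltW r0).
    move=> t r t0 r0 tr rt.
    by apply: (@power_bounds_comp D) => //; [exact: Dcl|exact: Dcl|exact: mn|exact: mn].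
  - apply: (@radial_infty _ _ _ _ _ _ hs z u h0 u0 h00 (a + m)
      (C * Cm + C * (2 `^ `|a| + 2 `^ `|b|))) => //.
    + lra.
    + by rewrite addr_gt0// mulr_gt0// addr_gt0// powR_gt0.
    + move=> t r t0 tr r2; apply: le_trans
        (@power_bounds_comp D _ _ _ _ 2 t r Dpos u0 C0 ub _ _ _ _ _) _ => //.
      * by rewrite ler1n.
      * exact: le_trans tr.
      * by have := Dpos _ t0; lra.
      * by rewrite ler_wpM2r ?(ltW (u0 _))// lerDr mulr_ge0// ltW.
    + move=> t r Dt tr.
      have Dr : D r by exact: le_trans tr.
      apply: le_trans (power_bounds_dec Dpos u0 bz C0 Cm0 ub hmD Dt Dr tr) _.
      have b1 := bz _ Dr; have := u0 r => ur.
      rewrite ler_wpM2r ?mulr_ge0 ?(ltW ur) ?(ltW b1)//.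
      rewrite ler_wpM2r ?powR_ge0// lerDl mulr_ge0 ?addr_ge0 ?powR_ge0//.
      exact: ltW.
  - apply: (@radial_infty _ _ _ _ _ _ hs z (fun t => u t `^ (- q)) h0 u0' h00 (- (b * q) + m)
      (C `^ q * Cm + C `^ q * (2 `^ `|- (b * q)| + 2 `^ `|- (a * q)|))) => //.
    + rewrite addrC subr_gt0 /q ltr_pdivrMr// subr_gt0//.
    + by rewrite addr_gt0// mulr_gt0// addr_gt0// powR_gt0.
    + move=> t r t0 tr r2; apply: le_trans
        (@power_bounds_comp D _ _ _ _ 2 t r Dpos u0' Cq0 ub' _ _ _ _ _) _ => //.
      * by rewrite ler1n.
      * exact: le_trans tr.
      * by have := Dpos _ t0; lra.
      * by rewrite ler_wpM2r ?(ltW (u0' _))// lerDr mulr_ge0// ltW.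
    + move=> t r Dt tr.
      have Dr : D r by exact: le_trans tr.
      apply: le_trans (power_bounds_dec Dpos u0' bz Cq0 Cm0 ub' hmD Dt Dr tr) _.
      have b1 := bz _ Dr; have := u0' r => ur.
      rewrite ler_wpM2r ?mulr_ge0 ?(ltW ur) ?(ltW b1)//.
      rewrite ler_wpM2r ?powR_ge0// lerDl mulr_ge0 ?addr_ge0 ?powR_ge0//.
    + exact: measurable_fun_powR_cst.
split=> //; apply: (Acond_doubling hs _ mu_ _ F A); first exact: lt_trans s1.
by move=> y; exact: ltW.
Qed.

End radial_class.

(** * Indices *)

Section indices.
Context (R : realType).
Implicit Types (t a b h s r : R) (phi w u : R -> R).

(** An index is a supremum over t, so a strict lower bound is already witnessed by a single t > 1,
    and the limit inferior turns it into an inequality valid eventually. *)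
Lemma lower_index_gt (f : R -> R -> \bar R) (F : set_system R) (a : R) :
  Filter F -> (a%:E < lower_index (fun t => limf_einf (f t) F))%E ->
  exists2 t, 1 < t & \forall h \near F, ((t `^ a)%:E < f t h)%E.
Proof.
move=> FF /ereal_sup_gt[_ [t /= t1 <-] at_].
have t0 : 0 < t by apply: lt_trans t1.
have lt0 : 0 < ln t by rewrite ln_gt0.
exists t => //.
have : ((t `^ a)%:E < limf_einf (f t) F)%E.
  (* A non-positive limit inferior has [lne] equal to -oo and cannot exceed a. *)
  move: at_; case: (limf_einf (f t) F) => [L| |] /=.
  - case: ifPn => [_|]; last rewrite -ltNge => L0.
      by rewrite mulNyr gtr0_sg ?invr_gt0// mul1e ltNge leNye.
    rewrite -EFinM !lte_fin ltr_pdivlMr// /powR gt_eqF// => H.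
    by rewrite -[L in ltRHS]lnK ?posrE// ltr_expR.
  - by rewrite ltry.
  - by rewrite mulNyr gtr0_sg ?invr_gt0// mul1e ltNge leNye.
rewrite /limf_einf lteNr => /ereal_inf_lt[_ [V FV <-]] H.
apply: filterS FV => h Vh.
have : (- f t h <= ereal_sup [set (- f t x)%E | x in V])%E.
  by apply: ereal_sup_ubound; exists h.
by move=> /le_lt_trans/(_ H); rewrite lteN2.
Qed.

Lemma upper_index_lt (f : R -> R -> \bar R) (F : set_system R) (b : R) :
  Filter F -> (upper_index (fun t => limf_esup (f t) F) < b%:E)%E ->
  exists2 t, 1 < t & \forall h \near F, (f t h < (t `^ b)%:E)%E.
Proof.
move=> FF /ereal_inf_lt[_ [t /= t1 <-] at_].
have t0 : 0 < t by apply: lt_trans t1.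
have lt0 : 0 < ln t by rewrite ln_gt0.
exists t => //.
have : (limf_esup (f t) F < (t `^ b)%:E)%E.
  move: at_; case: (limf_esup (f t) F) => [L| |] /=.
  - case: ifPn => [L0 _|]; last rewrite -ltNge => L0.
      by rewrite lte_fin (le_lt_trans L0)// powR_gt0.
    rewrite -EFinM !lte_fin ltr_pdivrMr// /powR gt_eqF// => H.
    by rewrite -[L in ltLHS]lnK ?posrE// ltr_expR.
  - by rewrite mulyr gtr0_sg ?invr_gt0// mul1e.
  - by rewrite ltNyr.
rewrite limf_esupE => /ereal_inf_lt[_ [V FV <-]] H.
apply: filterS FV => h Vh; apply: le_lt_trans H.
by apply: ereal_sup_ubound; exists h.
Qed.

Lemma near_right0 (P : R -> Prop) : (\forall h \near 0^'+, P h) ->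
  exists2 e, 0 < e & forall h, 0 < h -> h <= e -> P h.
Proof.
rewrite near_withinE => /nbhs_ballP[e /= e0 He].
exists (e / 2); first by rewrite divr_gt0.
move=> h h0 he; apply: He => //; rewrite -ball_normE /= sub0r normrN gtr0_norm//.
by lra.
Qed.

Lemma near_pinfty (P : R -> Prop) : (\forall h \near +oo, P h) ->
  exists M : R, forall h, M <= h -> P h.
Proof.
move=> [M [_ HM]]; exists (M + 1) => h Mh; apply: HM; lra.
Qed.

Lemma expr_unbounded (x t : R) : 1 < t -> exists n, x <= t ^+ n.
Proof.
move=> t1; have t0 : 0 < t by apply: lt_trans t1.
have [x0|x0] := leP x 0; first by exists 0%N; rewrite expr0 (le_trans x0).
have lt0 : 0 < ln t by rewrite ln_gt0.
exists (Num.truncn `|ln x / ln t|).+1.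
rewrite -powR_mulrn ?(ltW t0)// /powR gt_eqF// -[x in leLHS]lnK ?posrE//.
rewrite ler_expR -ler_pdivrMr// (le_trans (ler_norm _))//.
exact/ltW/truncnS_gt.
Qed.

Variable D : set R.
Hypotheses (Dpos : forall t, D t -> 0 < t)
  (Dconv : forall s h x, D s -> D h -> s <= x -> x <= h -> D x).

(** The dilation is iterated, moving [s] up by factors of [t] until h / s is at most [t]. Only the
    remaining step uses [mon], so the constant does not grow with the number of iterations. *)
Lemma dilation_lower phi t a C : 1 < t -> 1 <= C -> (forall h, 0 < h -> 0 < phi h) ->
  (forall h, D h -> t `^ a * phi h <= phi (h * t)) ->
  (forall s h, D s -> s <= h -> h <= t * s -> phi s <= C * phi h) ->
  forall s h, D s -> D h -> s <= h ->
    phi s <= C * t `^ `|a| * (h / s) `^ (- a) * phi h.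
Proof.
move=> t1 C1 p0 dil mon s h Ds Dh sh.
have t0 : 0 < t by lra. have C0 : 0 <= C by lra.
have h0 := Dpos Dh.
have [n Hn] : exists n, h <= s * t ^+ n.
  have s0 := Dpos Ds.
  have [n Hn] := expr_unbounded (h / s) t1.
  by exists n; rewrite mulrC -ler_pdivrMr.
elim: n s Ds sh Hn => [|n IH] s Ds sh Hn; have s0 := Dpos Ds.
all: have [hts|] := leP h (t * s).
- apply: (le_trans (mon _ _ Ds sh hts)); rewrite -!mulrA ler_wpM2l//.
  rewrite mulrA ler_peMl//; first exact/ltW/p0.
  rewrite powRN -ler_pdivrMr ?invr_gt0 ?powR_gt0 ?divr_gt0//.
  by rewrite invrK mul1r powR_le_norm// ?ler_pdivlMr ?mul1r// ler_pdivrMr.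
- by move: Hn; rewrite expr0 mulr1; nra.
- apply: (le_trans (mon _ _ Ds sh hts)); rewrite -!mulrA ler_wpM2l//.
  rewrite mulrA ler_peMl//; first exact/ltW/p0.
  rewrite powRN -ler_pdivrMr ?invr_gt0 ?powR_gt0 ?divr_gt0//.
  by rewrite invrK mul1r powR_le_norm// ?ler_pdivlMr ?mul1r// ler_pdivrMr.
- move=> /ltW tsh.
  have Dst : D (s * t) by apply: (@Dconv s h) => //; nra.
  have sth : s * t <= h by rewrite mulrC.
  have Hn' : h <= s * t * t ^+ n by rewrite -mulrA -exprS.
  have := IH (s * t) Dst sth Hn' => H.
  have ta : 0 < t `^ a by rewrite powR_gt0.
  rewrite -(ler_pM2l ta); apply: (le_trans (dil s Ds)); apply: (le_trans H).
  have -> : h / (s * t) = h / s * t^-1 by rewrite invfM mulrA.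
  rewrite (@powRM _ (h / s)) ?divr_ge0 ?invr_ge0 ?(ltW h0) ?(ltW s0) ?(ltW t0)//.
  have -> : t^-1 `^ (- a) = t `^ a.
    by rewrite -powR_inv1 ?(ltW t0)// -powRrM mulN1r opprK.
  by rewrite le_eqVlt; apply/orP; left; apply/eqP; ring.
Qed.

(** Here [h] is moved down by factors of [t]. In the remaining step [mon] would compare [s] and [h]
    in the wrong direction, so h is first dominated by t s and the dilation is applied at [s]. The
    point t s may leave [D], which is why [mon] asks membership of its smaller argument only. *)
Lemma dilation_upper phi t b C : 1 < t -> 1 <= C -> (forall h, 0 < h -> 0 < phi h) ->
  (forall h, D h -> phi (h * t) <= t `^ b * phi h) ->
  (forall s h, D s -> s <= h -> h <= t * s -> phi s <= C * phi h) ->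
  forall s h, D s -> D h -> s <= h ->
    phi h <= C * t `^ `|b| * t `^ `|b| * (h / s) `^ b * phi s.
Proof.
move=> t1 C1 p0 dil mon s h Ds Dh sh.
have t0 : 0 < t by lra. have C0 : 0 <= C by lra.
have s0 := Dpos Ds.
have base h' : D h' -> s <= h' -> h' <= t * s ->
    phi h' <= C * t `^ `|b| * t `^ `|b| * (h' / s) `^ b * phi s.
  move=> Dh' sh' hts; have h'0 := Dpos Dh'.
  have H1 : phi h' <= C * phi (t * s).
    by apply: mon => //; rewrite ler_pM2l.
  apply: (le_trans H1); rewrite -!mulrA ler_wpM2l//.
  apply: (@le_trans _ _ (t `^ b * phi s)); first by rewrite [t * s]mulrC dil.
  rewrite !mulrA ler_wpM2r ?(ltW (p0 _ s0))// -mulrA.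
  apply: (@le_trans _ _ (t `^ `|b|)); first by rewrite powR_le_norm// ltW.
  rewrite ler_peMr ?powR_ge0//.
  rewrite -[b]opprK powRN -ler_pdivrMr ?invr_gt0 ?powR_gt0 ?divr_gt0//.
  rewrite invrK mul1r opprK -normrN powR_le_norm// ?ler_pdivlMr ?mul1r// ler_pdivrMr//.
have [n Hn] : exists n, h <= s * t ^+ n.
  have [n Hn] := expr_unbounded (h / s) t1.
  by exists n; rewrite mulrC -ler_pdivrMr.
elim: n h Dh sh Hn => [|n IH] h Dh sh Hn; have h0 := Dpos Dh.
all: have [hts|] := leP h (t * s); first exact: base.
- by move: Hn; rewrite expr0 mulr1; nra.
- move=> /ltW tsh.
  have sht : s <= h / t by rewrite ler_pdivlMr// mulrC.
  have hth : h / t <= h by rewrite ler_pdivrMr//; nra.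
  have Dht : D (h / t) by apply: (@Dconv s h).
  have Hn' : h / t <= s * t ^+ n by rewrite ler_pdivrMr// -mulrA -exprSr.
  have := IH (h / t) Dht sht Hn' => H.
  have := dil _ Dht; rewrite divfK ?gt_eqF// => /le_trans; apply.
  have tb : 0 < t `^ b by rewrite powR_gt0.
  apply: (le_trans (ler_wpM2l (ltW tb) H)).
  rewrite [h / t / s]mulrAC.
  rewrite (@powRM _ (h / s)) ?divr_ge0 ?invr_ge0 ?(ltW h0) ?(ltW s0) ?(ltW t0)//.
  have -> : t^-1 `^ b = (t `^ b)^-1.
    by rewrite -powR_inv1 ?(ltW t0)// -powRrM mulN1r powRN.
  rewrite le_eqVlt; apply/orP; left; apply/eqP.
  by field; rewrite gt_eqF.
Qed.

End indices.

Lemma lte_dense_fin (R : realType) (x y : \bar R) : (x < y)%E ->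
  exists2 r : R, (x < r%:E)%E & (r%:E < y)%E.
Proof.
case: x y => [x| |] [y| |] // xy.
- by exists ((x + y) / 2); rewrite lte_fin; move: xy; rewrite lte_fin; lra.
- by exists (x + 1); rewrite ?lte_fin ?ltry//; lra.
- by exists (y - 1); rewrite ?lte_fin ?ltNyr//; lra.
- by exists 0; rewrite ?ltNyr ?ltry.
Qed.

(** * Power bounds from the indices *)

Section index_bounds.
Context (R : realType).
Implicit Types (t a b h s r : R) (phi w u : R -> R).

Lemma power_bounds_intro (D : set R) a b C1 C2 w : (forall t, D t -> 0 < t) ->
  (forall t, 0 < t -> 0 < w t) -> 0 < C1 -> 0 < C2 ->
  (forall s h, D s -> D h -> s <= h -> w s <= C1 * (h / s) `^ (- a) * w h) ->
  (forall s h, D s -> D h -> s <= h -> w h <= C2 * (h / s) `^ b * w s) ->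
  power_bounds D a b (C1 + C2) w.
Proof.
move=> Dpos w0 C10 C20 H1 H2 s h Ds Dh sh.
have s0 := w0 _ (Dpos _ Ds); have h0 := w0 _ (Dpos _ Dh).
split; [apply: (le_trans (H1 _ _ Ds Dh sh))|apply: (le_trans (H2 _ _ Ds Dh sh))].
  by rewrite ler_wpM2r ?ler_wpM2r ?powR_ge0 ?(ltW h0)// lerDl ltW.
by rewrite ler_wpM2r ?ler_wpM2r ?powR_ge0 ?(ltW s0)// lerDr ltW.
Qed.

(** Between points of ratio at most [K], the factor t^c varies by at most K^|c|. *)
Lemma almost_increasing_mono (D : set R) c w : (forall t, D t -> 0 < t) ->
  (forall t, 0 < t -> 0 < w t) ->
  (exists2 C, 0 < C & forall s t, D s -> D t -> s <= t ->
     s `^ c * w s <= C * (t `^ c * w t)) ->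
  forall K, 1 < K -> exists2 C, 1 <= C & forall s h, D s -> D h ->
    s <= h -> h <= K * s -> w s <= C * w h.
Proof.
move=> Dpos w0 [C C0 HC] K K1; exists (1 + C * K `^ `|c|).
  by rewrite lerDl mulr_ge0 ?powR_ge0// ltW.
move=> s h Ds Dh sh hK; have s0 := Dpos _ Ds; have h0 := Dpos _ Dh.
have := HC _ _ Ds Dh sh; rewrite -ler_pdivlMl ?powR_gt0// => /le_trans; apply.
have -> : (s `^ c)^-1 * (C * (h `^ c * w h)) = C * (h / s) `^ c * w h.
  rewrite powRM ?invr_ge0 ?ltW// -[s^-1]powR_inv1 ?(ltW s0)// -powRrM mulN1r powRN.
  by ring.
rewrite ler_wpM2r ?(ltW (w0 _ h0))// ler_wpDl// ler_wpM2l ?(ltW C0)//.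
by rewrite powR_le_norm ?(ltW K1)// ?ler_pdivlMr ?mul1r// ler_pdivrMr.
Qed.

Lemma weight_mono01 w : Wtilde w -> forall K, 1 < K ->
  exists2 C, 1 <= C & forall s h, 0 < s -> h <= 1 -> s <= h -> h <= K * s ->
    w s <= C * w h.
Proof.
move=> [_ w0 [c [v [vE _ _ [_ [C C0 HC]]]]] _] K K1.
have [| |C' C'1 H] := @almost_increasing_mono [set t | 0 < t <= 1] c w _ w0 _ K K1.
- by move=> t /andP[].
- exists C => // s t /andP[s0 s1] /andP[t0 t1] st; rewrite -!vE//.
  by apply: HC => //=; rewrite in_itv /= ltW.
exists C' => // s h s0 h1 sh hK; apply: H => //=.
  by rewrite s0 (le_trans sh).
by rewrite h1 (lt_le_trans s0).
Qed.

Lemma weight_mono1oo w : Wtilde w -> forall K, 1 < K ->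
  exists2 C, 1 <= C & forall s h, 1 <= s -> s <= h -> h <= K * s ->
    w s <= C * w h.
Proof.
move=> [_ w0 _ [c [_ _ [_ [C C0 HC]] _]]] K K1.
have [| |C' C'1 H] := @almost_increasing_mono [set t | 1 <= t] c w _ w0 _ K K1.
- by move=> t /=; exact: lt_le_trans.
- by exists C => // s t s1 t1 st; apply: HC => //=; rewrite in_itv /= andbT.
exists C' => // s h s1 sh hK; apply: H => //=.
exact: le_trans sh.
Qed.

Lemma weight_bounds_zero w a b : Wtilde w -> (a%:E < m_idx w)%E ->
  (M_idx w < b%:E)%E -> exists2 h0, 0 < h0 & exists2 C, 0 < C &
    power_bounds [set t | 0 < t <= h0] a b C w.
Proof.
move=> Ww /(lower_index_gt _)[t1 t11 /near_right0[e1 e10 H1]].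
move=> /(upper_index_lt _)[t2 t21 /near_right0[e2 e20 H2]].
have [_ w0 _ _] := Ww.
have [C1 C11 M1] := weight_mono01 Ww t11.
have [C2 C21 M2] := weight_mono01 Ww t21.
have t10 : 0 < t1 by lra. have t20 : 0 < t2 by lra.
(* Besides the range of the two dilation inequalities, h0 stays below 1 / t1 and 1 / t2, so that
   dilated arguments remain in ]0, 1], where [weight_mono01] applies. *)
pose h0 := Num.min (Num.min e1 e2) (Num.min t1^-1 t2^-1).
have h00 : 0 < h0 by rewrite !lt_min e10 e20 !invr_gt0 t10 t20.
have he1 : h0 <= e1 by rewrite !ge_min lexx.
have he2 : h0 <= e2 by rewrite !ge_min lexx ?orbT.
have ht1 : h0 <= t1^-1 by rewrite !ge_min lexx ?orbT.
have ht2 : h0 <= t2^-1 by rewrite !ge_min lexx ?orbT.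
have top t s h : 0 < t -> h0 <= t^-1 -> 0 < s <= h0 -> h <= t * s -> h <= 1.
  move=> t0 ht /andP[s0 sh0] hts; apply: (le_trans hts).
  by rewrite -(@mulfV _ t) ?gt_eqF// ler_pM2l// (le_trans sh0).
exists h0 => //.
exists (C1 * t1 `^ `|a| + C2 * t2 `^ `|b| * t2 `^ `|b|).
  by rewrite addr_gt0// !mulr_gt0 ?powR_gt0//; lra.
have Dpos t : [set t | 0 < t <= h0] t -> 0 < t by case/andP.
have Dconv s h x : [set t | 0 < t <= h0] s -> [set t | 0 < t <= h0] h ->
    s <= x -> x <= h -> [set t | 0 < t <= h0] x.
  move=> /andP[s0 _] /andP[_ hh] sx xh /=.
  by rewrite (lt_le_trans s0)// (le_trans xh).
apply: power_bounds_intro => //.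
- by rewrite mulr_gt0 ?powR_gt0//; lra.
- by rewrite !mulr_gt0 ?powR_gt0//; lra.
- apply: dilation_lower => //.
    move=> h /andP[h_0 hh]; have := H1 h h_0 (le_trans hh he1).
    by rewrite lte_fin ltr_pdivlMr ?w0// => /ltW.
  move=> s h Ds sh hts; apply: M1 => //; first by case/andP: Ds.
  exact: top hts.
- apply: dilation_upper => //.
    move=> h /andP[h_0 hh]; have := H2 h h_0 (le_trans hh he2).
    by rewrite lte_fin ltr_pdivrMr ?w0// => /ltW.
  move=> s h Ds sh hts; apply: M2 => //; first by case/andP: Ds.
  exact: top hts.
Qed.

Lemma weight_bounds_infty w a b : Wtilde w -> (a%:E < m_idx_infty w)%E ->
  (M_idx_infty w < b%:E)%E -> exists2 h0, 1 <= h0 & exists2 C, 0 < C &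
    power_bounds [set t | h0 <= t] a b C w.
Proof.
move=> Ww /(lower_index_gt _)[t1 t11 /near_pinfty[e1 H1]].
move=> /(upper_index_lt _)[t2 t21 /near_pinfty[e2 H2]].
have [_ w0 _ _] := Ww.
have [C1 C11 M1] := weight_mono1oo Ww t11.
have [C2 C21 M2] := weight_mono1oo Ww t21.
have t10 : 0 < t1 by lra. have t20 : 0 < t2 by lra.
pose h0 := Num.max (Num.max e1 e2) 1.
have h01 : 1 <= h0 by rewrite !le_max lexx orbT.
have he1 : e1 <= h0 by rewrite !le_max lexx.
have he2 : e2 <= h0 by rewrite !le_max lexx ?orbT.
exists h0 => //.
exists (C1 * t1 `^ `|a| + C2 * t2 `^ `|b| * t2 `^ `|b|).
  by rewrite addr_gt0// !mulr_gt0 ?powR_gt0//; lra.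
have Dpos t : [set t | h0 <= t] t -> 0 < t.
  by rewrite /= => ?; apply: lt_le_trans (le_trans h01 _).
have Dconv s h x : [set t | h0 <= t] s -> [set t | h0 <= t] h ->
    s <= x -> x <= h -> [set t | h0 <= t] x.
  by move=> /= hs _ sx _; exact: le_trans sx.
apply: power_bounds_intro => //.
- by rewrite mulr_gt0 ?powR_gt0//; lra.
- by rewrite !mulr_gt0 ?powR_gt0//; lra.
- apply: dilation_lower => //.
    move=> h Dh; have := H1 h (le_trans he1 Dh).
    by rewrite lte_fin ltr_pdivlMr ?w0 ?Dpos// => /ltW.
  by move=> s h Ds sh hts; apply: M1 => //; exact: le_trans Ds.
- apply: dilation_upper => //.
    move=> h Dh; have := H2 h (le_trans he2 Dh).
    by rewrite lte_fin ltr_pdivrMr ?w0 ?Dpos// => /ltW.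
  by move=> s h Ds sh hts; apply: M2 => //; exact: le_trans Ds.
Qed.

Context (disp : measure_display) (X : measurableType disp).
Variables (d : X -> X -> R) (mu : {measure set X -> \bar R}) (c0 : R).
Hypothesis hs : homogeneous d mu c0.
Local Notation bm := (ballm d mu).

Let bm_mono (x : X) s h : 0 < s -> s <= h -> bm x s <= bm x h.
Proof.
by move=> s0 sh; apply: (ballm_le hs) => //;
  [exact: lt_le_trans sh|exact: qball_sub].
Qed.

(** The infimum over points inside [m_mu] is what makes the threshold and the constant uniform in
    [x]. *)
Lemma measure_bounds_zero a : (a%:E < m_mu d mu)%E ->
  exists2 h0, 0 < h0 & exists2 C, 0 < C & forall x t r, 0 < t -> t <= r ->
    r <= h0 -> bm x t * (r / t) `^ a <= C * bm x r.
Proof.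
move=> /(lower_index_gt _)[t t1 /near_right0[h0 h00 H]].
exists h0 => //; exists (1 * t `^ `|a|); first by rewrite mul1r powR_gt0//; lra.
move=> x s r s0 sr rh.
have r0 : 0 < r by exact: lt_le_trans sr.
rewrite -ler_pdivlMr ?powR_gt0 ?divr_gt0// mulrAC -powRN.
apply: (@dilation_lower R [set t | 0 < t <= h0]) => //=.
- by move=> ? /andP[].
- by move=> s' h' x' /andP[s'0 _] /andP[_ h'h] sx xh;
    rewrite (lt_le_trans s'0)//= (le_trans xh).
- by move=> h h_0; exact: (ballm_gt0 hs).
- move=> h /andP[h_0 hh]; rewrite -ler_pdivlMr ?(ballm_gt0 hs)//.
  rewrite -lee_fin ltW//; apply: lt_le_trans (H h h_0 hh) _.
  by apply: ereal_inf_lbound; exists x.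
- by move=> s' h /andP[s'0 _] sh _; rewrite mul1r bm_mono.
- by rewrite s0 (le_trans sr).
- by rewrite r0.
Qed.

Lemma measure_bounds_infty (x : X) a : (a%:E < m_mu_infty d mu x)%E ->
  exists2 h0, 1 <= h0 & exists2 C, 0 < C & forall t r, h0 <= t -> t <= r ->
    bm x t * (r / t) `^ a <= C * bm x r.
Proof.
move=> /(lower_index_gt _)[t t1 /near_pinfty[M H]].
pose h0 := Num.max M 1; have h01 : 1 <= h0 by rewrite le_max lexx orbT.
exists h0 => //; exists (1 * t `^ `|a|); first by rewrite mul1r powR_gt0//; lra.
have pos s : h0 <= s -> 0 < s by move=> ?; apply: lt_le_trans (le_trans h01 _).
move=> s r s0 sr; have r0 := le_trans s0 sr.
rewrite -ler_pdivlMr ?powR_gt0 ?divr_gt0 ?pos// mulrAC -powRN.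
apply: (@dilation_lower R [set t | h0 <= t]) => //=.
- by move=> s' h' x' ? _ ? _; exact: le_trans (_ : s' <= x').
- by move=> h h_0; exact: (ballm_gt0 hs).
- move=> h hh; rewrite -ler_pdivlMr ?(ballm_gt0 hs) ?pos//.
  rewrite -lee_fin ltW//; apply: H.
  by apply: le_trans hh; rewrite le_max lexx.
- by move=> s' h s'0 sh _; rewrite mul1r bm_mono// pos.
Qed.

Lemma measure_upper_infty (x : X) b : (M_mu_infty d mu x < b%:E)%E ->
  exists2 h0, 1 <= h0 & exists2 C, 0 < C & forall t r, h0 <= t -> t <= r ->
    bm x r <= C * (r / t) `^ b * bm x t.
Proof.
move=> /(upper_index_lt _)[t t1 /near_pinfty[M H]].
pose h0 := Num.max M 1; have h01 : 1 <= h0 by rewrite le_max lexx orbT.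
exists h0 => //; exists (1 * t `^ `|b| * t `^ `|b|).
  by rewrite mul1r mulr_gt0// powR_gt0//; lra.
have pos s : h0 <= s -> 0 < s by move=> ?; apply: lt_le_trans (le_trans h01 _).
move=> s r s0 sr; have r0 := le_trans s0 sr.
apply: (@dilation_upper R [set t | h0 <= t]) => //=.
- by move=> s' h' x' ? _ ? _; exact: le_trans (_ : s' <= x').
- by move=> h h_0; exact: (ballm_gt0 hs).
- move=> h hh; rewrite -ler_pdivrMr ?(ballm_gt0 hs) ?pos//.
  rewrite -lee_fin ltW//; apply: H.
  by apply: le_trans hh; rewrite le_max lexx.
- by move=> s' h s'0 sh _; rewrite mul1r bm_mono// pos.
Qed.

(** Otherwise two reals b < a strictly between the indices would make balls grow at least like r^a
    and at most like r^b. *)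
Lemma m_mu_infty_le_M (x : X) : (m_mu_infty d mu x <= M_mu_infty d mu x)%E.
Proof.
rewrite leNgt; apply/negP => Mm.
have [b Mb bm'] : exists2 b : R, (M_mu_infty d mu x < b%:E)%E &
    (b%:E < m_mu_infty d mu x)%E by exact: lte_dense_fin.
have [a ba am] : exists2 a : R, (b%:E < a%:E)%E &
    (a%:E < m_mu_infty d mu x)%E by exact: lte_dense_fin.
have [h1 h11 [C1 C10 H1]] := measure_bounds_infty am.
have [h2 h21 [C2 C20 H2]] := measure_upper_infty Mb.
pose h := Num.max h1 h2.
have hh1 : h1 <= h by rewrite le_max lexx.
have hh2 : h2 <= h by rewrite le_max lexx orbT.
have h0 : 0 < h by apply: lt_le_trans hh1; lra.
have ab : 0 < a - b by rewrite subr_gt0 -lte_fin.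
pose C := 1 + C1 * C2; have C0 : 1 < C by rewrite ltrDl mulr_gt0.
(* Chosen so that (r / h)^(a - b) equals 1 + C1 C2, while the two growth bounds force it to be at
   most C1 C2. *)
pose r := h * C `^ (a - b)^-1.
have Cp1 : 1 <= C `^ (a - b)^-1.
  by rewrite -[leLHS](powRr0 C) ler_powR ?(ltW C0)// invr_ge0 ltW.
have hr : h <= r by rewrite ler_peMr ?(ltW h0).
have E : r / h = C `^ (a - b)^-1 by rewrite /r mulrAC divff ?mul1r// gt_eqF.
have := H1 h r hh1 hr; have := H2 h r hh2 hr; rewrite E => K2 K1.
have bh := ballm_gt0 hs x h0.
have := le_trans K1 (ler_wpM2l (ltW C10) K2).
set z := C `^ (a - b)^-1; have z0 : 0 < z by rewrite powR_gt0// (lt_trans _ C0).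
have -> : C1 * (C2 * z `^ b * bm x h) = bm x h * (C1 * C2 * z `^ b) by ring.
rewrite ler_pM2l// => K3.
have : z `^ (a - b) <= C1 * C2.
  rewrite powRB; last by rewrite (gt_eqF z0) implybT.
  by rewrite ler_pdivrMr// powR_gt0.
rewrite /z -powRrM mulVf ?gt_eqF// powRr1; last by lra.
rewrite /C; lra.
Qed.

End index_bounds.

(** * Variable exponents *)

Section variable_exponent.
Context (R : realType) (disp : measure_display) (X : measurableType disp).
Variables (d : X -> X -> R) (mu : {measure set X -> \bar R}) (c0 : R).
Hypothesis hs : homogeneous d mu c0.
Local Notation B := (qball d).
Local Notation bm := (ballm d mu).
Local Notation wm := (wballm d mu).
Implicit Types (v g F rho : X -> R) (A Q : set X) (x y z : X) (r s t : R).

Lemma measurable_powR_var F (p : X -> R) : measurable_fun setT F ->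
  measurable_fun setT p -> (forall x, 0 <= F x) -> (forall x, 0 < p x) ->
  measurable_fun setT (fun x => F x `^ p x).
Proof.
move=> mF mp F0 p0.
(* The factor [(0 < F x)] gives the value 0 where F vanishes, since the exponential formula for the
   power fails there. *)
rewrite (_ : (fun x => _) = fun x => (0 < F x)%R%:R * expR (p x * ln (F x))).
  apply: measurable_funM; first exact: measurable_fun_lt_cst.
  apply: (measurableT_comp (@measurable_expR R)).
  apply: measurable_funM => //.
  exact: (measurableT_comp (@measurable_ln R)).
apply/funext => x; rewrite /powR; have := F0 x; rewrite le_eqVlt.
case/predU1P => [<-|Fx]; first by rewrite eqxx ltxx mul0r gt_eqF.
by rewrite gt_eqF// Fx mul1r.
Qed.

Lemma nint_null (N0 : set X) F : measurable N0 -> mu N0 = 0%E ->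
  measurable_fun setT F -> (forall x, 0 <= F x) ->
  nint mu F = nint mu (fun x => F x * \1_(~` N0) x).
Proof.
move=> mN N_0 mF F0; apply: ae_eq_integral => //.
- exact/measurable_EFinP.
- apply/measurable_EFinP; apply: measurable_mul_indic => //.
  exact: measurableC.
exists N0; split=> // x /= H; apply: contrapT => nx; apply: H => _.
by rewrite indicE mem_set ?mulr1.
Qed.

(** F is divided by l = (1 + a)^(t / p(x)), which would normalise the v-average of its power exactly
    if p were constant on the ball; the oscillation hypothesis limits the error to the factor Z =
    exp L. With G = (F / l)^(p / (s t)), A_s bounds the average of G, and F <= l (1 + G) because p
    >= s t. *)
Lemma variable_averages (p : X -> R) v s t Q L pp : 1 < s -> 1 < t ->
  doubling_weight d mu v -> Acond d mu s v -> measurable_fun setT p ->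
  (forall x, 0 < p x) -> measurable Q -> (forall y, Q y -> s * t <= p y) ->
  (forall x, p x <= pp) ->
  exists2 C : R, 0 < C & forall F c rad a x, measurable_fun setT F ->
  (forall y, 0 <= F y) -> 0 < rad -> B c rad `<=` Q -> B c rad x -> 0 <= a ->
  (wint mu (fun y => (F y `^ (p y / t) * \1_Q y * v y)%R) (B c rad) =
     (a * wm v c rad)%:E)%E ->
  (forall y, B c rad y -> `|p x - p y| * ln (1 + a) <= L) ->
  (wint mu F (B c rad) <= (C * (1 + a) `^ (t / p x) * bm c rad)%:E)%E.
Proof.
move=> s1 t1 dw Ac mp p0 mQ pQ ppx.
have t0 : 0 < t by lra. have s0 : 0 < s by lra.
have [C C0 HC] := Acond_scaled hs s0 dw Ac.
have v0 := dw_ge0 dw; have mv := dw_meas dw; have mB := hs_meas hs.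
pose Z := expR L; have Z0 : 0 < Z by exact: expR_gt0.
exists (1 + C * Z `^ s^-1); first by rewrite addr_gt0// mulr_gt0// powR_gt0.
move=> F c rad a x mF F0 rad0 BQ xB a0 Ha Hosc.
have a10 : 0 < 1 + a by rewrite ltr_wpDr.
pose l := (1 + a) `^ (t / p x).
have l0 : 0 < l by exact: powR_gt0.
pose G y := (F y / l) `^ (p y / t / s) * \1_Q y.
have mFl : measurable_fun setT (fun y => F y / l) by exact: measurable_funM.
have Fl0 y : 0 <= F y / l by rewrite divr_ge0// ltW.
have mG : measurable_fun setT G.
  apply: measurable_mul_indic => //; apply: measurable_powR_var => //.
  - by apply: measurable_funM => //; apply: measurable_funM.
  - by move=> y; rewrite !divr_gt0.
have G0 y : 0 <= G y by rewrite mulr_ge0 ?powR_ge0 ?indic_ge0.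
have wB0 := wballm_gt0 c dw rad0.
have mg : measurable_fun setT (fun y => F y `^ (p y / t) * \1_Q y * v y).
  apply: measurable_funM => //; apply: measurable_mul_indic => //.
  apply: measurable_powR_var => //; first by apply: measurable_funM.
  by move=> y; rewrite divr_gt0.
have g0 y : 0 <= F y `^ (p y / t) * \1_Q y * v y.
  by rewrite !mulr_ge0 ?powR_ge0 ?indic_ge0.
(* The quantity l^(-p(y)/t) (1 + a) is 1 + a raised to (p(x) - p(y)) / p(x), and the denominator is
   at least 1. *)
have osc y : B c rad y -> l `^ (- (p y / t)) <= Z / (1 + a).
  move=> yB; have px1 : 1 <= p x.
    by apply: le_trans (pQ _ (BQ _ xB)); nra.
  rewrite ler_pdivlMr// -[X in _ * X](powRr1 (ltW a10)).
  rewrite /l -powRrM -powRD; last by rewrite (gt_eqF a10) implybT.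
  rewrite /Z /powR gt_eqF// ler_expR; apply: le_trans (Hosc y yB).
  have -> : t / p x * - (p y / t) + 1 = (p x - p y) / p x.
    by field; rewrite !gt_eqF//; lra.
  have ln0 : 0 <= ln (1 + a) by rewrite ln_ge0// lerDl.
  rewrite ler_wpM2r// (le_trans (ler_norm _))// normrM ler_piMr//.
  by rewrite gtr0_norm ?invr_gt0 ?p0// invf_le1.
have := HC c rad rad0 G Z mG G0 Z0.
have : (wint mu (fun y => (G y `^ s * v y)%R) (B c rad) <= (Z * wm v c rad)%:E)%E.
  apply: (@le_trans _ _ (wint mu (fun y => (Z / (1 + a) *
      (F y `^ (p y / t) * \1_Q y * v y))%R) (B c rad))).
    apply: le_nint => y; first by rewrite !mulr_ge0 ?powR_ge0 ?indic_ge0.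
    rewrite [\1_(B c rad) y]indicE; case: (boolP (y \in B c rad)) => [|_].
      rewrite inE !mulr1 => yB; rewrite /G !indicE !mem_set ?mulr1; last exact: BQ.
      rewrite mulrA ler_wpM2r// -powRrM divfK ?gt_eqF// powRM ?invr_ge0 ?(ltW l0)//.
      rewrite mulrC ler_wpM2r ?powR_ge0//.
      by rewrite -powR_inv1 ?(ltW l0)// -powRrM mulN1r osc.
    by rewrite !mulr0.
  rewrite wintZ ?divr_ge0 ?(ltW Z0) ?(ltW a10)// Ha -EFinM lee_fin.
  rewrite mulrA ler_wpM2r ?(ltW wB0)// mulrAC -mulrA ler_piMr ?(ltW Z0)//.
  by rewrite ler_pdivrMr// mul1r lerDr.
move=> /[swap] /[apply] HG.
apply: (@le_trans _ _ (wint mu (fun y => (l * (1 + G y))%R) (B c rad))).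
  apply: le_nint => y; first by rewrite mulr_ge0 ?indic_ge0.
  rewrite indicE; case: (boolP (y \in B c rad)) => [|_]; last by rewrite !mulr0.
  rewrite inE !mulr1 => yB; rewrite mulrC -ler_pdivrMr//.
  rewrite /G indicE mem_set ?mulr1; last exact: BQ.
  apply: le_1Dpow => //; rewrite ler_pdivlMr// mul1r ler_pdivlMr//.
  exact/pQ/BQ.
rewrite wintZ//; last 3 first.
- exact: measurable_funD.
- by move=> y; rewrite addr_ge0.
- exact: ltW.
rewrite wintD// wint_cst// (ballmE hs)// mul1e.
apply: (@le_trans _ _ (l%:E * ((bm c rad)%:E + (C * Z `^ s^-1 * bm c rad)%:E))%E).
  by apply: lee_wpmul2l; rewrite ?lee_fin ?(ltW l0)// leeD2l.
rewrite -EFinD -EFinM lee_fin -/l.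
by rewrite le_eqVlt; apply/orP; left; apply/eqP; ring.
Qed.

(** About log2(1/r) doublings take B x r to a ball containing B x0 Rb, each at the cost of a factor
    [C]; hence the exponent n = log2 C. *)
Lemma wballm_lower v x0 Rb : doubling_weight d mu v -> 0 < Rb ->
  exists k n : R, [/\ 0 < k, 0 <= n & forall x r, d x0 x < Rb -> 0 < r -> r <= 1 ->
    k * r `^ n <= wm v x r].
Proof.
move=> dw R0; have c00 := hs_c0_gt0 hs; have c01 := hs_c0 hs.
have [C C1 HC] := dw_dbl dw 2.
have C0 : 0 < C by lra.
have l2 : 0 < ln 2 :> R by rewrite ln_gt0// ltr1n.
pose n := ln C / ln 2; have n0 : 0 <= n by apply: divr_ge0; [exact: ln_ge0|exact: ltW].
have w0 := wballm_gt0 x0 dw R0.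
pose M := 4 * c0 * Rb + 1.
have M0 : 0 < M by rewrite addr_gt0// !mulr_gt0.
exists (M `^ (- n) * wm v x0 Rb), n.
split=> //; first by rewrite mulr_gt0// powR_gt0.
move=> x r xR r0 r1.
have iter k : wm v x (2 ^+ k * r) <= C ^+ k * wm v x r.
  elim: k => [|k IH]; first by rewrite !expr0 !mul1r.
  rewrite exprS -mulrA exprS -mulrA.
  apply: (le_trans (HC _ _ _)); first by rewrite mulr_gt0// exprn_gt0.
  by rewrite ler_pM2l.
have [k [k1 k2]] : exists k : nat, 2 * c0 * Rb <= 2 ^+ k * r /\ 2 ^+ k * r <= M.
  have ex : exists k : nat, 2 * c0 * Rb <= 2 ^+ k * r.
    have [k Hk] := @expr_unbounded R (2 * c0 * Rb / r) 2 (ltr1n _ _).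
    by exists k; rewrite -ler_pdivrMr.
  case: (ex_minnP ex) => [[|k]] Hk mink; [exists 0%N|exists k.+1]; split=> //.
    by rewrite expr0 mul1r (le_trans r1)// lerDr !mulr_ge0// ltW.
  have : 2 ^+ k * r < 2 * c0 * Rb.
    by rewrite ltNge; apply/negP => /mink; rewrite ltnn.
  by rewrite exprS /M; lra.
have big : wm v x0 Rb <= wm v x (2 ^+ k * r).
  have kr0 : 0 < 2 ^+ k * r by rewrite mulr_gt0// exprn_gt0.
  rewrite -lee_fin -!(wballmE _ dw)//; apply: le_wint => //; first exact: dw_ge0 dw.
  apply: (qball_sub_ball hs); apply: le_trans k1.
  rewrite (hs_sym hs) [2 * c0]mulrC -mulrA ler_pM2l//; lra.
have := le_trans big (iter k) => H.
have Ck : C ^+ k = (2 ^+ k) `^ n.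
  rewrite -powR_mulrn ?(ltW C0)// -powR_mulrn// -powRrM /powR !gt_eqF//.
  by congr expR; rewrite /n -mulrA divfK// gt_eqF.
have Ckr : C ^+ k * r `^ n <= M `^ n.
  rewrite Ck -powRM ?exprn_ge0 ?(ltW r0)//; apply: ge0_ler_powR => //.
    by rewrite nnegrE mulr_ge0 ?exprn_ge0// ltW.
  by rewrite nnegrE ltW.
rewrite powRN -mulrA ler_pdivrMl ?powR_gt0//.
apply: (@le_trans _ _ (C ^+ k * wm v x r * r `^ n)).
  by rewrite ler_wpM2r ?powR_ge0.
by rewrite mulrAC ler_wpM2r// ltW// (wballm_gt0 _ dw).
Qed.

(** The hypothesis on [a] and the lower bound of [wballm_lower] give ln(1 + a) a growth of at most n
    ln(1 / rad), while the exponents at two points of the ball differ by at most a multiple of 1 /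
    ln(1 / rad). *)
Lemma log_oscillation (p : X -> R) v x0 (Rb A K0 : R) : 0 < A -> 0 < Rb -> 0 <= K0 ->
  doubling_weight d mu v ->
  (forall x y, 0 < d x y -> d x y <= 2^-1 -> `|p x - p y| <= A / ln (1 / d x y)) ->
  exists L dl : R, 0 < dl /\ forall c rad a x y, d x0 c < Rb ->
    0 < rad -> rad <= dl -> 0 <= a -> a * wm v c rad <= wm v c rad + K0 ->
    B c rad x -> B c rad y -> `|p x - p y| * ln (1 + a) <= L.
Proof.
move=> A0 R0 K00 dw logH; have c00 := hs_c0_gt0 hs; have c01 := hs_c0 hs.
have [k [n [k0 n0 Hk]]] := wballm_lower x0 dw R0.
pose K1 := 2 + K0 / k; have K11 : 1 <= K1.
  by rewrite /K1 ler_wpDr ?divr_ge0 ?(ltW k0)//; lra.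
have K10 : 0 < K1 by lra.
(* The bound exp(-1) makes ln(1 / rad) at least 1. The other one gives d(x, y)^2 <= rad, hence ln(1
   / d(x, y)) >= ln(1 / rad) / 2, and d(x, y) <= 1/2 as the log-condition requires. *)
pose dl := Num.min (expR (- 1)) ((4 * c0 ^+ 2)^-1).
have c20 : 0 < 4 * c0 ^+ 2 by rewrite mulr_gt0// exprn_gt0.
have dl0 : 0 < dl by rewrite lt_min expR_gt0 invr_gt0.
exists (2 * A * (ln K1 + n)), dl; split=> // c rad a x y cR rad0 radl a0 Ha xB yB.
have L0 : 0 <= ln K1 by rewrite ln_ge0.
have lna0 : 0 <= ln (1 + a) by rewrite ln_ge0// lerDl.
have [dxy0|dxy0] := eqVneq (d x y) 0.
  have -> : x = y by apply/(hs_eq0 hs).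
  by rewrite subrr normr0 mul0r !mulr_ge0 ?addr_ge0// ltW.
have {}dxy0 : 0 < d x y by rewrite lt_neqAle eq_sym dxy0 (hs_ge0 hs).
have dxyr : d x y <= 2 * c0 * rad.
  apply: (le_trans (hs_tri hs x y c)); rewrite [2 * c0]mulrC -mulrA ler_pM2l//.
  by move: xB yB; rewrite /qball /= [d x c](hs_sym hs); lra.
have rade : rad <= expR (-1) by rewrite (le_trans radl)// ge_min lexx.
have radc : 4 * c0 ^+ 2 * rad <= 1.
  by rewrite mulrC -ler_pdivlMr// mul1r (le_trans radl)// ge_min lexx orbT.
pose l := - ln rad.
have l1 : 1 <= l.
  rewrite /l lerNr -[leRHS](@expRK R) ler_ln ?posrE// ?expR_gt0//.
have radlt1 : rad < 1.
  by apply: (le_lt_trans rade); rewrite expR_lt1; lra.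
have dsq : d x y ^+ 2 <= rad.
  apply: (@le_trans _ _ ((2 * c0 * rad) ^+ 2)).
    by rewrite ler_pXn2r// nnegrE ?(hs_ge0 hs)// !mulr_ge0// ltW.
  rewrite (_ : _ ^+ 2 = 4 * c0 ^+ 2 * rad * rad); last by ring.
  by rewrite ler_piMl// ltW.
have dhalf : d x y <= 2^-1.
  apply: (le_trans dxyr); rewrite expr2 in radc.
  have : 2 * c0 * rad <= 2 * c0 * c0 * rad by rewrite ler_wpM2r ?(ltW rad0)//; nra.
  by lra.
have lnd : l / 2 <= ln (1 / d x y).
  rewrite div1r lnV ?posrE// /l.
  have : 2 * ln (d x y) <= ln rad.
    have := lnXn 2 dxy0; rewrite mulr_natl => <-.
    by rewrite ler_ln ?posrE ?exprn_gt0.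
  by lra.
have ln1a : ln (1 + a) <= ln K1 + n * l.
  have rn0 : 0 < rad `^ (- n) by exact: powR_gt0.
  have -> : ln K1 + n * l = ln (K1 * rad `^ (- n)).
    by rewrite lnM ?posrE// ln_powR mulNr mulrN.
  rewrite ler_ln ?posrE ?mulr_gt0//; last by rewrite ltr_wpDr.
  have rn1 : 1 <= rad `^ (- n).
    rewrite -[leLHS](powRr0 rad); apply: ger_powR; first by rewrite rad0 ltW.
    by rewrite oppr_le0.
  have wl := Hk _ _ cR rad0 (ltW radlt1).
  have kr0 : 0 < k * rad `^ n by rewrite mulr_gt0// powR_gt0.
  have w0 : 0 < wm v c rad by exact: lt_le_trans wl.
  have : a <= 1 + K0 / (k * rad `^ n).
    have H1 : a <= 1 + K0 / wm v c rad.
      by rewrite -(ler_pM2r w0) mulrDl mul1r divfK ?gt_eqF.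
    apply: (le_trans H1); rewrite lerD2l ler_wpM2l// lef_pV2// ?posrE.
  rewrite invfM -powRN mulrA /K1 mulrDl => H.
  have : a + 1 <= 2 * rad `^ (- n) + K0 / k * rad `^ (- n) by lra.
  by rewrite addrC.
have ld0 : 0 < l / 2 by rewrite divr_gt0//; lra.
apply: (@le_trans _ _ (A / (l / 2) * (ln K1 + n * l))).
  rewrite ler_pM//; apply: (le_trans (logH _ _ dxy0 dhalf)).
  by rewrite ler_pM2l// lef_pV2 ?posrE//; exact: lt_le_trans lnd.
rewrite [A / (l / 2)](_ : _ = 2 * A / l); last by field; rewrite gt_eqF//; lra.
rewrite -mulrA ler_wpM2l//; first by rewrite mulr_ge0// ltW.
rewrite mulrC ler_pdivrMr; last by lra.
nra.
Qed.

End variable_exponent.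

(** * Small balls in a bounded region *)

Section local_bound.
Context (R : realType) (disp : measure_display) (X : measurableType disp).
Variables (d : X -> X -> R) (mu : {measure set X -> \bar R}) (c0 : R).
Hypothesis hs : homogeneous d mu c0.
Local Notation B := (qball d).
Local Notation bm := (ballm d mu).
Local Notation wm := (wballm d mu).
Implicit Types (v g F rho : X -> R) (Q : set X) (x y z : X) (r s t : R).

Definition bavg F x r : R := fine (wint mu F (B x r)) / bm x r.

Lemma powRD_le (a t : R) : 0 <= a -> 0 <= t -> (1 + a) `^ t <= 2 `^ t * (1 + a `^ t).
Proof.
move=> a0 t0; have [a1|/ltW a1] := leP 1 a.
  apply: (@le_trans _ _ ((2 * a) `^ t)).
    by apply: ge0_ler_powR; rewrite ?nnegrE//; lra.
  by rewrite powRM// ler_wpM2l ?powR_ge0// lerDr.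
apply: (@le_trans _ _ (2 `^ t)).
  by apply: ge0_ler_powR; rewrite ?nnegrE//; lra.
by rewrite ler_peMr ?powR_ge0// lerDl powR_ge0.
Qed.

Lemma bavg_le F x r y s K C : 0 < r -> 0 < s -> 0 <= C -> (forall y, 0 <= F y) ->
  B x r `<=` B y s -> bm y s <= K * bm x r ->
  (wint mu F (B y s) <= (C * bm y s)%:E)%E ->
  (wint mu F (B x r) < +oo)%E /\ bavg F x r <= C * K.
Proof.
move=> r0 s0 C0 F0 sub bK H.
have H1 : (wint mu F (B x r) <= (C * bm y s)%:E)%E.
  by apply: le_trans H; exact: le_wint.
have fin : (wint mu F (B x r) < +oo)%E by apply: le_lt_trans H1 (ltry _).
split=> //; rewrite /bavg ler_pdivrMr ?(ballm_gt0 hs)//.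
apply: (@le_trans _ _ (C * bm y s)); last by rewrite -mulrA ler_wpM2l.
by rewrite -lee_fin fineK// ge0_fin_numE ?wint_ge0.
Qed.

Lemma bavg_ge0 F x r : (forall y, 0 <= F y) -> 0 < r -> 0 <= bavg F x r.
Proof.
move=> F0 r0; apply: divr_ge0; last exact/ltW/(ballm_gt0 hs).
exact/fine_ge0/wint_ge0.
Qed.

Lemma modular_weight (p rho v : X -> R) (N0 Q : set X) Cr F :
  measurable_fun setT p -> (forall x, 0 < p x) -> measurable_fun setT v ->
  (forall x, 0 <= v x) -> measurable Q -> measurable N0 -> mu N0 = 0%E ->
  0 < Cr -> (forall y, Q y -> ~ N0 y -> v y <= Cr * `|rho y| `^ p y) ->
  measurable_fun setT F -> (forall x, 0 <= F x) ->
  (nint mu (fun x => ((`|rho x| * F x) `^ p x)%R) <= 1)%E ->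
  (nint mu (fun x => (F x `^ p x * \1_Q x * v x)%R) <= Cr%:E)%E.
Proof.
move=> mp p0 mv v0 mQ mN N_0 Cr0 Hv mF F0 HF.
have mFp : measurable_fun setT (fun x => F x `^ p x * \1_Q x * v x).
  apply: measurable_funM => //; apply: measurable_mul_indic => //.
  exact: measurable_powR_var.
have Fp0 x : 0 <= F x `^ p x * \1_Q x * v x.
  by rewrite !mulr_ge0 ?powR_ge0 ?indic_ge0.
rewrite (nint_null mN N_0)//.
have -> : (Cr%:E = Cr%:E * 1)%E by rewrite mule1.
rewrite -lee_pdivrMl// -nintZ//; last 3 first.
- by apply: measurable_mul_indic => //; exact: measurableC.
- by move=> x; rewrite mulr_ge0 ?indic_ge0.
- by rewrite invr_ge0 ltW.
apply: le_trans HF; apply: le_nint => x.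
  by rewrite mulr_ge0 ?invr_ge0 ?(ltW Cr0)// mulr_ge0 ?indic_ge0.
rewrite ler_pdivrMl// powRM// !indicE.
have R0 : 0 <= Cr * (`|rho x| `^ p x * F x `^ p x).
  by rewrite !mulr_ge0 ?powR_ge0// ltW.
case: (boolP (x \in Q)) => [|_]; last by rewrite mulr0 !mul0r.
case: (boolP (x \in ~` N0)) => [|_]; last by rewrite mulr0.
rewrite !inE !mulr1 => xN xQ; rewrite mulrC [_ * F x `^ _]mulrC mulrA mulrAC.
by rewrite mulrC [leRHS]mulrC ler_wpM2l ?powR_ge0// Hv.
Qed.

Lemma pow_indic (a t : R) Q x : 0 < t -> 0 <= a ->
  (a * \1_Q x) `^ t = a `^ t * \1_Q x.
Proof.
move=> t0 a0; rewrite indicE; case: (x \in Q); rewrite ?mulr1//.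
by rewrite !mulr0 powR0 ?gt_eqF.
Qed.

(** With g = F^(p / t) on [Q], the modular of F bounds the integral of g^t v. The p(x)-th power of
    an average is at most a multiple of (1 + a)^t by [variable_averages], hence of 1 + a^t:
    multiplied by v, the first term is integrable over [Q] and the second is dominated by
    [maximal_strong]. *)
Theorem local_bound (p rho v : X -> R) (N0 Q S : set X) x0 (Rb A pp Cr dS s t : R) :
  1 < s -> 1 < t -> doubling_weight d mu v -> Acond d mu s v ->
  measurable_fun setT p -> (forall x, 0 < p x) -> (forall x, p x <= pp) ->
  measurable Q -> 0 < Rb -> Q `<=` B x0 Rb -> (forall y, Q y -> s * t <= p y) ->
  0 < A ->
  (forall x y, 0 < d x y -> d x y <= 2^-1 -> `|p x - p y| <= A / ln (1 / d x y)) ->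
  measurable N0 -> mu N0 = 0%E -> 0 < Cr ->
  (forall y, Q y -> ~ N0 y -> `|rho y| `^ p y <= Cr * v y) ->
  (forall y, Q y -> ~ N0 y -> v y <= Cr * `|rho y| `^ p y) ->
  0 < dS -> (forall x, S x -> B x dS `<=` Q) ->
  exists K dl : R, [/\ 0 < K, 0 < dl & forall F, measurable_fun setT F ->
    (forall x, 0 <= F x) ->
    (nint mu (fun x => ((`|rho x| * F x) `^ p x)%R) <= 1)%E ->
    exists Phi : X -> \bar R, [/\ measurable_fun setT Phi,
      forall x, (0 <= Phi x)%E, (\int[mu]_x Phi x <= K%:E)%E &
      forall x r, S x -> ~ N0 x -> 0 < r -> r <= dl ->
        (wint mu F (B x r) < +oo)%E /\
        (((`|rho x| * bavg F x r) `^ p x)%:E <= Phi x)%E]].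
Proof.
move=> s1 t1 dw Ac mp p0 ppx mQ Rb0 QB pQ A0 logH mN N_0 Cr0 Hr1 Hr2 dS0 SQ.
have c00 := hs_c0_gt0 hs; have c01 := hs_c0 hs; have mB := hs_meas hs.
have v0 := dw_ge0 dw; have mv := dw_meas dw.
have t0 : 0 < t by lra. have s0 : 0 < s by lra.
have [c [rad [rad0 fam]]] := ball_family hs x0.
have [C1 C10 HC1] := maximal_strong hs c rad0 dw t1.
have [L [dl0 [dl00 HL]]] := log_oscillation hs x0 A0 Rb0 (ltW Cr0) dw logH.
have [C2 C20 HC2] := @variable_averages _ _ _ d mu c0 hs p v s t Q L pp s1 t1 dw Ac mp p0 mQ pQ ppx.
have [Cb Cb1 HCb] := ballm_dbl hs (4 * c0 ^+ 2).
have c20 : 0 < 4 * c0 ^+ 2 by rewrite mulr_gt0// exprn_gt0.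
(* [fam] places B x r in a ball of the family of radius at most 3 c0 r, itself inside the ball about
   [x] of radius 4 c0^2 r. The two quotients keep it in [Q] and its radius below [dl0]. *)
pose dl := Num.min (dS / (4 * c0 ^+ 2)) (dl0 / (3 * c0)).
have c30 : 0 < 3 * c0 by rewrite mulr_gt0.
have dl_0 : 0 < dl by rewrite lt_min !divr_gt0.
pose C3 := 1 + C2 * Cb; have C31 : 1 <= C3.
  by rewrite lerDl mulr_ge0 ?(ltW C20)//; lra.
pose C4 := Cr * C3 `^ pp * 2 `^ t.
have C40 : 0 < C4 by rewrite !mulr_gt0 ?powR_gt0//; lra.
pose wQ := wm v x0 Rb; have wQ0 : 0 < wQ by rewrite (wballm_gt0 _ dw).
exists (C4 * wQ + C4 * (C1 * Cr)), dl; split=> //.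
  by apply: addr_gt0; apply: mulr_gt0 => //; exact: mulr_gt0.
move=> F mF F0 HF.
pose g y := F y `^ (p y / t) * \1_Q y.
have mg : measurable_fun setT g.
  apply: measurable_mul_indic => //; apply: measurable_powR_var => //.
    by apply: measurable_funM.
  by move=> y; rewrite divr_gt0.
have g0 y : 0 <= g y by rewrite mulr_ge0 ?powR_ge0 ?indic_ge0.
have gtE y : g y `^ t = F y `^ p y * \1_Q y.
  by rewrite /g pow_indic ?powR_ge0// -powRrM divfK// gt_eqF.
have Ig : (nint mu (fun x => (g x `^ t * v x)%R) <= Cr%:E)%E.
  rewrite (eq_nint _ (g := fun x => F x `^ p x * \1_Q x * v x)).
    exact: (@modular_weight p rho v N0 Q Cr F).
  by move=> x; rewrite gtE.
have Igfin := le_lt_trans Ig (ltry Cr).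
have [Phi0 [mPhi0 Phi00 HPhi0 IPhi0]] := HC1 g mg g0 Igfin.
pose vQ y := v y * \1_Q y.
have mvQ : measurable_fun setT vQ by exact: measurable_mul_indic.
have vQ0 y : 0 <= vQ y by rewrite mulr_ge0 ?indic_ge0.
exists (fun x => (C4 * vQ x)%:E + C4%:E * Phi0 x)%E; split.
- apply: emeasurable_funD; first exact/measurable_EFinP/measurable_funM.
  exact: measurable_funeM.
- move=> x; apply: adde_ge0; first by rewrite lee_fin mulr_ge0 ?(ltW C40).
  by apply: mule_ge0 => //; rewrite lee_fin ltW.
- rewrite ge0_integralD//; last 4 first.
  + by move=> x _; rewrite lee_fin mulr_ge0 ?(ltW C40).
  + exact/measurable_EFinP/measurable_funM.
  + by move=> x _; rewrite mule_ge0 ?lee_fin ?(ltW C40).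
  + exact: measurable_funeM.
  rewrite -/(nint mu (fun x => (C4 * vQ x)%R)) nintZ ?(ltW C40)//.
  rewrite ge0_integralZl_EFin ?(ltW C40)// EFinD; apply: leeD.
    rewrite (EFinM C4); apply: lee_wpmul2l; first by rewrite lee_fin ltW.
    by rewrite -(wballmE _ dw)//; exact: le_wint.
  rewrite (EFinM C4); apply: lee_wpmul2l; first by rewrite lee_fin ltW.
  apply: (le_trans IPhi0); rewrite (EFinM C1).
  by apply: lee_wpmul2l => //; rewrite lee_fin ltW.
move=> x r Sx Nx r0 rdl.
have [i [sub1 sub2 radi]] := fam x r r0.
have rS : 4 * c0 ^+ 2 * r <= dS.
  by rewrite mulrC -ler_pdivlMr// (le_trans rdl)// ge_min lexx.
have BiQ : B (c i) (rad i) `<=` Q.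
  apply: subset_trans (SQ x Sx); apply: subset_trans sub2 _.
  exact: qball_sub.
have xBi : B (c i) (rad i) x by apply: sub1; exact: qball_center hs _ _ r0.
have Qx := BiQ _ xBi.
have cR : d x0 (c i) < Rb.
  by apply: QB; apply: BiQ; exact: qball_center hs _ _ (rad0 i).
have raddl : rad i <= dl0.
  apply: (le_trans radi); rewrite mulrC -ler_pdivlMr//.
  by rewrite (le_trans rdl)// ge_min lexx orbT.
pose a := wavg d mu c rad v g i.
have gv0 y : 0 <= g y * v y by rewrite mulr_ge0.
have wB0 := wballm_gt0 (c i) dw (rad0 i).
have wgfin : (wint mu (fun y => (g y * v y)%R) (B (c i) (rad i)) < +oo)%E.
  apply: (wint_lty_of_pow dw (ltW t1)) => //.
  by case/andP: (dw_pos dw (c i) (rad0 i)).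
have aE : wint mu (fun y => (g y * v y)%R) (B (c i) (rad i)) =
    (a * wm v (c i) (rad i))%:E.
  rewrite /a /wavg divfK ?gt_eqF// fineK// ge0_fin_numE ?wint_ge0//.
have a0 : 0 <= a by rewrite divr_ge0 ?(ltW wB0)// fine_ge0// wint_ge0.
(* The crude bound asked by [log_oscillation]: g <= 1 + g^t, and the integral of g^t v is at most
   [Cr]. *)
have aw : a * wm v (c i) (rad i) <= wm v (c i) (rad i) + Cr.
  rewrite -lee_fin EFinD -aE -(wballmE _ dw)//.
  apply: (@le_trans _ _ (wint mu v (B (c i) (rad i)) +
      wint mu (fun y => (g y `^ t * v y)%R) (B (c i) (rad i)))%E).
    rewrite -wintD//; last 2 first.
    - by apply: measurable_funM => //; exact: measurable_fun_powR_cst.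
    - by move=> y; rewrite mulr_ge0 ?powR_ge0.
    apply: le_wint => // y.
    by rewrite -[X in X + _]mul1r -mulrDl ler_wpM2r// le_1Dpow// ltW.
  apply: leeD => //; apply: le_trans Ig; apply: wint_le_nint => y.
  by rewrite mulr_ge0 ?powR_ge0.
have Hosc y : B (c i) (rad i) y -> `|p x - p y| * ln (1 + a) <= L.
  by move=> yB; exact: HL cR (rad0 i) raddl a0 aw xBi yB.
have HF2 := HC2 F (c i) (rad i) a x mF F0 (rad0 i) BiQ xBi a0 aE Hosc.
have bK : bm (c i) (rad i) <= Cb * bm x r.
  apply: le_trans (HCb x r r0); apply: (ballm_le hs) => //.
  by rewrite mulr_gt0.
have la0 : 0 <= C2 * (1 + a) `^ (t / p x).
  by rewrite mulr_ge0 ?powR_ge0// ltW.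
have [fin avg] := bavg_le r0 (rad0 i) la0 F0 sub1 bK HF2.
split=> //.
have avg0 := bavg_ge0 x F0 r0.
apply: (@le_trans _ _ (C4 * (v x + v x * a `^ t))%:E); last first.
  rewrite mulrDr EFinD; apply: leeD.
    by rewrite /vQ indicE mem_set// mulr1.
  rewrite (EFinM C4); apply: lee_wpmul2l; first by rewrite lee_fin ltW.
  by rewrite mulrC; exact: HPhi0.
rewrite lee_fin powRM//.
have avgp : bavg F x r `^ p x <= C3 `^ pp * (1 + a) `^ t.
  apply: (@le_trans _ _ ((C3 * (1 + a) `^ (t / p x)) `^ p x)).
    apply: ge0_ler_powR; rewrite ?nnegrE ?(ltW (p0 x))//.
      by rewrite mulr_ge0 ?powR_ge0//; lra.
    apply: (le_trans avg); rewrite mulrAC ler_wpM2r ?powR_ge0//.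
    by rewrite /C3 lerDr.
  rewrite powRM ?powR_ge0//; last by lra.
  rewrite -powRrM divfK ?gt_eqF// ler_wpM2r ?powR_ge0//.
  exact: ler_powR.
apply: (@le_trans _ _ (Cr * v x * (C3 `^ pp * (2 `^ t * (1 + a `^ t))))).
  apply: ler_pM; rewrite ?powR_ge0//; first exact: Hr1.
  apply: (le_trans avgp); rewrite ler_wpM2l ?powR_ge0//.
  by apply: powRD_le => //; exact: ltW.
by rewrite le_eqVlt; apply/orP; left; apply/eqP; rewrite /C4; ring.
Qed.

End local_bound.

(** * Large balls and distant points *)

Section infinity_bound.
Context (R : realType) (disp : measure_display) (X : measurableType disp).
Variables (d : X -> X -> R) (mu : {measure set X -> \bar R}) (c0 : R).
Hypothesis hs : homogeneous d mu c0.
Local Notation B := (qball d).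
Local Notation bm := (ballm d mu).
Local Notation wm := (wballm d mu).
Local Notation bavg := (bavg d mu).
Implicit Types (v g F rho : X -> R) (Q : set X) (x y z : X) (r s t : R).

(** The value Z = 0 is reached as a limit: for each e > 0 the level [Y] makes the right-hand side of
    [Acond_scaled] equal to e. *)
Lemma Acond_scaled_ge0 s v : 0 < s -> doubling_weight d mu v -> Acond d mu s v ->
  exists2 C : R, 0 < C & forall x r, 0 < r ->
  forall g (Z : R), measurable_fun setT g -> (forall y, 0 <= g y) -> 0 <= Z ->
  (wint mu (fun y => (g y `^ s * v y)%R) (B x r) <= (Z * wm v x r)%:E)%E ->
  (wint mu g (B x r) <= (C * Z `^ s^-1 * bm x r)%:E)%E.
Proof.
move=> s0 dw Ac; have [C C0 HC] := Acond_scaled hs s0 dw Ac.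
exists C => // x r r0 g Z mg g0; rewrite le_eqVlt => /predU1P[<-|Z0]; last exact: HC.
move=> HZ; rewrite powR0 ?invr_eq0 ?gt_eqF// mulr0 mul0r.
apply/lee_addgt0Pr => e e0; rewrite add0e.
have b0 := ballm_gt0 hs x r0.
pose Y := (e / (C * bm x r)) `^ s.
have eb0 : 0 < e / (C * bm x r) by rewrite divr_gt0// mulr_gt0.
have Y0 : 0 < Y by rewrite powR_gt0.
apply: (le_trans (HC x r r0 g Y mg g0 Y0 _)).
  apply: (le_trans HZ); rewrite lee_fin mul0r mulr_ge0 ?(ltW Y0)//.
  by rewrite ltW// (wballm_gt0 _ dw).
rewrite lee_fin /Y -powRrM mulfV ?gt_eqF// powRr1 ?(ltW eb0)//.
by rewrite mulrAC mulrC divfK// gt_eqF// mulr_gt0.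
Qed.

(** With G = F^(p / s) on [Q], F is at most 1 + G there, and A_s bounds the integral of G through
    the modular of F. *)
Lemma wint_ball_bound (p rho v : X -> R) (N0 Q : set X) z (r Cr s : R) :
  1 < s -> doubling_weight d mu v -> Acond d mu s v ->
  measurable_fun setT p -> (forall x, 0 < p x) ->
  measurable Q -> 0 < r -> B z r `<=` Q -> (forall y, Q y -> s <= p y) ->
  measurable N0 -> mu N0 = 0%E -> 0 < Cr ->
  (forall y, Q y -> ~ N0 y -> v y <= Cr * `|rho y| `^ p y) ->
  exists K : R, forall F, measurable_fun setT F ->
    (forall x, 0 <= F x) ->
    (nint mu (fun x => ((`|rho x| * F x) `^ p x)%R) <= 1)%E ->
    (wint mu F (B z r) <= K%:E)%E.
Proof.
move=> s1 dw Ac mp p0 mQ r0 BQ pQ mN N_0 Cr0 Hv.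
have s0 : 0 < s by lra.
have v0 := dw_ge0 dw; have mv := dw_meas dw; have mB := hs_meas hs.
have [C C0 HC] := Acond_scaled_ge0 s0 dw Ac.
have w0 := wballm_gt0 z dw r0; have b0 := ballm_gt0 hs z r0.
pose Z := Cr / wm v z r; have Z0 : 0 <= Z by rewrite divr_ge0 ?ltW.
exists (bm z r + C * Z `^ s^-1 * bm z r) => F mF F0 HF.
pose G y := F y `^ (p y / s) * \1_Q y.
have mG : measurable_fun setT G.
  apply: measurable_mul_indic => //; apply: measurable_powR_var => //.
    by apply: measurable_funM.
  by move=> y; rewrite divr_gt0.
have G0 y : 0 <= G y by rewrite mulr_ge0 ?powR_ge0 ?indic_ge0.
have HG : (wint mu G (B z r) <= (C * Z `^ s^-1 * bm z r)%:E)%E.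
  apply: HC => //; rewrite /Z divfK ?gt_eqF//.
  apply: le_trans (@modular_weight _ _ _ mu p rho v N0 Q Cr F mp p0 mv v0
    mQ mN N_0 Cr0 Hv mF F0 HF).
  apply: (@le_trans _ _ (wint mu (fun x => (F x `^ p x * \1_Q x * v x)%R) (B z r))).
    apply: le_wint => // y; first by rewrite mulr_ge0 ?powR_ge0.
    by rewrite /G pow_indic ?powR_ge0// -powRrM divfK// gt_eqF.
  by apply: wint_le_nint => y; rewrite !mulr_ge0 ?powR_ge0 ?indic_ge0.
apply: (@le_trans _ _ (wint mu (fun y => (1 + G y)%R) (B z r))).
  apply: le_nint => y; first by rewrite mulr_ge0 ?indic_ge0.
  rewrite indicE; case: (boolP (y \in B z r)) => [|_]; last by rewrite !mulr0.
  rewrite inE !mulr1 => yB; rewrite /G indicE mem_set ?mulr1; last exact: BQ.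
  by apply: le_1Dpow => //; rewrite ler_pdivlMr// mul1r; exact/pQ/BQ.
rewrite wintD// wint_cst// (ballmE hs)// mul1e EFinD; exact: leeD.
Qed.

Lemma wint_flat_bound (p rho : X -> R) (N0 Q : set X) z (r Cr : R) :
  measurable_fun setT p -> (forall x, 1 <= p x) -> 0 < r ->
  measurable Q -> Q `<=` B z r -> measurable N0 -> mu N0 = 0%E -> 0 < Cr ->
  (forall y, Q y -> ~ N0 y -> 1 <= Cr * `|rho y| `^ p y) ->
  exists K : R, forall F, measurable_fun setT F ->
    (forall x, 0 <= F x) ->
    (nint mu (fun x => ((`|rho x| * F x) `^ p x)%R) <= 1)%E ->
    (wint mu F Q <= K%:E)%E.
Proof.
move=> mp p1 r0 mQ QB mN N_0 Cr0 Hv.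
have p0 x : 0 < p x by apply: lt_le_trans (p1 x).
exists (bm z r + Cr) => F mF F0 HF.
have mFp : measurable_fun setT (fun y => F y `^ p y) by exact: measurable_powR_var.
apply: (@le_trans _ _ (wint mu (fun y => (1 + F y `^ p y)%R) Q)).
  by apply: le_wint => // y; exact: le_1Dpow.
rewrite wintD//; last by move=> y; exact: powR_ge0.
rewrite wint_cst// mul1e EFinD; apply: leeD.
  by rewrite -(ballmE hs)//; apply: le_measure => //; rewrite inE//; exact: hs_meas hs _ _.
apply: le_trans (@modular_weight _ _ _ mu p rho (fun=> 1) N0 Q Cr F mp p0 _ _
  mQ mN N_0 Cr0 Hv mF F0 HF) => //.
by apply: le_nint => y; rewrite ?mulr_ge0 ?powR_ge0 ?indic_ge0// mulr1.
Qed.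

Variables (p rho v : X -> R) (x0 : X) (R1 pinf s Cr K0 : R).
Hypotheses (s1 : 1 < s) (sp : s < pinf) (R10 : 0 < R1) (Cr0 : 0 < Cr) (K00 : 0 <= K0).
Hypotheses (dw : doubling_weight d mu v) (Ac : Acond d mu s v).
Hypotheses (mp : measurable_fun setT p) (p0 : forall x, 0 < p x).
Hypothesis pfar : forall x, ~ B x0 R1 x -> p x = pinf.
Hypothesis Hr1 : forall x, ~ B x0 R1 x -> `|rho x| `^ pinf <= Cr * v x.
Hypothesis Hr2 : forall x, ~ B x0 R1 x -> v x <= Cr * `|rho x| `^ pinf.

Let G1 := B x0 R1.
Let mG1 : measurable G1. Proof. exact: hs_meas hs _ _. Qed.

Definition flat_inside F y : R := F y * \1_(~` G1) y + \1_G1 y.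
Local Notation ft := flat_inside.

(** Bounds the modular of [ft F]: [Cr] comes from outside [G1], the other term from the value 1
    inside. *)
Let K2 := Cr + wm v x0 R1.

Let s0 : 0 < s. Proof. exact: lt_trans s1. Qed.
Let pinf0 : 0 < pinf. Proof. exact: lt_trans sp. Qed.
Let w10 : 0 < wm v x0 R1. Proof. by rewrite (wballm_gt0 _ dw). Qed.
Let K20 : 0 < K2. Proof. by rewrite addr_gt0. Qed.
Let v0 := dw_ge0 dw.
Let mv := dw_meas dw.

Lemma measurable_flat_inside F : measurable_fun setT F -> measurable_fun setT (ft F).
Proof.
move=> mF; apply: measurable_funD; last exact: measurable_indic.
by apply: measurable_mul_indic => //; exact: measurableC.
Qed.

Lemma flat_inside_ge0 F : (forall x, 0 <= F x) -> forall x, 0 <= ft F x.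
Proof. by move=> F0 x; rewrite addr_ge0 ?mulr_ge0 ?indic_ge0. Qed.

Lemma flat_insideT F y : G1 y -> ft F y = 1.
Proof.
move=> Gy; rewrite /flat_inside !indicE (mem_set Gy) memNset ?mulr0 ?add0r//.
Qed.

Lemma flat_insideN F y : ~ G1 y -> ft F y = F y.
Proof.
move=> Gy; rewrite /flat_inside !indicE (memNset Gy) mem_set ?mulr1 ?addr0//.
Qed.

Lemma flat_inside_modular F : measurable_fun setT F -> (forall x, 0 <= F x) ->
  (nint mu (fun x => ((`|rho x| * F x) `^ p x)%R) <= 1)%E ->
  (nint mu (fun x => (ft F x `^ pinf * v x)%R) <= K2%:E)%E.
Proof.
move=> mF F0 HF.
pose q x := F x `^ p x * \1_(~` G1) x * v x.
have mG1C := measurableC mG1.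
have mFp : measurable_fun setT (fun y => F y `^ p y) by exact: measurable_powR_var.
have mq : measurable_fun setT q.
  by apply: measurable_funM => //; exact: measurable_mul_indic.
have q0 x : 0 <= q x by rewrite !mulr_ge0 ?powR_ge0 ?indic_ge0.
apply: (@le_trans _ _ (nint mu (fun x => (q x + v x * \1_G1 x)%R))).
  apply: le_nint => x; first by rewrite mulr_ge0 ?powR_ge0.
  rewrite /q !indicE; have [Gx|Gx] := pselect (G1 x).
    rewrite flat_insideT// powR1 mul1r (mem_set Gx) memNset ?mulr0 ?mul0r ?add0r ?mulr1//.
  by rewrite flat_insideN// (memNset Gx) mem_set// mulr1 mulr0 addr0 pfar.
rewrite nintD//; last 2 first.
- exact: measurable_mul_indic.
- by move=> x; rewrite mulr_ge0 ?indic_ge0.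
rewrite EFinD; apply: leeD; last by rewrite -(wballmE _ dw).
apply: (@modular_weight _ _ _ mu p rho v set0 (~` G1) Cr F) => //.
by move=> y Gy _; rewrite (pfar Gy) Hr2.
Qed.

(** If the ball meets [G1], its dilate contains all of [G1], over which [ft F] integrates to
    [bm x0 R1]; the multiple K0 / bm x0 R1 of that integral then pays for F on [G1]. *)
Lemma wint_flat_inside F x r K : measurable_fun setT F -> (forall x, 0 <= F x) ->
  (wint mu F G1 <= K0%:E)%E -> 1 <= K -> 0 < r ->
  (forall y, B x r y -> G1 y -> G1 `<=` B x (K * r)) ->
  (wint mu F (B x r) <= (1 + K0 / bm x0 R1)%:E * wint mu (ft F) (B x (K * r)))%E.
Proof.
move=> mF F0 HF K1 r0 meet; have b10 := ballm_gt0 hs x0 R10.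
have mB := hs_meas hs.
have sub : B x r `<=` B x (K * r) by apply: qball_sub; rewrite ler_peMl// ltW.
have ft0 := flat_inside_ge0 F0; have mft := measurable_flat_inside mF.
have [nomeet|] := pselect (forall y, B x r y -> ~ G1 y).
  apply: (@le_trans _ _ (wint mu (ft F) (B x (K * r)))).
    apply: le_nint => y; first by rewrite mulr_ge0 ?indic_ge0.
    have [By|By] := pselect (B x r y); last first.
      by rewrite indicE memNset// mulr0 mulr_ge0 ?indic_ge0.
    by rewrite flat_insideN ?ler_wpM2l ?indic_le//; exact: nomeet.
  rewrite -[leLHS]mul1e; apply: lee_wpmul2r; first exact: wint_ge0.
  by rewrite lee_fin lerDl divr_ge0// ltW.
move=> /existsNP[y /not_implyP[yB /contrapT yG]].
have GB := meet y yB yG.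
rewrite EFinD ge0_muleDl ?lee_fin ?divr_ge0 ?(ltW b10)// mul1e.
apply: (@le_trans _ _ (wint mu (ft F) (B x (K * r)) + wint mu F G1)%E).
  rewrite /wint -nintD; last 4 first.
  - exact: measurable_mul_indic.
  - exact: measurable_mul_indic.
  - by move=> z; rewrite mulr_ge0 ?indic_ge0.
  - by move=> z; rewrite mulr_ge0 ?indic_ge0.
  apply: le_nint => z; first by rewrite mulr_ge0 ?indic_ge0.
  have [Gz|Gz] := pselect (G1 z).
    rewrite [\1_G1 z]indicE mem_set// mulr1 ler_wpDl ?mulr_ge0 ?indic_ge0//.
    by rewrite ler_piMr ?indic_le1.
  by rewrite flat_insideN// ler_wpDr ?mulr_ge0 ?indic_ge0// ler_wpM2l ?indic_le.
apply: leeD => //; apply: (le_trans HF).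
apply: (@le_trans _ _ ((K0 / bm x0 R1)%:E * mu G1)%E).
  by rewrite /G1 (ballmE hs)// -EFinM divfK ?gt_eqF.
apply: lee_wpmul2l; first by rewrite lee_fin divr_ge0// ltW.
rewrite -nint_indic//; apply: le_nint => z; first exact: indic_ge0.
rewrite indicE; case: (boolP (z \in G1)) => [|_]; last by rewrite mulr_ge0 ?indic_ge0.
by rewrite inE => Gz; rewrite flat_insideT// mul1r indicE mem_set//; exact: GB.
Qed.

(** The dilation factor [K] is such that B x (K r) contains [G1] as soon as r >= dl, so its
    v-measure is bounded below. The v-average of the s-th power of [ft F] is then at most [Z], and
    A_s turns this into a bound on the average of F. *)
Lemma large_ball_bound R2 dl : 0 < R2 -> 0 < dl ->
  exists C : R, 0 <= C /\ forall F, measurable_fun setT F -> (forall x, 0 <= F x) ->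
  (wint mu F G1 <= K0%:E)%E ->
  (nint mu (fun x => ((`|rho x| * F x) `^ p x)%R) <= 1)%E ->
  forall x r, d x0 x < R2 -> dl <= r ->
    (wint mu F (B x r) < +oo)%E /\ bavg F x r <= C.
Proof.
move=> R20 dl0; have R1_0 := R10; have c00 := hs_c0_gt0 hs; have c01 := hs_c0 hs.
have mB := hs_meas hs.
have [C C0 HC] := Acond_scaled_ge0 s0 dw Ac.
pose K := 1 + c0 * (R2 + R1) / dl.
have K1 : 1 <= K by rewrite lerDl divr_ge0 ?(ltW dl0)// mulr_ge0 ?(ltW c00)//; lra.
have [Cb Cb1 HCb] := ballm_dbl hs K.
pose Z := 1 + K2 / wm v x0 R1.
have Z0 : 0 <= Z by rewrite addr_ge0// divr_ge0 ?ltW.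
pose K3 := 1 + K0 / bm x0 R1; have b10 := ballm_gt0 hs x0 R10.
have K30 : 0 <= K3 by rewrite addr_ge0// divr_ge0// ltW.
have CZ0 : 0 <= C * Z `^ s^-1 by rewrite mulr_ge0 ?powR_ge0// ltW.
exists (K3 * (C * Z `^ s^-1) * Cb); split.
  by rewrite mulr_ge0 ?(le_trans _ Cb1)// mulr_ge0.
move=> F mF F0 HG HF x r xR dlr.
have r0 : 0 < r by exact: lt_le_trans dlr.
have Kr0 : 0 < K * r by rewrite mulr_gt0//; lra.
have ft0 := flat_inside_ge0 F0; have mft := measurable_flat_inside mF.
have GB : G1 `<=` B x (K * r).
  apply: (qball_sub_ball hs); rewrite (hs_sym hs).
  apply: (@le_trans _ _ (c0 * (R2 + R1))).
    by rewrite ler_pM2l//; lra.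
  rewrite mulrDl mul1r ler_wpDl ?(ltW r0)// mulrAC ler_pdivlMr//.
  by rewrite ler_wpM2l// mulr_ge0 ?(ltW c00)//; lra.
have H1 : (wint mu (ft F) (B x (K * r)) <= (C * Z `^ s^-1 * bm x (K * r))%:E)%E.
  apply: HC => //.
  have wK0 := wballm_gt0 x dw Kr0.
  have wK : wm v x0 R1 <= wm v x (K * r).
    by rewrite -lee_fin -!(wballmE _ dw)//; exact: le_wint.
  apply: (@le_trans _ _ (wint mu v (B x (K * r)) +
     nint mu (fun y => (ft F y `^ pinf * v y)%R))%E).
    apply: (@le_trans _ _ (wint mu (fun y => (v y + ft F y `^ pinf * v y)%R) (B x (K * r)))).
      apply: le_wint => // y; first by rewrite mulr_ge0 ?powR_ge0.
      rewrite -[X in X + _]mul1r -mulrDl ler_wpM2r//.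
      have -> : ft F y `^ pinf = (ft F y `^ s) `^ (pinf / s).
        by rewrite -powRrM mulrC divfK// gt_eqF.
      by apply: le_1Dpow; rewrite ?powR_ge0// ler_pdivlMr// mul1r ltW.
    rewrite wintD//; last 2 first.
    - by apply: measurable_funM => //; exact: measurable_fun_powR_cst.
    - by move=> y; rewrite mulr_ge0 ?powR_ge0.
    apply: leeD => //; apply: wint_le_nint => y.
    by rewrite mulr_ge0 ?powR_ge0.
  apply: (@le_trans _ _ ((wm v x (K * r))%:E + K2%:E)%E).
    by apply: leeD; [rewrite (wballmE _ dw)|exact: flat_inside_modular].
  have -> : Z * wm v x (K * r) =
      wm v x (K * r) + K2 / wm v x0 R1 * wm v x (K * r) by rewrite /Z; ring.
  rewrite (EFinD (wm v x (K * r))); apply: leeD => //; rewrite lee_fin mulrAC ler_pdivlMr//.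
  by rewrite ler_pM2l.
have bK : bm x (K * r) <= Cb * bm x r by exact: HCb.
have H2 : (wint mu F (B x r) <= (K3 * (C * Z `^ s^-1) * bm x (K * r))%:E)%E.
  apply: (le_trans (wint_flat_inside mF F0 HG K1 r0 _)); first by [].
  rewrite -mulrA (EFinM K3); apply: lee_wpmul2l => //.
have bb := ballm_gt0 hs x r0.
have fin : (wint mu F (B x r) < +oo)%E by apply: le_lt_trans H2 (ltry _).
split => //; rewrite /bavg ler_pdivrMr//.
rewrite -lee_fin fineK ?ge0_fin_numE ?wint_ge0//; apply: (le_trans H2).
by rewrite lee_fin -[leRHS]mulrA ler_wpM2l// mulr_ge0.
Qed.

(** The exponent being constant at [x], A_s alone bounds the average of F by a multiple of a^(1/s),
    where a is the v-average of g = (ft F)^s; its power [pinf] is a^t with t = pinf / s, which the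
    maximal operator of v controls. *)
Lemma far_bound : exists K : R, 0 < K /\ forall F, measurable_fun setT F ->
  (forall x, 0 <= F x) -> (wint mu F G1 <= K0%:E)%E ->
  (nint mu (fun x => ((`|rho x| * F x) `^ p x)%R) <= 1)%E ->
  exists Phi : X -> \bar R, [/\ measurable_fun setT Phi,
    forall x, (0 <= Phi x)%E, (\int[mu]_x Phi x <= K%:E)%E &
    forall x r, 2 * c0 * R1 <= d x0 x -> 0 < r ->
      (wint mu F (B x r) < +oo)%E /\
      (((`|rho x| * bavg F x r) `^ p x)%:E <= Phi x)%E].
Proof.
have R1_0 := R10; have c00 := hs_c0_gt0 hs; have c01 := hs_c0 hs.
have mB := hs_meas hs; have s_1 := s1.
pose t := pinf / s; have t1 : 1 < t by rewrite ltr_pdivlMr// mul1r.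
have [c [rad [rad0 fam]]] := ball_family hs x0.
have [C1 C10 HC1] := maximal_strong hs c rad0 dw t1.
have [C C0 HC] := Acond_scaled_ge0 s0 dw Ac.
pose K := c0 * (2 * c0 + 1).
have K1 : 1 <= K by rewrite /K mulr_ege1//; lra.
have [Cb Cb1 HCb] := ballm_dbl hs (4 * c0 ^+ 2 * K).
pose K3 := 1 + K0 / bm x0 R1; have b10 := ballm_gt0 hs x0 R10.
have K30 : 0 < K3 by rewrite ltr_pwDl// divr_ge0// ltW.
pose C4 := K3 * C * Cb; have C40 : 0 < C4 by rewrite !mulr_gt0//; lra.
pose C5 := Cr * C4 `^ pinf; have C50 : 0 < C5 by rewrite mulr_gt0// powR_gt0.
exists (C5 * (C1 * K2)); split; first by apply: mulr_gt0 => //; exact: mulr_gt0.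
move=> F mF F0 HG HF.
have ft0 := flat_inside_ge0 F0; have mft := measurable_flat_inside mF.
pose g y := ft F y `^ s.
have mg : measurable_fun setT g by exact: measurable_fun_powR_cst.
have g0 y : 0 <= g y by exact: powR_ge0.
have Ig : (nint mu (fun x => (g x `^ t * v x)%R) <= K2%:E)%E.
  rewrite (eq_nint _ (g := fun x => ft F x `^ pinf * v x)).
    exact: flat_inside_modular.
  have st : s * t = pinf by rewrite /t mulrC divfK// gt_eqF.
  by move=> x; rewrite /g -powRrM st.
have Igfin := le_lt_trans Ig (ltry K2).
have [Phi0 [mPhi0 Phi00 HPhi0 IPhi0]] := HC1 g mg g0 Igfin.
exists (fun x => C5%:E * Phi0 x)%E; split.
- exact: measurable_funeM.
- by move=> x; apply: mule_ge0 => //; rewrite lee_fin ltW.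
- rewrite ge0_integralZl_EFin ?(ltW C50)// (EFinM C5).
  apply: lee_wpmul2l; first by rewrite lee_fin ltW.
  apply: (le_trans IPhi0); rewrite (EFinM C1).
  by apply: lee_wpmul2l => //; rewrite lee_fin ltW.
move=> x r xfar r0.
have xG : ~ G1 x.
  rewrite /G1 /qball /= => xR; have : 2 * c0 * R1 < R1 by exact: le_lt_trans xR.
  by nra.
have Kr0 : 0 < K * r by rewrite mulr_gt0//; lra.
(* As [x] is at distance at least 2 c0 R1 from x0, a ball about it that reaches [G1] has radius at
   least R1, and its dilate by K = c0 (2 c0 + 1) covers [G1]. *)
have meet y : B x r y -> G1 y -> G1 `<=` B x (K * r).
  rewrite /G1 /qball /= => yr yG.
  apply: (qball_sub_ball hs); rewrite [d x x0](hs_sym hs) /K -mulrA ler_pM2l//.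
  have := hs_tri hs x0 x y; rewrite [d y x](hs_sym hs) => H.
  have rR : R1 <= r.
    have : c0 * (2 * R1) <= c0 * (d x0 y + d x y).
      by apply: le_trans H; rewrite mulrA [c0 * 2]mulrC.
    by rewrite ler_pM2l//; lra.
  have : c0 * (d x0 y + d x y) <= c0 * (2 * r) by rewrite ler_pM2l//; lra.
  by lra.
have H1 := wint_flat_inside mF F0 HG K1 r0 meet.
have [i [sub1 sub2 radi]] := fam x (K * r) Kr0.
have xBi : B (c i) (rad i) x by apply: sub1; exact: qball_center hs _ _ Kr0.
pose a := wavg d mu c rad v g i.
have gv0 y : 0 <= g y * v y by rewrite mulr_ge0.
have wB0 := wballm_gt0 (c i) dw (rad0 i).
have wgfin : (wint mu (fun y => (g y * v y)%R) (B (c i) (rad i)) < +oo)%E.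
  apply: (wint_lty_of_pow dw (ltW t1)) => //.
  by case/andP: (dw_pos dw (c i) (rad0 i)).
have aE : wint mu (fun y => (g y * v y)%R) (B (c i) (rad i)) =
    (a * wm v (c i) (rad i))%:E.
  rewrite /a /wavg divfK ?gt_eqF// fineK// ge0_fin_numE ?wint_ge0//.
have a0 : 0 <= a by rewrite divr_ge0 ?(ltW wB0)// fine_ge0// wint_ge0.
have H2 : (wint mu (ft F) (B (c i) (rad i)) <= (C * a `^ s^-1 * bm (c i) (rad i))%:E)%E.
  by apply: HC => //; rewrite -aE.
have bK : bm (c i) (rad i) <= Cb * bm x r.
  apply: le_trans (HCb x r r0); apply: (ballm_le hs) => //.
    by rewrite mulr_gt0// mulr_gt0 ?mulr_gt0 ?exprn_gt0//; lra.
  by rewrite -(mulrA _ K r).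
have Ca0 : 0 <= C * a `^ s^-1 by rewrite mulr_ge0 ?powR_ge0// ltW.
have H3 : (wint mu F (B x r) <= (K3 * (C * a `^ s^-1) * (Cb * bm x r))%:E)%E.
  apply: (le_trans H1); rewrite -[X in (_ <= X%:E)%E]mulrA (EFinM K3).
  apply: lee_wpmul2l; first by rewrite lee_fin ltW.
  apply: (@le_trans _ _ (wint mu (ft F) (B (c i) (rad i)))); first exact: le_wint.
  by apply: (le_trans H2); rewrite lee_fin ler_wpM2l.
have bb := ballm_gt0 hs x r0.
have fin : (wint mu F (B x r) < +oo)%E by apply: le_lt_trans H3 (ltry _).
split => //.
have avg : bavg F x r <= C4 * a `^ s^-1.
  rewrite /bavg ler_pdivrMr//.
  rewrite -lee_fin fineK ?ge0_fin_numE ?wint_ge0//; apply: (le_trans H3).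
  by rewrite lee_fin le_eqVlt; apply/orP; left; apply/eqP; rewrite /C4; ring.
have avg0 := bavg_ge0 hs x F0 r0.
apply: (@le_trans _ _ (C5 * (a `^ t * v x))%:E); last first.
  rewrite (EFinM C5); apply: lee_wpmul2l; first by rewrite lee_fin ltW.
  exact: HPhi0.
rewrite lee_fin powRM// pfar//.
have avgp : bavg F x r `^ pinf <= C4 `^ pinf * a `^ t.
  apply: (@le_trans _ _ ((C4 * a `^ s^-1) `^ pinf)).
    apply: ge0_ler_powR; rewrite ?nnegrE ?(ltW pinf0)//.
    by rewrite mulr_ge0 ?powR_ge0// ltW.
  by rewrite powRM ?powR_ge0 ?(ltW C40)// -powRrM [_^-1 * _]mulrC.
apply: (@le_trans _ _ (Cr * v x * (C4 `^ pinf * a `^ t))).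
  by apply: ler_pM; rewrite ?powR_ge0//; exact: Hr1.
by rewrite le_eqVlt; apply/orP; left; apply/eqP; rewrite /C5; ring.
Qed.

End infinity_bound.

(** * The radial weight *)

Section weights.
Context (R : realType).
Implicit Types (t a b h s r q : R) (u w : R -> R).

(** The lemmas on radial weights ask for positivity on the whole line, while a weight is controlled
    on ]0, +oo[ only. *)
Definition posext w t : R := if 0 < t then w t else 1.

Lemma posextE w t : 0 < t -> posext w t = w t.
Proof. by rewrite /posext => ->. Qed.

Lemma posext_gt0 w : (forall t, 0 < t -> 0 < w t) -> forall t, 0 < posext w t.
Proof. by move=> w0 t; rewrite /posext; case: ifP => // /w0. Qed.

Lemma measurable_posext w : {in `]0, +oo[, continuous w} ->
  measurable_fun setT (posext w).
Proof.
move=> cw; rewrite (_ : posext w = fun t => (w \_ `]0, +oo[) t + \1_(~` `]0, +oo[) t).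
  have m0 : measurable (`]0, +oo[ : set R) by [].
  apply: measurable_funD; last by apply: measurable_indic; exact: measurableC.
  apply/(measurable_restrictT _ m0).
  apply: open_continuous_measurable_fun; first exact: interval_open.
  by move=> t; rewrite inE /= => t0; apply: cw.
apply/funext => t; rewrite /posext /patch indicE.
have -> : (t \in ~` `]0, +oo[) = ~~ (0 < t).
  by rewrite in_setC mem_setE in_itv /= andbT.
rewrite mem_setE in_itv /= andbT; case: (0 < t) => /=; first by rewrite addr0.
by rewrite add0r.
Qed.

Lemma power_bounds_sub (D D' : set R) a b C u : D' `<=` D ->
  power_bounds D a b C u -> power_bounds D' a b C u.
Proof. by move=> sub ub t r /sub Dt /sub Dr; exact: ub. Qed.

Lemma power_bounds_ext (D : set R) a b C u u' : (forall t, D t -> u t = u' t) ->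
  power_bounds D a b C u -> power_bounds D a b C u'.
Proof. by move=> uu ub t r Dt Dr tr; rewrite -!uu//; exact: ub. Qed.

Lemma power_bounds_pow (D : set R) a b C u q : (forall t, D t -> 0 < t) ->
  (forall t, D t -> 0 < u t) -> 0 < C -> 0 < q ->
  power_bounds D a b C u ->
  power_bounds D (a * q) (b * q) (C `^ q) (fun t => u t `^ q).
Proof.
move=> Dpos u0 C0 q0 ub t r Dt Dr tr.
have [H1 H2] := ub t r Dt Dr tr.
have t0 := Dpos _ Dt; have r0 := Dpos _ Dr.
have mono (x y k e : R) : 0 < x -> 0 < y -> x <= C * (r / t) `^ e * y ->
    x `^ q <= C `^ q * (r / t) `^ (e * q) * y `^ q.
  move=> x0 y0 xy; rewrite powRrM -!powRM ?mulr_ge0 ?powR_ge0 ?(ltW C0) ?(ltW y0)//.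
  apply: ge0_ler_powR; rewrite ?nnegrE ?(ltW x0) ?(ltW q0)//.
  by rewrite !mulr_ge0 ?powR_ge0 ?(ltW C0) ?(ltW y0).
split; last by apply: mono => //; exact: u0.
by rewrite -mulNr; apply: mono => //; exact: u0.
Qed.

Lemma power_bounds_mul (D : set R) a b C u a' b' C' u' : (forall t, D t -> 0 < t) ->
  (forall t, D t -> 0 < u t) -> (forall t, D t -> 0 < u' t) ->
  power_bounds D a b C u -> power_bounds D a' b' C' u' ->
  power_bounds D (a + a') (b + b') (C * C') (fun t => u t * u' t).
Proof.
move=> Dpos u0 u'0 ub ub' t r Dt Dr tr.
have [H1 H2] := ub t r Dt Dr tr; have [H1' H2'] := ub' t r Dt Dr tr.
have rt0 : 0 < r / t by rewrite divr_gt0 ?Dpos.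
have ad e e' : (r / t) `^ (e + e') = (r / t) `^ e * (r / t) `^ e'.
  by rewrite powRD// (gt_eqF rt0) implybT.
rewrite opprD !ad; split.
  apply: le_trans (ler_pM (ltW (u0 _ Dt)) (ltW (u'0 _ Dt)) H1 H1') _.
  by rewrite le_eqVlt; apply/orP; left; apply/eqP; ring.
apply: le_trans (ler_pM (ltW (u0 _ Dr)) (ltW (u'0 _ Dr)) H2 H2') _.
by rewrite le_eqVlt; apply/orP; left; apply/eqP; ring.
Qed.

Lemma power_bounds_prod (D : set R) (I : Type) (s : seq I) (a b : I -> R)
    (u : I -> R -> R) : (forall t, D t -> 0 < t) ->
  (forall i t, D t -> 0 < u i t) ->
  (forall i, exists2 C, 0 < C & power_bounds D (a i) (b i) C (u i)) ->
  exists2 C, 0 < C & power_bounds D (\sum_(i <- s) a i) (\sum_(i <- s) b i) C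
    (fun t => \prod_(i <- s) u i t).
Proof.
move=> Dpos u0 ub; elim: s => [|i s [C C0 IH]].
  exists 1 => // t r Dt Dr tr; rewrite !big_nil oppr0.
  by rewrite powRr0 !mul1r.
have [C' C'0 ubi] := ub i; exists (C' * C); first exact: mulr_gt0.
have P0 t : D t -> 0 < \prod_(j <- s) u j t.
  by move=> Dt; apply: prodr_gt0 => j _; exact: u0.
have := power_bounds_mul Dpos (u0 i) P0 ubi IH; rewrite !big_cons.
by apply: power_bounds_ext => t Dt; rewrite big_cons.
Qed.

(** Almost monotonicity up to a power gives both bounds: on either side of 1, [w t] is compared with
    the values at [l], 1 and [T], all within a ratio [K]. *)
Lemma weight_compact w lo hi : Wtilde w -> 0 < lo -> 0 < hi ->
  exists2 C, 1 <= C & forall t, lo <= t -> t <= hi -> C^-1 <= w t /\ w t <= C.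
Proof.
move=> Ww lo0 hi0; have [_ w0 _ _] := Ww.
pose T := Num.max 1 hi; pose l := Num.min 1 lo.
have l0 : 0 < l by rewrite lt_min lo0 ltr01.
have T1 : 1 <= T by rewrite le_max lexx.
pose K := 1 + T / l; have K1 : 1 < K by rewrite ltrDl divr_gt0//; lra.
have Kl x y : l <= x -> y <= T -> y <= K * x.
  move=> lx yT; apply: (le_trans yT); apply: (@le_trans _ _ (K * l)).
    by rewrite mulrDl mul1r divfK ?gt_eqF// lerDr ltW.
  by rewrite ler_pM2l//; lra.
have [C1 C11 H1] := weight_mono01 Ww K1.
have [C2 C21 H2] := weight_mono1oo Ww K1.
have l1 : l <= 1 by rewrite ge_min lexx.
have wl := w0 _ l0; have w1 := w0 _ (ltr01 : 0 < 1); have wT := w0 T (lt_le_trans ltr01 T1).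
pose Cu := C1 * w 1 + C2 * w T; pose Cl := C1 / w l + C2 / w 1.
have Cu0 : 0 < Cu by rewrite addr_gt0// mulr_gt0//; lra.
have Cl0 : 0 < Cl by rewrite addr_gt0// divr_gt0//; lra.
exists (1 + Cu + Cl); first by rewrite -addrA lerDl addr_ge0// ltW.
move=> t lot thi; have lt : l <= t by rewrite (le_trans _ lot)// ge_min lexx orbT.
have tT : t <= T by rewrite (le_trans thi)// le_max lexx orbT.
have t0 : 0 < t by exact: lt_le_trans lo0 lot.
have wt := w0 _ t0.
have [up low] : w t <= Cu /\ (w t)^-1 <= Cl.
  have [t1|/ltW t1] := leP t 1.
    split.
      apply: le_trans (H1 t 1 t0 (lexx _) t1 (Kl _ _ lt T1)) _.
      by rewrite lerDl mulr_ge0 ?(ltW wT)//; lra.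
    have := H1 l t l0 t1 lt (Kl _ _ (lexx _) tT) => H.
    apply: (@le_trans _ _ (C1 / w l)); last by rewrite lerDl divr_ge0 ?(ltW w1)//; lra.
    by rewrite ler_pdivlMr// mulrC ler_pdivrMr.
  split.
    apply: le_trans (H2 t T t1 tT (Kl _ _ lt (lexx _))) _.
    by rewrite lerDr mulr_ge0 ?(ltW w1)//; lra.
  have := H2 1 t (lexx _) t1 (Kl _ _ l1 tT) => H.
  apply: (@le_trans _ _ (C2 / w 1)); last by rewrite lerDr divr_ge0 ?(ltW wl)//; lra.
  by rewrite ler_pdivlMr// mulrC ler_pdivrMr.
split; last by lra.
by rewrite invf_ple ?posrE//; lra.
Qed.

(** In the product with |p(y) - p(x_k)| <= A / ln(1/d) the logarithms cancel, so w_k raised to that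
    difference stays bounded. The bound h0 <= 1/2 keeps ln(1/t) above ln 2, which absorbs the
    additive constants. *)
Lemma power_bounds_ln h0 a b C w : 0 < h0 -> h0 <= 2^-1 -> 0 < C ->
  (forall t, 0 < t -> 0 < w t) -> power_bounds [set t | 0 < t <= h0] a b C w ->
  exists2 L, 0 < L & forall t, 0 < t -> t <= h0 -> `|ln (w t)| <= L * ln (1 / t).
Proof.
move=> h00 hh C0 w0 ub; have wh := w0 _ h00.
have l2 : 0 < ln 2 :> R by rewrite ln_gt0// ltr1n.
pose M := `|ln C| + `|ln (w h0)|.
have M0 : 0 <= M by rewrite addr_ge0.
have ME : `|ln C| + `|ln (w h0)| <= M by [].
clearbody M; exists (M / ln 2 + `|a| + `|b| + 1).
  by rewrite ltr_wpDl// !addr_ge0// divr_ge0// ltW.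
move=> t t0 th; have wt := w0 _ t0.
have [H1 H2] := ub t h0 (introT andP (conj t0 th)) (introT andP (conj h00 (lexx _))) th.
have ht0 : 0 < h0 / t by rewrite divr_gt0.
have lt2 : ln 2 <= ln (1 / t).
  by rewrite ler_ln ?posrE ?divr_gt0// ler_pdivlMr//; lra.
have lh : 0 <= ln (h0 / t) /\ ln (h0 / t) <= ln (1 / t).
  split; first by rewrite ln_ge0// ler_pdivlMr// mul1r.
  by rewrite ler_ln ?posrE ?divr_gt0// ler_pM2r ?invr_gt0//; lra.
have ln3 x y z : 0 < x -> 0 < y -> 0 < z -> ln (x * y * z) = ln x + ln y + ln z.
  by move=> x0 y0 z0; rewrite lnM ?posrE ?mulr_gt0// lnM ?posrE.
have le1 : ln (w t) <= ln C - a * ln (h0 / t) + ln (w h0).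
  rewrite -mulNr -ln_powR -ln3 ?powR_gt0// ler_ln ?posrE//.
  by rewrite !mulr_gt0 ?powR_gt0.
have le2 : ln (w h0) <= ln C + b * ln (h0 / t) + ln (w t).
  rewrite -ln_powR -ln3 ?powR_gt0// ler_ln ?posrE//.
  by rewrite !mulr_gt0 ?powR_gt0.
move: (ln (h0 / t)) (ln (1 / t)) lh lt2 le1 le2 => x y [x0 xy] y2 le1 le2.
have My : M <= M / ln 2 * y by rewrite mulrAC ler_pdivlMr// ler_wpM2l.
have y0 : 0 <= y by lra.
have ax : `|a * x| <= `|a| * y by rewrite normrM (ger0_norm x0) ler_wpM2l.
have bx : `|b * x| <= `|b| * y by rewrite normrM (ger0_norm x0) ler_wpM2l.
rewrite !mulrDl mul1r ler_norml.
have := ler_norm (a * x); have := ler_norm (b * x).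
have := ler_norm (- (a * x)); rewrite normrN; have := ler_norm (- (b * x)); rewrite normrN.
have := ler_norm (ln C); have := ler_norm (- ln C); rewrite normrN.
have := ler_norm (ln (w h0)); have := ler_norm (- ln (w h0)); rewrite normrN.
have ay0 : 0 <= `|a| * y by rewrite mulr_ge0.
have by0 : 0 <= `|b| * y by rewrite mulr_ge0.
move: My ME ax bx ay0 by0 le1 le2; set p1 := `|a| * y; set p2 := `|b| * y.
set p3 := a * x; set p4 := b * x; set p5 := M / ln 2 * y => *.
by apply/andP; split; lra.
Qed.

Lemma finite_lower (I : finType) (P : I -> R -> Prop) :
  (forall i e e', P i e -> 0 < e' -> e' <= e -> P i e') ->
  (forall i, exists2 e, 0 < e & P i e) -> exists2 e, 0 < e & forall i, P i e.
Proof.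
move=> mono ex; have {ex} /choice[e He] : forall i, exists e, 0 < e /\ P i e.
  by move=> i; have [e] := ex i; exists e.
pose m := \big[Num.min/1]_i e i.
have m0 : 0 < m.
  by rewrite /m; apply: (big_ind (fun x => 0 < x)) => // [x y x0 y0|i _];
    [rewrite lt_min x0|case: (He i)].
exists m => // i; apply: mono (He i).2 m0 _.
exact: bigmin_le_cond.
Qed.

Lemma finite_upper (I : finType) (P : I -> R -> Prop) :
  (forall i e e', P i e -> e <= e' -> P i e') ->
  (forall i, exists e, P i e) -> exists2 e, 1 <= e & forall i, P i e.
Proof.
move=> mono /choice[e He].
exists (1 + \sum_i `|e i|); first by rewrite lerDl sumr_ge0.
move=> i; apply: mono (He i) _; rewrite (bigD1 i)//=.
have : 0 <= \sum_(j | j != i) `|e j| by exact: sumr_ge0.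
have := ler_norm (e i); lra.
Qed.

Lemma prod_comparable (I : finType) (f g : I -> R) C : 1 <= C ->
  (forall i, 0 <= f i) -> (forall i, 0 <= g i) -> (forall i, f i <= C * g i) ->
  \prod_i f i <= C ^+ #|I| * \prod_i g i.
Proof.
move=> C1 f0 g0 fg.
have -> : C ^+ #|I| = \prod_(i : I) C by rewrite prodr_const.
by rewrite -big_split /=; apply: ler_prod => i _; rewrite f0 fg.
Qed.

End weights.

(** * Choice of the exponents *)

Section exponents.
Context (R : realType).
Implicit Types (x y : \bar R) (a b c m p : R).

Lemma sum_lower_approx (I : eqType) (s : seq I) (f : I -> \bar R) c : uniq s ->
  (c%:E < \sum_(i <- s) f i)%E -> exists a : I -> R,
  (forall i, i \in s -> ((a i)%:E < f i)%E) /\ c < \sum_(i <- s) a i.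
Proof.
elim: s c => [|i s IH] c /=.
  by move=> _; rewrite big_nil lte_fin => c0; exists (fun=> 0); rewrite big_nil.
case/andP => ins us; rewrite big_cons => cS.
have [al [ga [Hal Hga cag]]] : exists al ga : R, [/\ (al%:E < f i)%E,
    (ga%:E < \sum_(j <- s) f j)%E & c < al + ga].
  move: cS; case: (f i) => [x| |]; case: (\sum_(j <- s) f j)%E => [y| |] //=.
  - rewrite -EFinD lte_fin => cxy; exists (x - (x + y - c) / 3), (y - (x + y - c) / 3).
    by rewrite !lte_fin; split; lra.
  - by move=> _; exists (x - 1), (c - x + 2); rewrite lte_fin ltry; split => //; lra.
  - by move=> _; exists (c - y + 2), (y - 1); rewrite lte_fin ltry; split => //; lra.
  - by move=> _; exists (c + 1), 0; rewrite !ltry; split => //; lra.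
have [a [Ha ca]] := IH ga us Hga.
exists (fun j => if j == i then al else a j); split.
  move=> j; rewrite inE; case: eqP => [->//|_ /= js]; exact: Ha.
rewrite big_cons eqxx; apply: (lt_trans cag); rewrite ltrD2l.
apply: (lt_le_trans ca); rewrite [leLHS]big_seq [leRHS]big_seq; apply: ler_sum => j js.
by case: eqP => // ji; move: ins; rewrite -ji js.
Qed.

(** In a sum -oo absorbs +oo, so a term -oo could hide a term +oo that no real bounds; hence the
    second hypothesis. *)
Lemma sum_upper_approx (I : eqType) (s : seq I) (f : I -> \bar R) c : uniq s ->
  (forall i, -oo < f i)%E ->
  (\sum_(i <- s) f i < c%:E)%E -> exists b : I -> R,
  (forall i, i \in s -> (f i < (b i)%:E)%E) /\ \sum_(i <- s) b i < c.
Proof.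
move=> + fN; elim: s c => [|i s IH] c /=.
  by move=> _; rewrite big_nil lte_fin => c0; exists (fun=> 0); rewrite big_nil.
case/andP => ins us; rewrite big_cons => cS.
have SN : (-oo < \sum_(j <- s) f j)%E.
  elim: (s) => [|j s' IH']; first by rewrite big_nil ltNyr.
  rewrite big_cons; move: (fN j) IH'; case: (f j) => [x| |] //;
    case: (\sum_(k <- s') f k)%E => [y| |] //= _ _; exact: ltNyr.
have [al [ga [Hal Hga cag]]] : exists al ga : R, [/\ (f i < al%:E)%E,
    (\sum_(j <- s) f j < ga%:E)%E & al + ga < c].
  move: cS (fN i) SN; case: (f i) => [x| |]; case: (\sum_(j <- s) f j)%E => [y| |] //=.
  rewrite -EFinD lte_fin => cxy _ _; exists (x + (c - x - y) / 3), (y + (c - x - y) / 3).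
  by rewrite !lte_fin; split; lra.
have [b [Hb cb]] := IH ga us Hga.
exists (fun j => if j == i then al else b j); split.
  move=> j; rewrite inE; case: eqP => [->//|_ /= js]; exact: Hb.
rewrite big_cons eqxx; apply: le_lt_trans cag; rewrite lerD2l.
apply: le_trans (ltW cb); rewrite [leLHS]big_seq [leRHS]big_seq; apply: ler_sum => j js.
by case: eqP => // ji; move: ins; rewrite -ji js.
Qed.

Lemma conj_expV p : 1 < p -> (conj_exp p)^-1 = (p - 1) / p.
Proof. by move=> p1; rewrite /conj_exp invf_div. Qed.

(** All inequalities are strict, so a real [m] below [mm] remains, even for infinite [mm]; it has to
    exceed 0, -a p and b p / (p - 1). *)
Lemma local_exponents (mm mi Mi : \bar R) p : 1 < p ->
  (- (mm * p^-1%:E) < mi)%E -> (mi <= Mi)%E ->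
  (Mi < mm * (conj_exp p)^-1%:E)%E ->
  exists a b m, [/\ (a%:E < mi)%E, (Mi < b%:E)%E, (m%:E < mm)%E, 0 < m &
    - (a * p) < m /\ b * p < m * (p - 1)].
Proof.
move=> p1 H1 H2 H3; have p0 : 0 < p by lra.
have q0 : 0 < (p - 1) / p by rewrite divr_gt0//; lra.
have [a Ha1 Ha2] := lte_dense_fin H1.
have [b Hb1 Hb2] := lte_dense_fin H3.
(* The outer bounds give -mm / p < mm / p', where 1 / p + 1 / p' is positive; the value -oo is
   excluded. *)
have mm0 : (0 < mm)%E.
  have := lt_trans H1 (le_lt_trans H2 H3); rewrite conj_expV//.
  case: (mm) => [x| |]; [|by []|].
    rewrite -!EFinM -EFinN !lte_fin => H.
    have : 0 < x * (p^-1 + (p - 1) / p) by lra.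
    by rewrite pmulr_lgt0// addr_gt0// invr_gt0.
  by rewrite mulNyr gtr0_sg ?invr_gt0// mul1e /= mulNyr gtr0_sg// mul1e.
have am : ((- (a * p))%:E < mm)%E.
  move: Ha1; case: (mm) mm0 => [x| |] // _; last by rewrite ltry.
  rewrite -EFinM -EFinN !lte_fin => H.
  have : - a < x / p by lra.
  by rewrite ltr_pdivlMr// mulNr.
have bm : ((b * p / (p - 1))%:E < mm)%E.
  move: Hb2; rewrite conj_expV//; case: (mm) mm0 => [x| |] // _; last by rewrite ltry.
  rewrite -EFinM !lte_fin mulrA ltr_pdivlMr// => H.
  by rewrite ltr_pdivrMr//; lra.
pose c := Num.max 0 (Num.max (- (a * p)) (b * p / (p - 1))).
have cm : (c%:E < mm)%E.
  rewrite /c; have [_|_] := leP 0 (Num.max (- (a * p)) (b * p / (p - 1))) => //.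
  by have [_|_] := leP (- (a * p)) (b * p / (p - 1)).
have [m cm1 cm2] := lte_dense_fin cm; rewrite lte_fin in cm1.
exists a, b, m; split=> //.
  by apply: le_lt_trans cm1; rewrite /c le_max lexx.
split.
  by apply: le_lt_trans cm1; rewrite /c !le_max lexx !orbT.
rewrite -ltr_pdivrMr; last by lra.
by apply: le_lt_trans cm1; rewrite /c !le_max lexx !orbT.
Qed.

Lemma infinity_exponents (I : finType) (f g : I -> \bar R) (mm MM : \bar R) p : 1 < p ->
  (0 <= mm)%E -> (mm <= MM)%E -> (MM < +oo)%E ->
  (- (mm * p^-1%:E) < \sum_i f i)%E -> (\sum_i f i <= \sum_i g i)%E ->
  (\sum_i g i < mm * (conj_exp p)^-1%:E - (MM - mm) * p^-1%:E)%E ->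
  exists (a b : I -> R) m, [/\ forall i, ((a i)%:E < f i)%E,
     forall i, (g i < (b i)%:E)%E, (m%:E < mm)%E, 0 < m &
     - ((\sum_i a i) * p) < m /\ (\sum_i b i) * p < m * (p - 1)].
Proof.
move=> p1 mm0 mM MMy H1 H2 H3; have p0 : 0 < p by lra.
have [x xE] : exists x : R, mm = x%:E.
  exists (fine mm); rewrite fineK// ge0_fin_numE//; exact: le_lt_trans MMy.
have [y yE] : exists y : R, MM = y%:E.
  exists (fine MM); rewrite fineK// ge0_fin_numE//; exact: le_trans mM.
rewrite xE yE in mm0 mM MMy H1 H2 H3 *.
rewrite !lee_fin in mm0 mM.
(* As mm <= MM, the subtracted term is non-negative. *)
have H3' : (\sum_i g i < (x * ((p - 1) / p))%:E)%E.
  apply: (lt_le_trans H3); rewrite conj_expV// -EFinM -EFinB lee_fin.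
  by rewrite gerBl mulr_ge0 ?invr_ge0 ?subr_ge0// ltW.
have [c Hc1 Hc2] := lte_dense_fin H1.
have [e He1 He2] := lte_dense_fin H3'.
have [a [Ha ca]] := sum_lower_approx (index_enum_uniq I) Hc2.
(* Approximating the sum of the g i from below provides a real number below each of them. *)
have gN i : (-oo < g i)%E.
  have [a' [Ha' _]] := sum_lower_approx (index_enum_uniq I) (lt_le_trans Hc2 H2).
  by apply: lt_trans (Ha' i (mem_index_enum i)); rewrite ltNyr.
have [b [Hb be]] := sum_upper_approx (index_enum_uniq I) gN He1.
have bx : (\sum_i b i) * p / (p - 1) < x.
  rewrite ltr_pdivrMr; last by lra.
  move: He2; rewrite lte_fin mulrA ltr_pdivlMr// => H.
  by apply: le_lt_trans H; rewrite ler_pM2r// ltW.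
have ax : - ((\sum_i a i) * p) < x.
  move: Hc1; rewrite -EFinM -EFinN lte_fin => H.
  have : - c < x / p by lra.
  rewrite ltr_pdivlMr// mulNr => H'; apply: lt_trans H'.
  by rewrite ltrN2 ltr_pM2r.
have x0 : 0 < x.
  have := lt_trans H1 (le_lt_trans H2 H3').
  rewrite -EFinM -EFinN lte_fin => H.
  have : 0 < x * (p^-1 + (p - 1) / p) by lra.
  by rewrite pmulr_lgt0// addr_gt0 ?invr_gt0// divr_gt0//; lra.
pose m0 := Num.max 0 (Num.max (- ((\sum_i a i) * p)) ((\sum_i b i) * p / (p - 1))).
have mx : m0 < x by rewrite !gt_max x0 ax.
have m00 : 0 <= m0 by rewrite le_max lexx.
exists a, b, ((m0 + x) / 2); split.
- by move=> i; apply: Ha; exact: mem_index_enum.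
- by move=> i; apply: Hb; exact: mem_index_enum.
- by rewrite lte_fin; lra.
- lra.
split.
  have : - ((\sum_i a i) * p) <= m0 by rewrite /m0 !le_max lexx orbT.
  lra.
rewrite -ltr_pdivrMr; last by lra.
have : (\sum_i b i) * p / (p - 1) <= m0 by rewrite /m0 !le_max lexx !orbT.
lra.
Qed.

(** The condition is open in the exponent and survives lowering [p] to some [s]; the gap between
    them later yields t > 1. *)
Lemma intermediate_exponent m p beta : 0 < m -> 1 < p -> beta < m * (p - 1) ->
  exists s, [/\ 1 < s, s < p & beta < m * (s - 1)].
Proof.
move=> m0 p1 bm; pose l := Num.max 0 (beta / m).
have lp : l < p - 1.
  by rewrite gt_max subr_gt0 p1 ltr_pdivrMr// mulrC.
have l0 : 0 <= l by rewrite le_max lexx.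
have lb : beta / m <= l by rewrite le_max lexx orbT.
exists (1 + (l + p - 1) / 2); split; [lra|lra|].
by rewrite mulrC -ltr_pdivrMr//; lra.
Qed.

Context (disp : measure_display) (X : measurableType disp).
Variables (d : X -> X -> R) (mu : {measure set X -> \bar R}) (c0 : R).
Hypothesis hs : homogeneous d mu c0.

Lemma m_mu_infty_ge0 (x : X) : (0 <= m_mu_infty d mu x)%E.
Proof.
apply: (@le_trans _ _ (lne (limf_einf (ball_ratio d mu x 2) +oo%R) * (ln 2)^-1%:E)%E).
  apply: mule_ge0; last by rewrite lee_fin invr_ge0 ltW// ln_gt0// ltr1n.
  rewrite lne_ge0 /limf_einf leeNr limf_esupE.
  apply: ge_ereal_inf; exists
    (ereal_sup [set (- ball_ratio d mu x 2 r)%E | r in [set r : R | 1 < r]]).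
    exists [set r : R | 1 < r] => //=.
    by exists 1; split => //; rewrite num_real.
  apply: ge_ereal_sup => _ [r r1 <-]; rewrite leeN2 lee_fin; rewrite /= in r1.
  have r0 : 0 < r by lra.
  rewrite ler_pdivlMr ?(ballm_gt0 hs)// mul1r; apply: (ballm_le hs) => //.
    by rewrite mulr_gt0.
  by apply: qball_sub; rewrite ler_peMr ?ltW// ltr1n.
by apply: ereal_sup_ubound; exists 2 => //=; rewrite ltr1n.
Qed.

Lemma M_mu_infty_lty (x : X) : (M_mu_infty d mu x < +oo)%E.
Proof.
have [C C1 HC] := ballm_dbl hs 2.
have l2 : 0 < ln 2 :> R by rewrite ln_gt0// ltr1n.
apply: (@le_lt_trans _ _ (lne (limf_esup (ball_ratio d mu x 2) +oo%R) * (ln 2)^-1%:E)%E).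
  by apply: ereal_inf_lbound; exists 2 => //=; rewrite ltr1n.
have : (limf_esup (ball_ratio d mu x 2) +oo%R <= C%:E)%E.
  rewrite limf_esupE.
  apply: ge_ereal_inf; exists (ereal_sup [set ball_ratio d mu x 2 r | r in [set r : R | 0 < r]]).
    exists [set r : R | 0 < r] => //=.
    by exists 0; split => //; rewrite num_real.
  apply: ge_ereal_sup => _ [r /= r0 <-]; rewrite lee_fin.
  by rewrite ler_pdivrMr ?(ballm_gt0 hs)// mulrC; exact: HC.
case: (limf_esup _ _) => [y| |] //=.
- move=> _; case: ifP => _; last by rewrite -EFinM ltry.
  by rewrite mulNyr gtr0_sg ?invr_gt0// mul1e.
- by move=> _; rewrite mulNyr gtr0_sg ?invr_gt0// mul1e.
Qed.

End exponents.

(** * The weight near its poles *)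

Section pieces.
Context (R : realType) (disp : measure_display) (X : measurableType disp).
Variables (d : X -> X -> R) (mu : {measure set X -> \bar R}) (c0 : R).
Hypothesis hs : homogeneous d mu c0.
Local Notation B := (qball d).
Local Notation bm := (ballm d mu).
Implicit Types (x y z : X) (r s t m : R).

(** The hypothesis bounds the measure of B z t by M (t / h0)^m, which tends to 0 with t. *)
Lemma point_null z (h0 m M : R) : 0 < h0 -> 0 < m ->
  (forall t, 0 < t -> t <= h0 -> bm z t * (h0 / t) `^ m <= M) ->
  mu [set z] = 0%E.
Proof.
move=> h00 m0 HM.
have sub t : 0 < t -> (mu [set z] <= (bm z t)%:E)%E.
  move=> t0; apply: (ballm_set_le hs) => //; first exact: measurable_point hs _.
  by move=> _ ->; exact: qball_center hs _ _ t0.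
have fin : mu [set z] \is a fin_num.
  by rewrite ge0_fin_numE ?measure_ge0//; exact: le_lt_trans (sub _ h00) (ltry _).
move: sub; rewrite -(fineK fin); set e := fine _ => sub.
have e0 : 0 <= e by rewrite /e fine_ge0.
apply/eqP; rewrite eqe; apply/negP => /negP en0.
have {}e0 : 0 < e by rewrite lt_neqAle eq_sym en0.
have M0 : 0 <= M.
  by apply: le_trans (HM h0 h00 (lexx _)); rewrite mulr_ge0 ?powR_ge0// ltW// (ballm_gt0 hs).
pose Y := M / e + 1; have Y1 : 1 <= Y by rewrite lerDr divr_ge0// ltW.
have Y0 : 0 < Y by lra.
have Ym1 : 1 <= Y `^ m^-1.
  by rewrite -[leLHS](powRr0 Y) ler_powR// invr_ge0 ltW.
have Ym0 : 0 < Y `^ m^-1 by lra.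
pose t := h0 / Y `^ m^-1; have t0 : 0 < t by rewrite divr_gt0.
have th : t <= h0 by rewrite ler_pdivrMr// ler_peMr// ltW.
have := HM t t0 th; have -> : h0 / t = Y `^ m^-1.
  by rewrite /t invf_div mulrCA divff ?mulr1// gt_eqF.
rewrite -powRrM mulVf ?gt_eqF// powRr1 ?(ltW Y0)//.
have := sub t t0; rewrite lee_fin => et H.
have : e * Y <= M by apply: le_trans H; rewrite ler_wpM2r// ltW.
by rewrite /Y mulrDr mulr1 mulrC divfK ?gt_eqF//; lra.
Qed.

Lemma prod_bounds (I : finType) (P : pred I) (f : I -> R) C : 1 <= C ->
  (forall i, P i -> C^-1 <= f i /\ f i <= C) ->
  (C ^+ #|I|)^-1 <= \prod_(i | P i) f i /\ \prod_(i | P i) f i <= C ^+ #|I|.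
Proof.
move=> C1 Hf; have C0 : 0 < C by lra.
have Ci : C^-1 <= 1 by rewrite invf_le1.
have Ci0 : 0 < C^-1 by rewrite invr_gt0.
split.
  rewrite -exprVn -prodr_const [leRHS]big_mkcond; apply: ler_prod => i _.
  rewrite (ltW Ci0) /=; case: ifP => // /Hf[]//.
rewrite -prodr_const [leLHS]big_mkcond; apply: ler_prod => i _.
case: ifP => [/Hf[H1 H2]|_]; last by rewrite ler01.
by rewrite H2 andbT (le_trans _ H1)// ltW.
Qed.

Lemma powR_bounds (D x q pp : R) : 1 <= D -> D^-1 <= x -> x <= D ->
  0 <= q -> q <= pp -> (D `^ pp)^-1 <= x `^ q /\ x `^ q <= D `^ pp.
Proof.
move=> D1 x1 x2 q0 qpp; have D0 : 0 < D by lra.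
have Di0 : 0 < D^-1 by rewrite invr_gt0.
have x0 : 0 < x by lra.
have Dpq : D `^ q <= D `^ pp by exact: ler_powR.
split; last first.
  by apply: le_trans Dpq; apply: ge0_ler_powR; rewrite ?nnegrE// ltW.
apply: (@le_trans _ _ (D^-1 `^ q)).
  rewrite -[D^-1]powR_inv1 ?(ltW D0)// -powRrM mulN1r powRN.
  by rewrite lef_pV2 ?posrE ?powR_gt0.
by apply: ge0_ler_powR; rewrite ?nnegrE// ltW.
Qed.

Lemma powR_exp_bounds (x e L : R) : 0 < x -> `|e * ln x| <= L ->
  (expR L)^-1 <= x `^ e /\ x `^ e <= expR L.
Proof.
move=> x0; rewrite ler_norml => /andP[H1 H2].
by rewrite /powR gt_eqF// -expRN !ler_expR.
Qed.

Variables (p : X -> R) (pm pp A : R).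
Hypotheses (mp : measurable_fun setT p) (pm1 : 1 < pm) (A0 : 0 < A).
Hypotheses (pmp : forall x, pm <= p x) (ppp : forall x, p x <= pp).
Hypothesis logH : forall x y, 0 < d x y -> d x y <= 2^-1 ->
  `|p x - p y| <= A / ln (1 / d x y).
Variables (x0 : X) (N : nat) (xs : 'I_N -> X) (w : 'I_N.+1 -> R -> R).
Hypotheses (xs_inj : injective xs) (Ww : forall k, Wtilde (w k)).
Local Notation rho := (radial_weight d x0 xs w).
Local Notation wk := (fun k => w (lift ord0 k)).

Let w0 k t : 0 < t -> 0 < w k t. Proof. by case: (Ww k) => _ + _ _; apply. Qed.
Let p1 x : 1 < p x. Proof. exact: lt_le_trans pm1 _. Qed.
Let p_gt0 x : 0 < p x. Proof. exact: lt_trans (p1 x). Qed.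

(** At these points [rho] involves the unconstrained value of a weight at 0; they form the null set
    left out of the pointwise estimates. *)
Definition poles : set X := [set y | exists k, y = xs k].

Lemma measurable_poles : measurable poles.
Proof.
rewrite (_ : poles = \bigcup_(k in [set: 'I_N]) [set xs k]).
  by apply: fin_bigcup_measurable => // k _; exact: measurable_point hs _.
by apply/seteqP; split => [y [k ->]|y [k _ /= ->]]; exists k.
Qed.

Lemma poles_null : (forall k, mu [set xs k] = 0%E) -> mu poles = 0%E.
Proof.
move=> H; have mP := measurable_poles.
apply/eqP; rewrite eq_le measure_ge0 andbT.
rewrite -nint_indic//.
apply: (@le_trans _ _ (nint mu (fun x => \sum_(k <- index_enum 'I_N) \1_[set xs k] x))).
  apply: le_nint => x; first exact: indic_ge0.
  rewrite indicE; case: (boolP (x \in poles)) => [|_]; last first.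
    by apply: sumr_ge0 => k _; exact: indic_ge0.
  rewrite inE => -[k ->]; rewrite (bigD1 k)//= indicE mem_set// lerDl.
  by apply: sumr_ge0 => j _; exact: indic_ge0.
rewrite nint_sum; last 2 first.
- by move=> k; apply: measurable_indic; exact: measurable_point hs _.
- by move=> k x; exact: indic_ge0.
rewrite big1// => k _; rewrite nint_indic//; exact: measurable_point hs _.
Qed.

Lemma dist_pole_gt0 y k : ~ poles y -> 0 < d y (xs k).
Proof.
move=> yP; rewrite lt_neqAle eq_sym (hs_ge0 hs) andbT.
by apply/eqP => /(hs_eq0 hs) yk; apply: yP; exists k.
Qed.

(** [P] selects the factors kept: all of them away from the poles, all but one near a pole, where
    the omitted factor carries the singularity. *)
Lemma factor_bounds (Rb eta : R) : 0 < Rb -> 0 < eta ->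
  exists2 D, 1 <= D & forall (P : pred 'I_N) y, d x0 y < Rb ->
    (forall k, P k -> eta <= d y (xs k)) ->
    D^-1 <= w ord0 (1 + d x0 y) * \prod_(k | P k) wk k (d y (xs k)) /\
    w ord0 (1 + d x0 y) * \prod_(k | P k) wk k (d y (xs k)) <= D.
Proof.
move=> R0 eta0; have c00 := hs_c0_gt0 hs.
have R01 : 0 < 1 + Rb by lra.
have [C1 C11 H1] := weight_compact (Ww ord0) ltr01 R01.
have [hi hi1 Hhi] : exists2 hi, 1 <= hi & forall k, c0 * (Rb + d x0 (xs k)) <= hi.
  apply: finite_upper => [k e e' H1' H2'|k]; first exact: le_trans H2'.
  by exists (c0 * (Rb + d x0 (xs k))).
have [C2 C21 H2] : exists2 C, 1 <= C & forall k t, eta <= t -> t <= hi ->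
    C^-1 <= wk k t /\ wk k t <= C.
  have [||C C1' HC] := @finite_upper R 'I_N (fun k C => 1 <= C /\ forall t,
      eta <= t -> t <= hi -> C^-1 <= wk k t /\ wk k t <= C).
  - move=> k e e' [e1 He] ee'; split; first exact: le_trans ee'.
    move=> t t1 t2; have [H3 H4] := He t t1 t2; split; last exact: le_trans ee'.
    by apply: le_trans H3; rewrite lef_pV2 ?posrE//; lra.
  - move=> k; have [C C1' HC] := weight_compact (Ww (lift ord0 k)) eta0 (lt_le_trans ltr01 hi1).
    by exists C.
  by exists C => // k; exact: (HC k).2.
have C10 : 0 < C1 by lra.
have C2N : 1 <= C2 ^+ #|'I_N| by rewrite exprn_ege1.
exists (C1 * C2 ^+ #|'I_N|); first by rewrite mulr_ege1.
move=> P y yR HP.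
have [a1 a2] : C1^-1 <= w ord0 (1 + d x0 y) /\ w ord0 (1 + d x0 y) <= C1.
  by apply: H1; [rewrite lerDl (hs_ge0 hs)|lra].
have yhi k : d y (xs k) <= hi.
  apply: le_trans (Hhi k); apply: le_trans (hs_tri hs y (xs k) x0) _.
  by rewrite ler_pM2l// lerD2r (hs_sym hs) ltW.
have [b1 b2] := @prod_bounds 'I_N P (fun k => wk k (d y (xs k))) C2 C21
  (fun k Pk => H2 k _ (HP k Pk) (yhi k)).
rewrite invfM; split; apply: ler_pM => //.
- by rewrite invr_ge0 ltW.
- by rewrite invr_ge0; lra.
- by apply: le_trans a1; rewrite invr_ge0 ltW.
- by apply: le_trans b1; rewrite invr_ge0; lra.
Qed.

(** With v = w_k^(p(x_k)), frozen beyond [h], rho(y)^p(y) is v times a bounded factor from the other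
    weights and times w_k^(p(y) - p(x_k)), which [power_bounds_ln] and the log-condition keep
    bounded. All small radii are allowed so that one of them can serve all poles. *)
Lemma weight_near_pole k (a b m : R) : (a%:E < m_idx (wk k))%E -> (M_idx (wk k) < b%:E)%E ->
  (m%:E < m_mu d mu)%E -> 0 < m -> - (a * p (xs k)) < m ->
  b * p (xs k) < m * (p (xs k) - 1) ->
  mu [set xs k] = 0%E /\ exists2 e, 0 < e & forall tau, 0 < tau -> tau <= e ->
    exists v s t Cr, [/\ 1 < s, 1 < t, doubling_weight d mu v, Acond d mu s v &
      [/\ 0 < Cr, forall y, B (xs k) tau y -> s * t <= p y,
      forall y, B (xs k) tau y -> ~ poles y -> `|rho y| `^ p y <= Cr * v y &
      forall y, B (xs k) tau y -> ~ poles y -> v y <= Cr * `|rho y| `^ p y]].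
Proof.
move=> Ha Hb Hm m0 am bm'; have c00 := hs_c0_gt0 hs; have c01 := hs_c0 hs.
pose pk := p (xs k).
have pk1 : 1 < pk := p1 (xs k). have pk0 : 0 < pk := p_gt0 (xs k).
have [h1 h10 [C C0 ub]] := weight_bounds_zero (Ww (lift ord0 k)) Ha Hb.
have [h2 h20 [Cm Cm0 Hmu]] := measure_bounds_zero hs Hm.
have null : mu [set xs k] = 0%E.
  apply: (@point_null (xs k) h2 m (Cm * bm (xs k) h2)) => // t t0 th.
  exact: Hmu.
split=> //.
have [s [s1 sp bs]] := intermediate_exponent m0 pk1 bm'.
(* The midpoint leaves room on both sides: t = q / s exceeds 1, and s t = q stays below p near the
   pole. *)
pose q := (s + pk) / 2; have sq : s < q by rewrite /q; lra.
have qp : q < pk by rewrite /q; lra.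
pose t := q / s; have s0 : 0 < s by lra.
have t1 : 1 < t by rewrite ltr_pdivlMr// mul1r.
have stq : s * t = q by rewrite /t mulrC divfK// gt_eqF.
pose h := Num.min (Num.min h1 h2) 2^-1.
have h0 : 0 < h by rewrite !lt_min h10 h20 invr_gt0 ltr0n.
have hh1 : h <= h1 by rewrite !ge_min lexx.
have hh2 : h <= h2 by rewrite !ge_min lexx orbT.
have hhalf : h <= 2^-1 by rewrite !ge_min lexx orbT.
have ubh : power_bounds [set t | 0 < t <= h] a b C (wk k).
  apply: power_bounds_sub ub => r /= /andP[r0 rh]; rewrite r0 /=.
  exact: le_trans hh1.
have [L L0 HL] := power_bounds_ln h0 hhalf C0 (fun r => @w0 (lift ord0 k) r) ubh.
pose u r := posext (wk k) r `^ pk.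
have u0 r : 0 < u r by rewrite powR_gt0// posext_gt0// => r' /w0.
have ubu : power_bounds [set t | 0 < t <= h] (a * pk) (b * pk) (C `^ pk) u.
  apply: power_bounds_pow => //.
  - by move=> r /andP[].
  - by move=> r _; rewrite posext_gt0// => r' /w0.
  - by apply: power_bounds_ext ubh => r /andP[r0 _]; rewrite posextE.
have mu_ : measurable_fun setT (fun y => u (Num.min (d y (xs k)) h)).
  apply: measurable_fun_powR_cst.
  have [cw _ _ _] := Ww (lift ord0 k).
  apply: (measurableT_comp (measurable_posext cw)).
  apply: measurable_minr => //; exact: measurable_dist hs _.
have Cp0 : 0 < C `^ pk by exact: powR_gt0.
have [dw Ac] := local_weight hs u0 h0 s1 Cp0 Cm0 m0 ubu
  (fun t r H1 H2 H3 => Hmu (xs k) t r H1 H2 (le_trans H3 hh2)) am bs null mu_.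
pose v y := u (Num.min (d y (xs k)) h).
have [eta eta0 Heta] : exists2 eta, 0 < eta & forall j, j != k -> eta <= d (xs k) (xs j).
  apply: (@finite_lower R 'I_N (fun j e => j != k -> e <= d (xs k) (xs j))).
    by move=> j e e' He _ ee' jk; apply: le_trans (He jk).
  move=> j; have [->|jk] := eqVneq j k; first by exists 1.
  exists (d (xs k) (xs j)) => //; rewrite lt_neqAle eq_sym (hs_ge0 hs) andbT.
  apply/eqP => /(hs_eq0 hs)/xs_inj kj; by rewrite kj eqxx in jk.
(* Below [h] the power bounds hold; below exp(-A / (pk - q)) the log-condition keeps p within pk - q
   of pk; below eta / (2 c0) the other poles remain at distance at least eta / (2 c0). *)
pose e := Num.min (Num.min h (expR (- (A / (pk - q))))) (eta / (2 * c0)).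
have e0 : 0 < e by rewrite lt_min lt_min h0 expR_gt0 divr_gt0// mulr_gt0.
exists e => // tau tau0 taue.
have tauh : tau <= h by rewrite (le_trans taue)// ge_min ge_min lexx.
have taue2 : tau <= expR (- (A / (pk - q))).
  by rewrite (le_trans taue)// ge_min ge_min lexx orbT.
have taueta : tau <= eta / (2 * c0) by rewrite (le_trans taue)// ge_min lexx orbT.
have Rb0 : 0 < c0 * (d x0 (xs k) + h) by rewrite mulr_gt0// ltr_wpDl ?(hs_ge0 hs).
have ec0 : 0 < eta / (2 * c0) by rewrite divr_gt0// mulr_gt0.
have [D D1 HD] := factor_bounds Rb0 ec0.
have D0 : 0 < D by lra.
pose Cr := D `^ pp * expR (A * L).
have Cr0 : 0 < Cr by rewrite mulr_gt0 ?powR_gt0 ?expR_gt0.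
have key y : B (xs k) tau y -> ~ poles y -> exists th W,
   [/\ `|rho y| `^ p y = th * W * v y, (D `^ pp)^-1 <= th, th <= D `^ pp,
       (expR (A * L))^-1 <= W & W <= expR (A * L)].
  move=> yB yP; have dy0 := dist_pole_gt0 k yP.
  have dyt : d y (xs k) < tau by rewrite (hs_sym hs).
  have dyh : d y (xs k) <= h by rewrite (le_trans (ltW dyt)).
  have wy0 := w0 (lift ord0 k) dy0.
  have yR : d x0 y < c0 * (d x0 (xs k) + h).
    apply: le_lt_trans (hs_tri hs x0 y (xs k)) _; rewrite ltr_pM2l// ltrD2l.
    by rewrite (hs_sym hs); exact: lt_le_trans dyt tauh.
  have sepj j : predC1 k j -> eta / (2 * c0) <= d y (xs j).
    move=> /= jk; have H := le_trans (Heta j jk) (hs_tri hs (xs k) (xs j) y).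
    have : d (xs k) y <= eta / (2 * c0) by rewrite (hs_sym hs) (le_trans (ltW dyt)).
    have c2 : 0 < 2 * c0 by rewrite mulr_gt0.
    rewrite ler_pdivlMr// ler_pdivrMr//; nra.
  have [th1 th2] := HD (predC1 k) y yR sepj.
  set th := (w ord0 _ * _) in th1 th2.
  have th0 : 0 < th by apply: lt_le_trans th1; rewrite invr_gt0.
  have rhoE : rho y = th * wk k (d y (xs k)).
    by rewrite /radial_weight (bigD1 k)//= /th -!mulrA [X in _ * X]mulrC.
  exists (th `^ p y), (wk k (d y (xs k)) `^ (p y - pk)).
  have [t_1 t_2] := powR_bounds D1 th1 th2 (ltW (p_gt0 y)) (ppp y).
  have [W1 W2] : (expR (A * L))^-1 <= wk k (d y (xs k)) `^ (p y - pk) /\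
      wk k (d y (xs k)) `^ (p y - pk) <= expR (A * L).
    apply: powR_exp_bounds => //; rewrite normrM.
    have ln0 : 0 < ln (1 / d y (xs k)).
      by rewrite ln_gt0// ltr_pdivlMr// mul1r (le_lt_trans dyh)// (le_lt_trans hhalf)//; lra.
    have := logH dy0 (le_trans dyh hhalf) => Hp.
    apply: (le_trans (ler_pM (normr_ge0 _) (normr_ge0 _) Hp (HL _ dy0 dyh))).
    by rewrite mulrA mulrAC divfK ?lexx// gt_eqF.
  split=> //.
  have pr := mulr_gt0 th0 wy0.
  rewrite rhoE (gtr0_norm pr) (powRM _ (ltW th0) (ltW wy0)) -mulrA.
  congr (_ * _); rewrite /v /u min_l// posextE// -powRD ?subrK//.
  by rewrite (gt_eqF wy0) implybT.
exists v, s, t, Cr; split=> //; split=> //.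
- move=> y yB; rewrite stq.
  have [yk|yk] := eqVneq (d y (xs k)) 0.
    have -> : y = xs k by apply/(hs_eq0 hs).
    exact: ltW.
  have dy0 : 0 < d y (xs k) by rewrite lt_neqAle eq_sym yk (hs_ge0 hs).
  have dyt : d y (xs k) < tau by rewrite (hs_sym hs).
  have pq0 : 0 < pk - q by rewrite subr_gt0.
  have ln1 : A / (pk - q) <= ln (1 / d y (xs k)).
    rewrite div1r lnV ?posrE// lerNr -[leRHS](@expRK R) ler_ln ?posrE ?expR_gt0//.
    exact: le_trans (ltW dyt) _.
  have Aq : 0 < A / (pk - q) by rewrite divr_gt0.
  have := logH dy0 (le_trans (ltW dyt) (le_trans tauh hhalf)) => Hp.
  have : `|p y - pk| <= pk - q.
    apply: (le_trans Hp); rewrite ler_pdivrMr; last exact: lt_le_trans ln1.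
    by move: ln1; rewrite ler_pdivrMr// mulrC.
  by rewrite ler_norml => /andP[H _]; lra.
- move=> y yB yP; have [th [W [-> t_1 t_2 W1 W2]]] := key y yB yP.
  rewrite ler_wpM2r ?(ltW (u0 _))// ler_pM//.
    by apply: le_trans t_1; rewrite invr_ge0 powR_ge0.
  by apply: le_trans W1; rewrite invr_ge0 expR_ge0.
- move=> y yB yP; have [th [W [-> t_1 t_2 W1 W2]]] := key y yB yP.
  rewrite mulrA ler_peMl ?(ltW (u0 _))//.
  rewrite /Cr mulrACA mulr_ege1//.
    by rewrite mulrC -ler_pdivrMr ?powR_gt0// mul1r.
  by rewrite mulrC -ler_pdivrMr ?expR_gt0// mul1r.
Qed.

End pieces.

(** * Modular estimates *)

Section assembly.
Context (R : realType) (disp : measure_display) (X : measurableType disp).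
Variables (d : X -> X -> R) (mu : {measure set X -> \bar R}) (c0 : R).
Hypothesis hs : homogeneous d mu c0.
Local Notation B := (qball d).
Local Notation bm := (ballm d mu).
Local Notation bavg := (bavg d mu).
Implicit Types (x y z : X) (r s t m : R) (F : X -> R) (S Q : set X).
Variables (p : X -> R) (pm pp A : R).
Hypotheses (mp : measurable_fun setT p) (pm1 : 1 < pm) (A0 : 0 < A).
Hypotheses (pmp : forall x, pm <= p x) (ppp : forall x, p x <= pp).
Hypothesis logH : forall x y, 0 < d x y -> d x y <= 2^-1 ->
  `|p x - p y| <= A / ln (1 / d x y).
Variables (x0 : X) (N : nat) (xs : 'I_N -> X) (w : 'I_N.+1 -> R -> R).
Hypotheses (xs_inj : injective xs) (Ww : forall k, Wtilde (w k)).
Local Notation rho := (radial_weight d x0 xs w).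
Local Notation wk := (fun k => w (lift ord0 k)).
Local Notation poles := (poles xs).

Let w0 k t : 0 < t -> 0 < w k t. Proof. by case: (Ww k) => _ + _ _; apply. Qed.
Let p1 x : 1 < p x. Proof. exact: lt_le_trans pm1 _. Qed.
Let p_gt0 x : 0 < p x. Proof. exact: lt_trans (p1 x). Qed.

(** Far from x0 the arguments d x (xs k) and 1 + d x0 x are all comparable to d x0 x. Hence rho is
    comparable to the product of all w_k at d x0 x, whose exponents are the sums of the individual
    ones. *)
Lemma weight_at_infinity (a b : 'I_N.+1 -> R) (m q : R) : 1 < q -> 0 < m ->
  (forall k, ((a k)%:E < m_idx_infty (w k))%E) ->
  (forall k, (M_idx_infty (w k) < (b k)%:E)%E) ->
  (m%:E < m_mu_infty d mu x0)%E ->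
  - ((\sum_k a k) * q) < m -> (\sum_k b k) * q < m * (q - 1) ->
  exists (Rinf : R) (v : X -> R) s Cr, [/\ 0 < Rinf, 1 < s, s < q,
    doubling_weight d mu v & [/\ Acond d mu s v, 0 < Cr,
    forall x, Rinf <= d x0 x -> `|rho x| `^ q <= Cr * v x &
    forall x, Rinf <= d x0 x -> v x <= Cr * `|rho x| `^ q]].
Proof.
move=> q1 m0 Ha Hb Hm am bmq; have c00 := hs_c0_gt0 hs; have c01 := hs_c0 hs.
have q0 : 0 < q by lra.
have [h1 h11 [Cm Cm0 Hmu]] := measure_bounds_infty hs Hm.
have [h2 h21 Hw] : exists2 h, 1 <= h & forall k, exists2 C, 0 < C &
    power_bounds [set t | h <= t] (a k) (b k) C (w k).
  apply: finite_upper => [k e e' [C C0 ub] ee'|k].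
    by exists C => //; apply: power_bounds_sub ub => t /=; exact: le_trans.
  by have [h h_1 [C C0 ub]] := weight_bounds_infty (Ww k) (Ha k) (Hb k); exists h, C.
pose h := Num.max h1 h2.
have hh1 : h1 <= h by rewrite le_max lexx.
have hh2 : h2 <= h by rewrite le_max lexx orbT.
have h0 : 0 < h by lra.
have Dpos t : [set t | h <= t] t -> 0 < t by exact: lt_le_trans.
have pw k t : 0 < posext (w k) t by apply: posext_gt0 => t' /w0.
have ubk k : exists2 C, 0 < C & power_bounds [set t | h <= t] (a k) (b k) C (posext (w k)).
  have [C C0 ub] := Hw k; exists C => //.
  apply: (power_bounds_ext (u := w k)) => [t Dt|]; first by rewrite posextE// Dpos.
  by apply: power_bounds_sub ub => t; exact: le_trans.
have [C C0 ub] := power_bounds_prod (index_enum 'I_N.+1) Dpos (fun k t _ => pw k t) ubk.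
pose W t := \prod_k posext (w k) t.
have W0 t : 0 < W t by apply: prodr_gt0.
pose u t := W t `^ q.
have u0 t : 0 < u t by exact: powR_gt0.
have ubu : power_bounds [set t | h <= t] ((\sum_k a k) * q) ((\sum_k b k) * q) (C `^ q) u.
  by apply: power_bounds_pow.
have [s [s1 sq bs]] := intermediate_exponent m0 q1 bmq.
have mW : measurable_fun setT (fun y => u (Num.max (d y x0) h)).
  apply: measurable_fun_powR_cst; apply: measurable_prod => k _.
  have [cw _ _ _] := Ww k.
  apply: (measurableT_comp (measurable_posext cw)).
  apply: measurable_maxr => //; exact: measurable_dist hs _.
have Cq0 : 0 < C `^ q by exact: powR_gt0.
have [dw Ac] := infinity_weight hs u0 h0 s1 Cq0 Cm0 ubu
  (fun t r H1 H2 => Hmu t r (le_trans hh1 H1) H2) am bs mW.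
have [dm dm1 Hdm] : exists2 dm, 1 <= dm & forall k, d x0 (xs k) <= dm.
  apply: finite_upper => [k e e' H1 H2|k]; first exact: le_trans H2.
  by exists (d x0 (xs k)).
pose K := 2 * c0; have K2 : 2 <= K by rewrite /K; lra.
have K1 : 1 <= K by lra.
have [C3 C31 H3] : exists2 C, 1 <= C & forall k t r, h <= t -> h <= r ->
    t <= K * r -> r <= K * t -> w k t <= C * w k r.
  have [||C3 C31 HC] := @finite_upper R 'I_N.+1 (fun k C => forall t r, h <= t -> h <= r ->
    t <= K * r -> r <= K * t -> w k t <= C * w k r).
  - move=> k e e' H ee' t r t0 r0 tr rt; apply: (le_trans (H t r t0 r0 tr rt)).
    by rewrite ler_wpM2r// ltW// w0// Dpos.
  - move=> k; have [Ck Ck0 ubk'] := ubk k.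
    exists (Ck * (K `^ `|a k| + K `^ `|b k|)) => t r ht hr tr rt.
    rewrite -!(@posextE _ (w k)) ?Dpos//.
    exact: (power_bounds_comp Dpos (pw k) Ck0 ubk').
  by exists C3.
(* Beyond this radius each d x (xs k) is at least dm + h and within a factor K = 2 c0 of d x0 x. *)
pose Rinf := K * (dm + h).
have Rinf0 : 0 < Rinf by rewrite mulr_gt0; lra.
pose Cr := (C3 ^+ #|'I_N.+1|) `^ q.
have C3N : 1 <= C3 ^+ #|'I_N.+1| by rewrite exprn_ege1.
have Cr0 : 0 < Cr by rewrite powR_gt0//; lra.
(* [unlift] brings w_0 and the other weights under a single product over N + 1 indices. *)
pose arg x k := if unlift ord0 k is Some j then d x (xs j) else 1 + d x0 x.
have rhoE x : rho x = \prod_k w k (arg x k).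
  rewrite big_ord_recl /arg unlift_none; congr (_ * _).
  by apply: eq_bigr => k _; rewrite liftK.
have compat x : Rinf <= d x0 x -> h <= d x0 x /\ forall k, [/\ h <= arg x k,
    arg x k <= K * d x0 x & d x0 x <= K * arg x k].
  move=> xR; have KD : dm + h <= d x0 x.
    by apply: le_trans xR; rewrite ler_peMl//; lra.
  split; first by lra.
  move=> k; rewrite /arg; case: unliftP => [j _|_].
    have dj := Hdm j.
    have T1 : d x (xs j) <= K * d x0 x.
      apply: (le_trans (hs_tri hs x (xs j) x0)); rewrite /K [d x x0](hs_sym hs).
      rewrite [2 * c0]mulrC -mulrA ler_pM2l//; lra.
    have T2 : d x0 x <= c0 * (dm + d x (xs j)).
      apply: (le_trans (hs_tri hs x0 x (xs j))); rewrite ler_pM2l//.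
      by rewrite [d (xs j) x](hs_sym hs) lerD2r.
    have T3 : dm + h <= d x (xs j).
      have : c0 * (2 * (dm + h)) <= c0 * (dm + d x (xs j)).
        by apply: le_trans T2; apply: le_trans xR; rewrite /Rinf /K mulrA [c0 * 2]mulrC.
      rewrite ler_pM2l//; lra.
    split=> //; first by lra.
    apply: (le_trans T2); rewrite /K [2 * c0]mulrC -mulrA ler_pM2l//; lra.
  split; [lra| |].
    apply: (@le_trans _ _ (2 * d x0 x)); first by lra.
    by rewrite ler_wpM2r//; lra.
  apply: (@le_trans _ _ (1 * (1 + d x0 x))); first by lra.
  by rewrite ler_wpM2r//; lra.
have WE x : Rinf <= d x0 x -> u (Num.max (d x x0) h) = (\prod_k w k (d x0 x)) `^ q.
  move=> xR; have [hx _] := compat x xR.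
  rewrite /u /W [d x x0](hs_sym hs) max_l//; congr (_ `^ _).
  by apply: eq_bigr => k _; rewrite posextE// Dpos.
have rho0 x : Rinf <= d x0 x -> 0 < rho x /\ 0 < \prod_k w k (d x0 x).
  move=> xR; have [hx Hk] := compat x xR; rewrite rhoE.
  split; apply: prodr_gt0 => k _; apply: w0; last exact: Dpos hx.
  by have [hk _ _] := Hk k; exact: Dpos hk.
have fin (y z : R) : 0 < y -> 0 < z -> y <= C3 ^+ #|'I_N.+1| * z -> y `^ q <= Cr * z `^ q.
  move=> y0 z0 yz; rewrite -powRM; [|by lra|exact: ltW].
  apply: ge0_ler_powR; rewrite ?nnegrE ?(ltW q0) ?(ltW y0)//.
  by rewrite mulr_ge0 ?(ltW z0)//; lra.
exists Rinf, (fun y => u (Num.max (d y x0) h)), s, Cr; split=> //; split=> //.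
- move=> x xR; have [r0 W0'] := rho0 x xR; have [hx Hk] := compat x xR.
  rewrite WE// gtr0_norm//; apply: fin => //; rewrite rhoE.
  apply: prod_comparable => // k; have [hk k1 k2] := Hk k.
  + by rewrite ltW// w0// Dpos.
  + by rewrite ltW// w0// Dpos.
  + exact: H3.
- move=> x xR; have [r0 W0'] := rho0 x xR; have [hx Hk] := compat x xR.
  rewrite WE// gtr0_norm//; apply: fin => //; rewrite rhoE.
  apply: prod_comparable => // k; have [hk k1 k2] := Hk k.
  + by rewrite ltW// w0// Dpos.
  + by rewrite ltW// w0// Dpos.
  + exact: H3.
Qed.

Definition unit_modular F := [/\ measurable_fun setT F, forall x, 0 <= F x &
  (nint mu (fun x => ((`|rho x| * F x) `^ p x)%R) <= 1)%E].

(** Uniform in F and limited to radii below [dl], so that finitely many pieces can be glued with the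
    smallest threshold and the sum of the majorants. *)
Definition controlled S := exists K dl : R, [/\ 0 < K, 0 < dl &
  forall F, unit_modular F ->
    exists Phi : X -> \bar R, [/\ measurable_fun setT Phi,
      forall x, (0 <= Phi x)%E, (\int[mu]_x Phi x <= K%:E)%E &
      forall x r, S x -> ~ poles x -> 0 < r -> r <= dl ->
        (wint mu F (B x r) < +oo)%E /\
        (((`|rho x| * bavg F x r) `^ p x)%:E <= Phi x)%E]].

Lemma controlledU S S' : controlled S -> controlled S' -> controlled (S `|` S').
Proof.
move=> [K [dl [K0 dl0 H]]] [K' [dl' [K'0 dl'0 H']]].
exists (K + K'), (Num.min dl dl'); split; first exact: addr_gt0.
  by rewrite lt_min dl0.
move=> F HF; have [Phi [m1 Phi0 I1 P1]] := H F HF.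
have [Phi' [m2 Phi'0 I2 P2]] := H' F HF.
exists (fun x => Phi x + Phi' x)%E; split.
- exact: emeasurable_funD.
- by move=> x; exact: adde_ge0.
- by rewrite ge0_integralD// EFinD; exact: leeD.
move=> x r [Sx|Sx] xP r0; rewrite le_min => /andP[rd rd'].
  have [fin H1] := P1 x r Sx xP r0 rd; split=> //.
  by apply: (le_trans H1); rewrite leeDl.
have [fin H1] := P2 x r Sx xP r0 rd'; split=> //.
by apply: (le_trans H1); rewrite leeDr.
Qed.

(** This is enough for radii above the threshold, whose averages are bounded by a constant. *)
Definition dominated S := exists psi : X -> R, [/\ measurable_fun setT psi,
  forall x, 0 <= psi x, (nint mu psi < +oo)%E &
  forall x, S x -> ~ poles x -> `|rho x| `^ p x <= psi x].

Lemma dominatedU S S' : dominated S -> dominated S' -> dominated (S `|` S').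
Proof.
move=> [f [mf f0 If Hf]] [g [mg g0 Ig Hg]].
exists (fun x => f x + g x); split.
- exact: measurable_funD.
- by move=> x; rewrite addr_ge0.
- by rewrite nintD// lte_add_pinfty.
move=> x [Sx|Sx] xP; first by apply: (le_trans (Hf x Sx xP)); rewrite lerDl.
by apply: (le_trans (Hg x Sx xP)); rewrite lerDr.
Qed.

(** Supplies the bound [K0] on the integral over the central ball that [far_bound] and
    [large_ball_bound] ask for. *)
Definition integrable_on Q := exists K : R, forall F, unit_modular F ->
  (wint mu F Q <= K%:E)%E.

Lemma integrable_onU Q Q' : measurable Q -> measurable Q' ->
  integrable_on Q -> integrable_on Q' -> integrable_on (Q `|` Q').
Proof.
move=> mQ mQ' [K HK] [K' HK']; exists (K + K') => F HF.
have [mF F0 _] := HF.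
apply: (@le_trans _ _ (wint mu F Q + wint mu F Q')%E); last first.
  by rewrite EFinD; apply: leeD; [exact: HK|exact: HK'].
rewrite /wint -nintD; last 4 first.
- exact: measurable_mul_indic.
- exact: measurable_mul_indic.
- by move=> x; rewrite mulr_ge0 ?indic_ge0.
- by move=> x; rewrite mulr_ge0 ?indic_ge0.
apply: le_nint => x; first by rewrite mulr_ge0 ?indic_ge0.
rewrite -mulrDr ler_wpM2l// [leLHS]indicE.
case: (boolP (x \in _)) => [|_]; last by rewrite addr_ge0 ?indic_ge0.
rewrite inE => -[Qx|Qx]; rewrite !indicE (mem_set Qx).
  by rewrite lerDl.
by rewrite lerDr.
Qed.

Lemma controlled_piece (v : X -> R) Q S (Rb Cr dS s t : R) :
  1 < s -> 1 < t -> doubling_weight d mu v -> Acond d mu s v ->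
  measurable Q -> 0 < Rb -> Q `<=` B x0 Rb -> (forall y, Q y -> s * t <= p y) ->
  mu poles = 0%E -> 0 < Cr ->
  (forall y, Q y -> ~ poles y -> `|rho y| `^ p y <= Cr * v y) ->
  (forall y, Q y -> ~ poles y -> v y <= Cr * `|rho y| `^ p y) ->
  0 < dS -> (forall x, S x -> B x dS `<=` Q) ->
  controlled S /\ dominated S.
Proof.
move=> s1 t1 dw Ac mQ Rb0 QB pQ nP Cr0 Hr1 Hr2 dS0 SQ.
have v0 := dw_ge0 dw; have mv := dw_meas dw.
split.
  have [K [dl [K0 dl0 H]]] := local_bound hs s1 t1 dw Ac mp p_gt0 ppp mQ Rb0 QB pQ A0
    logH (measurable_poles hs xs) nP Cr0 Hr1 Hr2 dS0 SQ.
  by exists K, dl; split=> // F [mF F0 IF]; exact: H.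
exists (fun x => Cr * (v x * \1_Q x)); split.
- by apply: measurable_funM => //; exact: measurable_mul_indic.
- by move=> x; rewrite !mulr_ge0 ?indic_ge0 ?(ltW Cr0).
- rewrite nintZ ?(ltW Cr0)//; last 2 first.
  + exact: measurable_mul_indic.
  + by move=> x; rewrite mulr_ge0 ?indic_ge0.
  have : (wint mu v Q <= wint mu v (B x0 Rb))%E by exact: le_wint.
  rewrite (wballmE _ dw)// => /le_lt_trans/(_ (ltry _)) fin.
  by apply: lte_mul_pinfty; rewrite ?lee_fin ?(ltW Cr0).
move=> x Sx xP; have Qx : Q x by apply: SQ Sx _ _; exact: qball_center hs _ _ dS0.
by rewrite indicE mem_set// mulr1 Hr1.
Qed.

End assembly.

(** * Bounded and distant points together *)

Section modular_bound.
Context (R : realType) (disp : measure_display) (X : measurableType disp).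
Variables (d : X -> X -> R) (mu : {measure set X -> \bar R}) (c0 : R).
Hypothesis hs : homogeneous d mu c0.
Local Notation B := (qball d).
Local Notation bavg := (bavg d mu).
Implicit Types (x y z : X) (r s t m : R) (F : X -> R) (S Q : set X).
Variables (p : X -> R) (pm pp A : R).
Hypotheses (mp : measurable_fun setT p) (pm1 : 1 < pm) (A0 : 0 < A).
Hypotheses (pmp : forall x, pm <= p x) (ppp : forall x, p x <= pp).
Hypothesis logH : forall x y, 0 < d x y -> d x y <= 2^-1 ->
  `|p x - p y| <= A / ln (1 / d x y).
Variables (x0 : X) (N : nat) (xs : 'I_N -> X) (w : 'I_N.+1 -> R -> R).
Hypotheses (xs_inj : injective xs) (Ww : forall k, Wtilde (w k)).
Local Notation rho := (radial_weight d x0 xs w).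
Local Notation wk := (fun k => w (lift ord0 k)).
Local Notation poles := (poles xs).
Local Notation controlled := (controlled d mu p x0 xs w).
Local Notation dominated := (dominated d mu p x0 xs w).
Local Notation integrable_on := (integrable_on d mu p x0 xs w).
Local Notation unit_modular := (unit_modular d mu p x0 xs w).

Let w0 k t : 0 < t -> 0 < w k t. Proof. by case: (Ww k) => _ + _ _; apply. Qed.
Let p1 x : 1 < p x. Proof. exact: lt_le_trans pm1 _. Qed.
Let p_gt0 x : 0 < p x. Proof. exact: lt_trans (p1 x). Qed.

Lemma radial_weight_gt0 x : ~ poles x -> 0 < rho x.
Proof.
move=> xP; apply: mulr_gt0.
  by apply: w0; rewrite ltr_pwDl// (hs_ge0 hs).
by apply: prodr_gt0 => k _; apply: w0; exact: (dist_pole_gt0 hs k xP).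
Qed.

Hypothesis local_idx : forall k, exists a b m, [/\ (a%:E < m_idx (wk k))%E,
  (M_idx (wk k) < b%:E)%E, (m%:E < m_mu d mu)%E, 0 < m &
  - (a * p (xs k)) < m /\ b * p (xs k) < m * (p (xs k) - 1)].

Lemma null_poles : mu poles = 0%E.
Proof.
apply: (poles_null hs) => k; have [a [b [m [Ha Hb Hm m0 [am bm]]]]] := local_idx k.
by have [] := weight_near_pole hs pm1 A0 pmp ppp logH x0 xs_inj Ww Ha Hb Hm m0 am bm.
Qed.

(** The ball is covered by neighbourhoods of the poles, with the weights of [weight_near_pole], and
    a remainder away from them, with v = 1. Each piece comes with a larger set on which the weights
    are compared, because small balls about its points must stay inside. *)
Lemma near_region R2 : 0 < R2 ->
  [/\ controlled (B x0 R2), dominated (B x0 R2) & integrable_on (B x0 R2)].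
Proof.
move=> R20; have c00 := hs_c0_gt0 hs; have c01 := hs_c0 hs; have mB := hs_meas hs.
have mP := measurable_poles hs xs; have nP := null_poles.
have [tau tau0 Htau] : exists2 e, 0 < e & forall k, exists v s t Cr,
     [/\ 1 < s, 1 < t, doubling_weight d mu v, Acond d mu s v &
      [/\ 0 < Cr, forall y, B (xs k) e y -> s * t <= p y,
      forall y, B (xs k) e y -> ~ poles y -> `|rho y| `^ p y <= Cr * v y &
      forall y, B (xs k) e y -> ~ poles y -> v y <= Cr * `|rho y| `^ p y]].
  have [||e e0 He] := @finite_lower R 'I_N (fun k e => forall tau, 0 < tau -> tau <= e ->
    exists v s t Cr, [/\ 1 < s, 1 < t, doubling_weight d mu v, Acond d mu s v &
      [/\ 0 < Cr, forall y, B (xs k) tau y -> s * t <= p y,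
      forall y, B (xs k) tau y -> ~ poles y -> `|rho y| `^ p y <= Cr * v y &
      forall y, B (xs k) tau y -> ~ poles y -> v y <= Cr * `|rho y| `^ p y]]).
  - by move=> k e e' H e'0 ee' tau tau0 te; apply: H => //; exact: le_trans ee'.
  - move=> k; have [a [b [m [Ha Hb Hm m0 [am bm]]]]] := local_idx k.
    by have [] := weight_near_pole hs pm1 A0 pmp ppp logH x0 xs_inj Ww Ha Hb Hm m0 am bm.
  by exists e => // k; exact: He.
have [dm dm1 Hdm] : exists2 dm, 1 <= dm & forall k, d x0 (xs k) <= dm.
  apply: finite_upper => [k e e' H1 H2|k]; first exact: le_trans H2.
  by exists (d x0 (xs k)).
(* A ball of radius [sg] about a point of B (xs k) sg stays in B (xs k) tau, and a ball of radius
   [eta] about a point at distance at least [sg] from the poles keeps distance at least [eta] from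
   them. *)
pose sg := tau / (2 * c0); have sg0 : 0 < sg by rewrite divr_gt0// mulr_gt0.
pose eta := sg / (2 * c0); have eta0 : 0 < eta by rewrite divr_gt0// mulr_gt0.
have sgE : tau = 2 * c0 * sg by rewrite /sg mulrC divfK// gt_eqF// mulr_gt0.
have etaE : sg = 2 * c0 * eta by rewrite /eta mulrC divfK// gt_eqF// mulr_gt0.
pose Rb := c0 * (R2 + eta) + c0 * (dm + tau).
have Rb0 : 0 < Rb by rewrite addr_gt0// mulr_gt0//; lra.
have Rb1 : c0 * (R2 + eta) <= Rb by rewrite lerDl mulr_ge0//; lra.
have Rb2 : c0 * (dm + tau) <= Rb by rewrite lerDr mulr_ge0//; lra.
pose S0 : set X := [set x | d x0 x < R2 /\ forall k, sg <= d x (xs k)].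
pose Q0 : set X := [set y | d x0 y < Rb /\ forall k, eta <= d y (xs k)].
have mQ0 : measurable Q0.
  rewrite (_ : Q0 = B x0 Rb `&` ~` (\bigcup_(k in [set: 'I_N]) B (xs k) eta)).
    apply: measurableI => //; apply: measurableC.
    by apply: fin_bigcup_measurable.
  apply/seteqP; split => y [yR H]; split=> //.
    by move=> [k _]; rewrite /qball /= (hs_sym hs) ltNge H.
  move=> k; rewrite leNgt; apply/negP => yk; apply: H; exists k => //.
  by rewrite /qball /= (hs_sym hs).
have Q0B : Q0 `<=` B x0 Rb by move=> y [].
have [D D1 HD] := factor_bounds hs x0 xs Ww Rb0 eta0.
have HD0 y : Q0 y -> (D `^ pp)^-1 <= `|rho y| `^ p y /\ `|rho y| `^ p y <= D `^ pp.
  move=> [yR Hk]; have [H1 H2] := HD predT y yR (fun k _ => Hk k).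
  have H3 : 0 < D^-1 by rewrite invr_gt0; lra.
  rewrite -/(rho y) in H1 H2; rewrite gtr0_norm; last exact: lt_le_trans H1.
  by apply: powR_bounds => //; exact: ltW.
have Dp0 : 0 < D `^ pp by rewrite powR_gt0//; lra.
have pm0 : 0 < pm by exact: lt_trans pm1.
(* Both s and t are taken equal to the square root of [pm], so that s t = pm is at most p
   everywhere. *)
have sq1 : 1 < Num.sqrt pm by rewrite -sqrtr1 ltr_sqrt.
have [Ac1 dw1] := Acond_cst1 hs sq1.
have sqpm y : Q0 y -> Num.sqrt pm * Num.sqrt pm <= p y.
  by move=> _; rewrite -expr2 sqr_sqrtr// ltW.
have H10 y : Q0 y -> ~ poles y -> `|rho y| `^ p y <= D `^ pp * 1.
  by move=> /HD0[_ +] _; rewrite mulr1.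
have H20 y : Q0 y -> ~ poles y -> 1 <= D `^ pp * `|rho y| `^ p y.
  by move=> /HD0[H _] _; rewrite -ler_pdivrMl// mulr1.
have S0Q x : S0 x -> B x eta `<=` Q0.
  move=> [xR xk] y xy; split.
    apply: (lt_le_trans _ Rb1); apply: le_lt_trans (hs_tri hs x0 y x) _.
    by rewrite ltr_pM2l// ltrD.
  move=> k; have := le_trans (xk k) (hs_tri hs x (xs k) y).
  rewrite {1}etaE [2 * c0]mulrC -mulrA ler_pM2l// => H.
  by move: xy; rewrite /qball /=; lra.
have [con0 dom0] := controlled_piece hs mp pm1 A0 pmp ppp logH sq1 sq1 dw1 Ac1
  mQ0 Rb0 Q0B sqpm nP Dp0 H10 H20 eta0 S0Q.
have int0 : integrable_on Q0.
  have [K HK] := wint_flat_bound hs mp (fun x => ltW (p1 x)) Rb0 mQ0 Q0B mP nP Dp0 H20.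
  by exists K => F [mF F0 IF]; exact: HK.
have QkB k : B (xs k) tau `<=` B x0 Rb.
  by apply: (qball_sub_ball hs); apply: le_trans Rb2; rewrite ler_pM2l// lerD2r.
have SkQ k x : B (xs k) sg x -> B x sg `<=` B (xs k) tau.
  move=> xk; apply: (qball_sub_ball hs); rewrite sgE [2 * c0]mulrC -mulrA ler_pM2l//.
  by move: xk; rewrite /qball /=; lra.
have piece k : [/\ controlled (B (xs k) sg), dominated (B (xs k) sg) &
    integrable_on (B (xs k) tau)].
  have [v [s [t [Cr [s1 t1 dw Ac [Cr0 pst Hr1 Hr2]]]]]] := Htau k.
  have [con dom] := controlled_piece hs mp pm1 A0 pmp ppp logH s1 t1 dw Ac
    (mB _ _) Rb0 (QkB k) pst nP Cr0 Hr1 Hr2 sg0 (SkQ k).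
  split=> //.
  have ps y : B (xs k) tau y -> s <= p y by move=> /pst; nra.
  have [K HK] := wint_ball_bound hs s1 dw Ac mp p_gt0 (mB _ _) tau0 (@subset_refl _ _) ps
    mP nP Cr0 Hr2.
  by exists K => F [mF F0 IF]; exact: HK.
pose SU (l : seq 'I_N) : set X := S0 `|` [set x | exists2 k, k \in l & B (xs k) sg x].
pose QU (l : seq 'I_N) : set X := Q0 `|` [set x | exists2 k, k \in l & B (xs k) tau x].
have [con [dom [_ int_]]] : controlled (SU (enum 'I_N)) /\ (dominated (SU (enum 'I_N)) /\
    (measurable (QU (enum 'I_N)) /\ integrable_on (QU (enum 'I_N)))).
  elim: (enum 'I_N) => [|k l [IH1 [IH2 [IH3 IH4]]]].
    have -> : SU [::] = S0.
      by apply/seteqP; split => [x []//|x]; [move=> []|left].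
    have -> : QU [::] = Q0.
      by apply/seteqP; split => [x []//|x]; [move=> []|left].
    by [].
  have [c1 d1 i1] := piece k.
  have -> : SU (k :: l) = B (xs k) sg `|` SU l.
    apply/seteqP; split => [x [Sx|[j]]|x [xk|[Sx|[j jl xj]]]].
    - by right; left.
    - rewrite inE => /orP[/eqP->|jl] xj; first by left.
      by right; right; exists j.
    - by right; exists k => //; rewrite inE eqxx.
    - by left.
    - by right; exists j => //; rewrite inE jl orbT.
  have -> : QU (k :: l) = B (xs k) tau `|` QU l.
    apply/seteqP; split => [x [Sx|[j]]|x [xk|[Sx|[j jl xj]]]].
    - by right; left.
    - rewrite inE => /orP[/eqP->|jl] xj; first by left.
      by right; right; exists j.
    - by right; exists k => //; rewrite inE eqxx.
    - by left.
    - by right; exists j => //; rewrite inE jl orbT.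
  split; first exact: controlledU.
  split; first exact: dominatedU.
  split; first exact: measurableU.
  exact: integrable_onU.
have cov x : B x0 R2 x -> SU (enum 'I_N) x.
  move=> xR; have [H|] := pselect (forall k, sg <= d x (xs k)); first by left.
  move=> /existsNP[k /negP]; rewrite -ltNge => xk; right; exists k.
    by rewrite mem_enum.
  by rewrite /qball /= (hs_sym hs).
have covQ x : B x0 R2 x -> QU (enum 'I_N) x.
  move=> /cov[[xR xk]|[k kl xk]].
    left; split.
      apply: (lt_le_trans xR); apply: le_trans Rb1.
      by nra.
    move=> k; apply: le_trans (xk k); rewrite etaE; nra.
  right; exists k => //; apply: qball_sub xk; rewrite sgE; nra.
split.
- have [K [dl [K0 dl0 H]]] := con; exists K, dl; split=> // F HF.
  have [Phi [m1 Phi0 I1 P1]] := H F HF; exists Phi; split=> // x r xR; exact/P1/cov.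
- have [psi [m1 psi0 I1 P1]] := dom; exists psi; split=> // x xR; exact/P1/cov.
- have [K HK] := int_; exists K => F HF; have [_ F0 _] := HF.
  by apply: le_trans (HK F HF); exact: le_wint.
Qed.

Variables (r0 pinf m : R) (a b : 'I_N.+1 -> R).
Hypotheses (pinf1 : 1 < pinf) (m0 : 0 < m).
Hypothesis p_far : forall x, ~ B x0 r0 x -> p x = pinf.
Hypothesis idx_lower : forall k, ((a k)%:E < m_idx_infty (w k))%E.
Hypothesis idx_upper : forall k, (M_idx_infty (w k) < (b k)%:E)%E.
Hypothesis m_lt : (m%:E < m_mu_infty d mu x0)%E.
Hypothesis am : - ((\sum_k a k) * pinf) < m.
Hypothesis bm : (\sum_k b k) * pinf < m * (pinf - 1).

(** Points beyond R2 = 2 c0 R1 fall under [far_bound]. For the others, radii up to [dl] are handled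
    by [near_region]; larger ones have averages at most [C] by [large_ball_bound], so (1 + C)^pp
    times [psi] dominates. *)
Theorem modular_bound : exists2 K, 0 < K & forall F, unit_modular F ->
  exists Phi : X -> \bar R, [/\ measurable_fun setT Phi,
    forall x, (0 <= Phi x)%E, (\int[mu]_x Phi x <= K%:E)%E &
    forall x r, ~ poles x -> 0 < r ->
      (wint mu F (B x r) < +oo)%E /\
      (((`|rho x| * bavg F x r) `^ p x)%:E <= Phi x)%E].
Proof.
have c00 := hs_c0_gt0 hs; have c01 := hs_c0 hs.
have [Rinf [v [s [Cr [Rinf0 s1 sq dw [Ac Cr0 Hr1 Hr2]]]]]] :=
  weight_at_infinity hs xs Ww pinf1 m0 idx_lower idx_upper m_lt am bm.
pose R1 := Num.max r0 Rinf; pose R2 := 2 * c0 * R1.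
have R10 : 0 < R1 by rewrite lt_max Rinf0 orbT.
have R20 : 0 < R2 by rewrite !mulr_gt0.
have far x : ~ B x0 R1 x -> R1 <= d x0 x.
  by rewrite /qball /= => /negP; rewrite -leNgt.
have pfar x : ~ B x0 R1 x -> p x = pinf.
  move=> xR; apply: p_far => xr; apply: xR; apply: qball_sub xr.
  by rewrite le_max lexx.
have inf_le x : ~ B x0 R1 x -> Rinf <= d x0 x.
  by move=> /far; apply: le_trans; rewrite le_max lexx orbT.
have [_ _ [K1 HK1]] := near_region R10.
have [[Kn [dl [Kn0 dl0 Hn]]] [psi [mpsi psi0 Ipsi Hpsi]] _] := near_region R20.
pose K0 := `|K1|; have K00 : 0 <= K0 by exact: normr_ge0.
have HK0 F : unit_modular F -> (wint mu F (B x0 R1) <= K0%:E)%E.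
  by move=> HF; apply: (le_trans (HK1 F HF)); rewrite lee_fin ler_norm.
have [Kf [Kf0 Hf]] := far_bound hs s1 sq R10 Cr0 K00 dw Ac mp p_gt0 pfar
  (fun x xR => Hr1 x (inf_le x xR)) (fun x xR => Hr2 x (inf_le x xR)).
have [C [C0 HC]] := large_ball_bound hs s1 sq R10 Cr0 K00 dw Ac mp p_gt0 pfar
  (fun x xR => Hr2 x (inf_le x xR)) R20 dl0.
pose C1 := 1 + C; have C11 : 1 <= C1 by rewrite lerDl.
pose CP := C1 `^ pp; have CP0 : 0 <= CP by exact: powR_ge0.
pose Kp := fine (nint mu psi).
have KpE : nint mu psi = Kp%:E by rewrite /Kp fineK// ge0_fin_numE// nint_ge0.
have Kp0 : 0 <= Kp by rewrite fine_ge0// nint_ge0.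
exists (Kn + Kf + CP * Kp); first by rewrite ltr_wpDr ?mulr_ge0// addr_gt0.
move=> F HF; have [mF F0 IF] := HF.
have [Phn [mPhn Phn0 IPhn HPhn]] := Hn F HF.
have [Phf [mPhf Phf0 IPhf HPhf]] := Hf F mF F0 (HK0 F HF) IF.
exists (fun x => Phn x + Phf x + (CP * psi x)%:E)%E.
have mCp : measurable_fun setT (fun x => CP * psi x) by exact: measurable_funM.
have Cp0 x : 0 <= CP * psi x by rewrite mulr_ge0.
have Pnf0 x : (0 <= Phn x + Phf x)%E by exact: adde_ge0.
have mPnf : measurable_fun setT (fun x => Phn x + Phf x)%E by exact: emeasurable_funD.
split.
- by apply: emeasurable_funD => //; exact/measurable_EFinP.
- by move=> x; rewrite adde_ge0// lee_fin.
- rewrite ge0_integralD//; last 2 first.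
  + by move=> x _; rewrite lee_fin.
  + exact/measurable_EFinP.
  rewrite ge0_integralD// -/(nint mu (fun x => (CP * psi x)%R)) nintZ// KpE.
  by rewrite EFinD EFinM; apply: leeD => //; rewrite EFinD; exact: leeD.
move=> x r xP r_0; have [xR|xR] := ltP (d x0 x) R2; last first.
  have [fin H] := HPhf x r xR r_0; split=> //.
  apply: (le_trans H); apply: (@le_trans _ _ (Phn x + Phf x)%E).
    by rewrite leeDr.
  by rewrite leeDl// lee_fin.
have [rd|dr] := leP r dl.
  have [fin H] := HPhn x r xR xP r_0 rd; split=> //.
  apply: (le_trans H); apply: (@le_trans _ _ (Phn x + Phf x)%E).
    by rewrite leeDl.
  by rewrite leeDl// lee_fin.
have [fin avg] := HC F mF F0 (HK0 F HF) IF x r xR (ltW dr); split=> //.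
have avg0 := bavg_ge0 hs x F0 r_0.
apply: (@le_trans _ _ (CP * psi x)%:E); last by rewrite leeDr.
rewrite lee_fin powRM// mulrC ler_pM ?powR_ge0//; last exact: Hpsi.
apply: (@le_trans _ _ (C1 `^ p x)); last exact: ler_powR.
apply: ge0_ler_powR; rewrite ?nnegrE ?(ltW (p_gt0 x))//; first by lra.
by apply: (le_trans avg); rewrite lerDr.
Qed.

End modular_bound.

(** * From modulars to norms *)

Section maximal_modular.
Context (R : realType) (disp : measure_display) (X : measurableType disp).
Variables (d : X -> X -> R) (mu : {measure set X -> \bar R}) (c0 : R).
Hypothesis hs : homogeneous d mu c0.
Local Notation B := (qball d).
Local Notation normc := Normc.normc.
Implicit Types (x y : X) (f : X -> R[i]) (p rho : X -> R) (g h : X -> \bar R) (l : R).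

Lemma normc_ge0 (z : R[i]) : 0 <= normc z.
Proof. by case: z => a b /=; exact: sqrtr_ge0. Qed.

Lemma measurable_normc f : measurable_fun setT (fun x => complex.Re (f x)) ->
  measurable_fun setT (fun x => complex.Im (f x)) ->
  measurable_fun setT (fun x => normc (f x)).
Proof.
move=> mr mi; rewrite (_ : (fun _ => _) = (fun x =>
  (complex.Re (f x) ^+ 2 + complex.Im (f x) ^+ 2) `^ 2^-1)); last first.
  by apply/funext => x; case: (f x) => a b /=; rewrite powR12_sqrt// addr_ge0// sqr_ge0.
apply: measurable_fun_powR_cst; apply: measurable_funD; exact: measurable_funX.
Qed.

Lemma maximal_le f l (c : R) x : 0 < l ->
  measurable_fun setT (fun y => normc (f y)) ->
  (forall r, 0 < r -> (wint mu (fun y => (normc (f y) / l)%R) (B x r) < +oo)%E /\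
     bavg d mu (fun y => normc (f y) / l) x r <= c) ->
  (maximal_function d mu f x <= (l * c)%:E)%E.
Proof.
move=> l0 mf H; apply: ge_ereal_sup => _ [r /= r0 <-]; have [fin avg] := H r r0.
have F0 y : 0 <= normc (f y) / l by rewrite divr_ge0 ?normc_ge0 ?(ltW l0).
have wE : (\int[mu]_(y in B x r) modulus f y = l%:E *
    wint mu (fun y => (normc (f y) / l)%R) (B x r))%E.
  rewrite /wint -nintZ ?(ltW l0)//; last 2 first.
  - apply: measurable_mul_indic; last exact: hs_meas hs _ _.
    by apply: measurable_funM.
  - by move=> y; rewrite mulr_ge0 ?indic_ge0.
  rewrite /modulus nint_setE; apply: eq_nint => y.
  by rewrite mulrA [l * _]mulrC divfK// gt_eqF.
have w0 : (0 <= wint mu (fun y => (normc (f y) / l)%R) (B x r))%E.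
  by apply: nint_ge0 => y; rewrite mulr_ge0 ?indic_ge0.
rewrite wE -[X in (_ * (_ * X))%E]fineK; last by rewrite ge0_fin_numE.
rewrite -!EFinM lee_fin mulrCA ler_pM2l// mulrC; exact: avg.
Qed.

(** Every l admissible for g makes C l admissible for h, and the norm is the infimum of the
    admissible numbers. *)
Lemma lp_norm_scale p rho g h (C : R) : 0 < C ->
  (forall l, 0 < l ->
     (\int[mu]_x (`| (rho x)%:E * g x * (l^-1)%:E | `^ (p x)) <= 1)%E ->
     (\int[mu]_x (`| (rho x)%:E * h x * ((C * l)^-1)%:E | `^ (p x)) <= 1)%E) ->
  (lp_norm mu p rho h <= C%:E * lp_norm mu p rho g)%E.
Proof.
move=> C0 H; rewrite -lee_pdivrMl//; apply: le_ereal_inf_tmp => _ [l [l0 Hl] <-].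
rewrite lee_pdivrMl// -EFinM; apply: ereal_inf_lbound; exists (C * l) => //.
by split; [exact: mulr_gt0|exact: H].
Qed.

(** Provides a point outside the given ball, which makes p_infty a value of p and hence larger than
    1. *)
Lemma unbounded_far x r : unbounded_space d -> exists y, ~ B x r y.
Proof.
move=> ub; apply: contrapT => /forallNP H.
have : (ereal_sup [set (d xy.1 xy.2)%:E | xy in [set: X * X]] <=
  (c0 * (r + r))%:E)%E.
  apply: ge_ereal_sup => _ [[y z] _ <-] /=; rewrite lee_fin.
  apply: (le_trans (hs_tri hs y z x)); rewrite ler_wpM2l ?(ltW (hs_c0_gt0 hs))//.
  have /contrapT := H y; have /contrapT := H z; rewrite /qball /= [d y x](hs_sym hs).
  by lra.
by rewrite ub.
Qed.

Lemma modular_le_scaled (S : set X) (Phi g : X -> \bar R) (C : R) :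
  measurable S -> mu S = 0%E -> measurable_fun setT Phi -> (forall x, 0 <= Phi x)%E ->
  1 <= C -> (\int[mu]_x Phi x <= C%:E)%E ->
  (forall x, 0 <= g x)%E -> (forall x, ~ S x -> g x <= C^-1%:E * Phi x)%E ->
  (\int[mu]_x g x <= 1)%E.
Proof.
move=> mS S0 mPhi Phi0 C1 IPhi g0 gPhi; have C0 : 0 < C by lra.
have CP0 x : (0 <= C^-1%:E * Phi x)%E by rewrite mule_ge0// lee_fin invr_ge0 ltW.
(* The majorant is raised to +oo on the null set [S], which leaves its integral unchanged. *)
apply: (@le_trans _ _ (\int[mu]_x ((C^-1%:E * Phi x) + (+oo * (\1_S x)%:E)))%E).
  apply: le_integral_ge0 => // x; rewrite indicE; case: (boolP (x \in S)) => xS.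
    by rewrite mule1 addey ?leey// -ltNye (lt_le_trans _ (CP0 x)).
  by rewrite mule0 adde0; apply: gPhi; move: xS; rewrite notin_setE.
have mS1 : measurable_fun setT (fun x => (\1_S x : R)%:E).
  by apply: measurableT_comp => //; exact: measurable_indic.
rewrite ge0_integralD//; last 2 first.
- exact: measurable_funeM.
- exact: measurable_funeM.
rewrite ge0_integralZl//; last by rewrite lee_fin invr_ge0 ltW.
rewrite ge0_integralZl//.
rewrite integral_indic// setIT S0 mule0 adde0 lee_pdivrMl// mule1; exact: IPhi.
Qed.

End maximal_modular.

Theorem theoremC (R : realType) (disp : measure_display)
    (X : measurableType disp) (d : X -> X -> R)
    (mu : {measure set X -> \bar R})
    (p : X -> R) (x0 : X) (r0 p_infty : R)
    (N : nat) (xs : 'I_N -> X) (w : 'I_N.+1 -> R -> R) :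
  doubling_space d mu ->
  unbounded_space d ->
  exponent_class d p ->
  0 < r0 ->
  (forall x, ~ qball d x0 r0 x -> p x = p_infty) ->
  injective xs ->
  (forall k, Wtilde (w k)) ->
  (forall k : 'I_N,
    [/\ (- (m_mu d mu * (p (xs k))^-1%:E) < m_idx (w (lift ord0 k)))%E,
        (m_idx (w (lift ord0 k)) <= M_idx (w (lift ord0 k)))%E &
        (M_idx (w (lift ord0 k)) <
           m_mu d mu * (conj_exp (p (xs k)))^-1%:E)%E]) ->
  (- (m_mu_infty d mu x0 * p_infty^-1%:E) <
     \sum_(k < N.+1) m_idx_infty (w k))%E ->
  (\sum_(k < N.+1) m_idx_infty (w k) <=
     \sum_(k < N.+1) M_idx_infty (w k))%E ->
  (\sum_(k < N.+1) M_idx_infty (w k) <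
     m_mu_infty d mu x0 * (conj_exp p_infty)^-1%:E -
     (M_mu_infty d mu x0 - m_mu_infty d mu x0) * p_infty^-1%:E)%E ->
  let rho := radial_weight d x0 xs w in
  exists2 C : R, 0 < C &
    forall f : X -> R[i], lp_space mu p rho f ->
      (lp_norm mu p rho (maximal_function d mu f) <=
         C%:E * lp_norm mu p rho (modulus f))%E.
Proof.
move=> /doubling_homogeneous[c0 hs] unb [mp pinf1 psup [A A0 logH]] r00 p_far inj Ww
  Hloc H1 H2 H3 rho.
have [pm pm1 pmp] : exists2 pm : R, 1 < pm & forall x, pm <= p x.
  have [pm H H'] := lte_dense_fin pinf1; exists pm; first by rewrite -lte_fin.
  move=> x; rewrite -lee_fin; apply: le_trans (ltW H') _.
  by apply: ereal_inf_lbound; exists x.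
have [pp ppp] : exists pp : R, forall x, p x <= pp.
  have [pp H H'] := lte_dense_fin psup; exists pp => x; rewrite -lee_fin.
  by apply: le_trans (ltW H); apply: ereal_sup_ubound; exists x.
have p1 x : 1 < p x by exact: lt_le_trans (pmp x).
have p_gt0 x : 0 < p x by exact: lt_trans (p1 x).
have pi1 : 1 < p_infty.
  by have [y /p_far <-] := unbounded_far hs x0 r0 unb.
have loc k : exists a b m, [/\ (a%:E < m_idx (w (lift ord0 k)))%E,
    (M_idx (w (lift ord0 k)) < b%:E)%E, (m%:E < m_mu d mu)%E, 0 < m &
    - (a * p (xs k)) < m /\ b * p (xs k) < m * (p (xs k) - 1)].
  by have [h1 h2 h3] := Hloc k; exact: local_exponents (p1 _) h1 h2 h3.
have [a [b [m [Ha Hb Hm m0 [am bm]]]]] := infinity_exponents pi1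
  (m_mu_infty_ge0 hs x0) (m_mu_infty_le_M hs x0) (M_mu_infty_lty hs x0) H1 H2 H3.
have [K K0 HK] := modular_bound hs mp pm1 A0 pmp ppp logH inj Ww loc pi1 m0 p_far
  Ha Hb Hm am bm.
have nP : mu (poles xs) = 0%E := null_poles hs pm1 A0 pmp ppp logH x0 inj Ww loc.
(* Raising to the power p(x) >= 1 turns the division by C >= 1 into a factor of at most 1 / C, which
   brings a modular bounded by K below 1. *)
pose C := 1 + K; have C1 : 1 <= C by rewrite lerDl ltW.
have C0 : 0 < C by lra.
exists C => // f [mre mim _]; have mf := measurable_normc mre mim.
apply: lp_norm_scale => // l l0 Hl.
pose F y := Normc.normc (f y) / l.
have F0 y : 0 <= F y by rewrite divr_ge0 ?normc_ge0 ?(ltW l0).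
have uF : unit_modular d mu p x0 xs w F.
  split=> //; first exact: measurable_funM.
  apply: le_trans Hl; rewrite le_eqVlt; apply/orP; left; apply/eqP.
  apply: eq_integral => x _; rewrite /modulus -!EFinM -mulrA -/(F x).
  by rewrite abse_EFin poweR_EFin normrM [`|F x|]ger0_norm.
have [Phi [mPhi Phi0 IPhi HPhi]] := HK F uF.
apply: (modular_le_scaled (measurable_poles hs xs) nP mPhi Phi0 C1).
- by apply: (le_trans IPhi); rewrite lee_fin lerDr.
- by move=> x; exact: poweR_ge0.
move=> x xP; have rho0 : 0 < rho x := radial_weight_gt0 hs x0 Ww xP.
have [Py|] := eqVneq (Phi x) +oo%E.
  by rewrite Py gt0_muley ?leey// lte_fin invr_gt0.
rewrite -ltey => Pfin.
have PE : Phi x = (fine (Phi x))%:E by rewrite fineK// ge0_fin_numE.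
set phi := fine (Phi x) in PE; have phi0 : 0 <= phi by exact: fine_ge0.
(* The root of order p(x) of the majorant bounds the averages uniformly in r, so the supremum over r
   can be taken. *)
have avg r : 0 < r -> (wint mu F (qball d x r) < +oo)%E /\
    bavg d mu F x r <= phi `^ (p x)^-1 / rho x.
  move=> r_0; have [fin H] := HPhi x r xP r_0; split=> //.
  have a0 : 0 <= bavg d mu F x r := bavg_ge0 hs x F0 r_0.
  move: H; rewrite PE lee_fin (gtr0_norm rho0) => H.
  rewrite ler_pdivlMr// mulrC -[leLHS]powRr1; last exact: (mulr_ge0 (ltW rho0) a0).
  rewrite -(divff (lt0r_neq0 (p_gt0 x))) powRrM.
  by apply: ge0_ler_powR; rewrite ?nnegrE ?powR_ge0// invr_ge0 ltW.
have M0 : (0 <= maximal_function d mu f x)%E.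
  apply: (@le_trans _ _ ((fine (mu (qball d x 1)))^-1%:E *
    \int[mu]_(y in qball d x 1) modulus f y)%E); last first.
    by apply: ereal_sup_ubound; exists 1; rewrite /=.
  rewrite mule_ge0 ?lee_fin ?invr_ge0 ?fine_ge0//.
  by apply: integral_ge0 => y _; rewrite lee_fin normc_ge0.
have Mle := maximal_le hs l0 mf avg.
have Mfin : maximal_function d mu f x \is a fin_num.
  by rewrite ge0_fin_numE//; apply: le_lt_trans Mle _; exact: ltry.
move: M0 Mle; rewrite -(fineK Mfin); set M := fine _; rewrite !lee_fin => M0 Mle.
rewrite -!EFinM abse_EFin poweR_EFin PE -EFinM lee_fin.
have nn : 0 <= rho x * M / (C * l).
  exact: (divr_ge0 (mulr_ge0 (ltW rho0) M0) (ltW (mulr_gt0 C0 l0))).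
rewrite (ger0_norm nn).
have le1 : rho x * M / (C * l) <= C^-1 * phi `^ (p x)^-1.
  rewrite ler_pdivrMr ?mulr_gt0// mulrC.
  rewrite (_ : _ * (C * l) = l * phi `^ (p x)^-1); last by field; rewrite gt_eqF.
  by rewrite -ler_pdivlMr// -mulrA.
apply: (@le_trans _ _ ((C^-1 * phi `^ (p x)^-1) `^ p x)).
  apply: ge0_ler_powR; rewrite ?nnegrE ?(ltW (p_gt0 x))//.
  - by rewrite mulr_ge0 ?powR_ge0// invr_ge0 ltW.
rewrite powRM ?powR_ge0 ?invr_ge0 ?(ltW C0)// -powRrM mulVf ?gt_eqF// powRr1//.
rewrite ler_wpM2r// -[leRHS]powRr1 ?invr_ge0 ?(ltW C0)//.
by apply: ger_powR; [rewrite invr_gt0 C0 invf_le1|exact: ltW].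
Qed.
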